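(* Let $\Gamma$ be a finite connected metric graph, let $q:\Gamma\to\mathbb{R}$ be measurable and bounded with $q(x)\ge0$ for almost all $x\in\Gamma$, and let $\widetilde\Gamma$, with the correspondingly rescaled potential $\widetilde q$, be the graph formed by lengthening one of the edges of $\Gamma$. Write $\lambda_j,\lambda_j^+$ for the eigenvalues and positive eigenvalues of $-\Delta_{{\rm K},\Gamma,q}$, and $\widetilde\lambda_j,\widetilde\lambda_j^+$ for those of $-\Delta_{{\rm K},\widetilde\Gamma,\widetilde q}$. Then: (a) the positive eigenvalues satisfy $\widetilde\lambda_j^+\le\lambda_j^+$ for all $j\in\mathbb{N}$; (b) the eigenvalues (counting ground states) satisfy $\widetilde\lambda_j\le\lambda_j$ for all $j\in\mathbb{N}$.
   Context: A finite metric graph $\Gamma$ consists of a finite vertex set $\mathcal{V}$, a finite nonempty edge set $\mathcal{E}$ (loops and multiple edges allowed) and a length function $\ell:\mathcal{E}\to(0,\infty)$. Each edge $e$ is identified with $[0,\ell(e)]$, its two endpoints corresponding to the (possibly equal) vertices incident with $e$. A function $f$ on $\Gamma$ is a collection $(f_e)_{e\in\mathcal{E}}$ of functions $f_e:(0,\ell(e))\to\mathbb{C}$; $f\in L^2(\Gamma)$ means $f_e\in L^2(0,\ell(e))$ for all $e$. $\widetilde H^k(\Gamma)$ is the set of $f\in L^2(\Gamma)$ with $f_e\in H^k(0,\ell(e))$ for all $e$; $H^1(\Gamma)$ is the set of $f\in\widetilde H^1(\Gamma)$ that are continuous at each vertex (all traces at endpoints corresponding to the same vertex $v$ coincide; the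 common value is $f(v)$). For $f\in\widetilde H^2(\Gamma)$ and $v\in\mathcal{V}$, $\partial_\nu f(v)$ is the sum, over all edge endpoints located at $v$ (both endpoints of a loop at $v$ are counted), of the derivative of $f_e$ at that endpoint taken in the direction pointing towards $v$ (i.e. $f_e'(\ell(e))$ for the endpoint $\ell(e)$ and $-f_e'(0)$ for the endpoint $0$). Let $S$ be the operator in $L^2(\Gamma)$ with $(Sf)_e=-f_e''+q_ef_e$ on each edge and $\operatorname{dom}S=\{f\in\widetilde H^2(\Gamma)\cap H^1(\Gamma): f(v)=\partial_\nu f(v)=0\text{ for each }v\in\mathcal{V}\}$. It is closed, symmetric, densely defined with a positive lower bound; its adjoint $S^*$ acts in the same way on $\operatorname{dom}S^*=\widetilde H^2(\Gamma)\cap H^1(\Gamma)$. The perturbed Krein Laplacian $-\Delta_{{\rm K},\Gamma,q}$ is the Krein–von Neumann extension of $S$: the self-adjoint restriction of $S^*$ to $\operatorname{dom}S\dotplus\ker S^*$. Its spectrum is purely discrete and nonnegative; eigenvalues (resp. positive eigenvalues) are listed in nondecreasing order as $\lambda_1\le\lambda_2\le\dots$ (resp. $\lambda_1^+\le\lambda_2^+\le\dots$), counted with multiplicities. Lengthening an edge $e_0$: for some factor $\alpha>1$, $\widetilde\Gamma$ is the same graph as $\Gamma$ except that $e_0$ has length $\widetilde\ell(e_0)=\alpha\,\ell(e_0)$; the new potential is $\widetilde q_{e_0}(x):=\alpha^{-2}q_{e_0}(x/\alpha)$ and $\widetilde q_e=q_e$ on all other edges. *)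

(* Defs.v *)
From HB Require Import structures.
From mathcomp Require Export all_boot all_order all_algebra.
From mathcomp Require Export all_classical all_reals all_analysis.
From mathcomp Require Export complex.

Set Implicit Arguments.
Unset Strict Implicit.
Unset Printing Implicit Defensive.

Import Order.TTheory GRing.Theory Num.Theory.
Import numFieldNormedType.Exports.

Local Open Scope classical_set_scope.
Local Open Scope ring_scope.
Local Open Scope complex_scope.

Record metric_graph (R : realType) := MetricGraph {
  vert : finType;
  edge : finType;
  edge_nonempty : (0 < #|edge|)%N;
  src : edge -> vert;  (* the vertex at the endpoint 0 *)
  tgt : edge -> vert;  (* the vertex at the endpoint len e *)
  len : edge -> R;
  len_gt0 : forall e, 0 < len e }.

Definition graph_connected (R : realType) (G : metric_graph R) : Prop :=
  forall v w : vert G,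
    fingraph.connect (fun x y => [exists e : edge G,
      ((src e == x) && (tgt e == y)) || ((src e == y) && (tgt e == x))]) v w.

Section Functions.
Variables (R : realType) (G : metric_graph R).

(* f e x is meaningful only for x in [0, len e] (or almost everywhere there,
   for a function that is only in L^2). *)
Definition graph_fun := edge G -> R -> R[i].

Definition L2_interval (l : R) (u : R -> R[i]) : Prop :=
  (fun x : R => if 0 < x < l then complex.Re (u x) else 0)
    \in Lfun (@lebesgue_measure R) 2%:E /\
  (fun x : R => if 0 < x < l then complex.Im (u x) else 0)
    \in Lfun (@lebesgue_measure R) 2%:E.

Definition integral0 (u : R -> R[i]) (x : R) : R[i] :=
  (\int[@lebesgue_measure R]_(t in `[0, x]) complex.Re (u t)) +i*
  (\int[@lebesgue_measure R]_(t in `[0, x]) complex.Im (u t)).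

(* u is in H^1(0, l) and u' = du: on an interval this means that u is
   absolutely continuous with derivative du in L^2.  An element of H^1(0, l) is
   identified with its continuous representative on [0, l], so that its traces
   at the endpoints are the values u 0 and u l. *)
Definition H1_interval (l : R) (u du : R -> R[i]) : Prop :=
  L2_interval l du /\ forall x, 0 <= x <= l -> u x = u 0 + integral0 du x.

(* f is in \tilde H^2(G), with edgewise derivatives f' = f1 and f'' = f2. *)
Definition H2_tilde (f f1 f2 : graph_fun) : Prop :=
  forall e, H1_interval (len e) (f e) (f1 e) /\
            H1_interval (len e) (f1 e) (f2 e).

(* The endpoints of edges: (e, false) is 0 and (e, true) is len e. *)
Definition endpoint := (edge G * bool)%type.

Definition end_vert (p : endpoint) : vert G :=
  if p.2 then tgt p.1 else src p.1.

Definition trace (f : graph_fun) (p : endpoint) : R[i] :=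
  if p.2 then f p.1 (len p.1) else f p.1 0.

Definition vertex_continuous (f : graph_fun) : Prop :=
  forall p p' : endpoint, end_vert p = end_vert p' -> trace f p = trace f p'.

(* f(v) = 0 *)
Definition vanishes_at (f : graph_fun) (v : vert G) : Prop :=
  forall p : endpoint, end_vert p = v -> trace f p = 0.

(* The sum of the derivatives towards v, in terms of the derivative f1 of f. *)
Definition normal_deriv (f1 : graph_fun) (v : vert G) : R[i] :=
  \sum_(p : endpoint | end_vert p == v)
    (if p.2 then trace f1 p else - trace f1 p).

Definition ae_eq_graph (f g : graph_fun) : Prop :=
  forall e, {ae @lebesgue_measure R, forall x, 0 < x < len e -> f e x = g e x}.

Definition dom_S (f : graph_fun) : Prop :=
  exists f1 f2, [/\ H2_tilde f f1 f2, vertex_continuous f &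
    forall v, vanishes_at f v /\ normal_deriv f1 v = 0].

Variable q : edge G -> R -> R.

(* f is in dom S^* = \tilde H^2(G) \cap H^1(G), and S^* f = g. *)
Definition S_adjoint (f g : graph_fun) : Prop :=
  exists f1 f2, [/\ H2_tilde f f1 f2, vertex_continuous f &
    ae_eq_graph g (fun e x => - f2 e x + (q e x)%:C * f e x)].

(* f is in dom S + ker S^*. *)
Definition dom_Krein (f : graph_fun) : Prop :=
  exists f0 h : graph_fun, [/\ dom_S f0, S_adjoint h (fun _ _ => 0) &
    forall e x, 0 <= x <= len e -> f e x = f0 e x + h e x].

(* The graph of the Krein-von Neumann extension of S. *)
Definition Krein_laplacian (f g : graph_fun) : Prop :=
  dom_Krein f /\ S_adjoint f g.

(* f lies in the eigenspace ker (A - mu); f = 0 is allowed. *)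
Definition in_eigenspace (mu : R) (f : graph_fun) : Prop :=
  Krein_laplacian f (fun e x => mu%:C * f e x).

(* Linear independence over the complex numbers in L^2(G). *)
Definition lin_indep (n : nat) (u : 'I_n -> graph_fun) : Prop :=
  forall c : 'I_n -> R[i],
    ae_eq_graph (fun e x => \sum_i c i * u i e x) (fun _ _ => 0) ->
    forall i, c i = 0.

(* dim ker (A - mu) >= n *)
Definition multiplicity_ge (mu : R) (n : nat) : Prop :=
  exists u : 'I_n -> graph_fun,
    (forall i, in_eigenspace mu (u i)) /\ lin_indep u.

(* The value mu occurs at n distinct indices or more. *)
Definition occurs_ge (lam : nat -> R) (mu : R) (n : nat) : Prop :=
  exists s : seq nat, [/\ uniq s, size s = n & forall j, j \in s -> lam j = mu].

(* lam 0 <= lam 1 <= ... lists the eigenvalues, each occurring exactly as often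
   as its multiplicity; indices start at 0, so lam j is \lambda_{j+1}. *)
Definition eigenvalue_listing (lam : nat -> R) : Prop :=
  {homo lam : i j / (i <= j)%N >-> i <= j} /\
  forall mu n, multiplicity_ge mu n <-> occurs_ge lam mu n.

Definition positive_eigenvalue_listing (lam : nat -> R) : Prop :=
  [/\ {homo lam : i j / (i <= j)%N >-> i <= j}, (forall j, 0 < lam j) &
      forall mu n, 0 < mu -> (multiplicity_ge mu n <-> occurs_ge lam mu n)].

Definition admissible_potential : Prop :=
  [/\ forall e, measurable_fun `]0, len e[ (q e),
      exists M : R, forall e x, 0 < x < len e -> `|q e x| <= M &
      forall e, {ae @lebesgue_measure R, forall x, 0 < x < len e -> 0 <= q e x}].

End Functions.

Definition lengthened_len (R : realType) (G : metric_graph R) (e0 : edge G)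
    (a : R) (e : edge G) : R :=
  if e == e0 then a * len e else len e.

Lemma lengthened_len_gt0 (R : realType) (G : metric_graph R) (e0 : edge G)
    (a : R) (a_gt1 : 1 < a) (e : edge G) : 0 < lengthened_len e0 a e.
Proof.
rewrite /lengthened_len; case: ifP => _; last exact: len_gt0.
by rewrite mulr_gt0 ?len_gt0 // (lt_trans _ a_gt1).
Qed.

Definition lengthen (R : realType) (G : metric_graph R) (e0 : edge G)
    (a : R) (a_gt1 : 1 < a) : metric_graph R :=
  MetricGraph (edge_nonempty G) (@src R G) (@tgt R G)
    (lengthened_len_gt0 e0 a_gt1).

Definition lengthen_potential (R : realType) (G : metric_graph R)
    (e0 : edge G) (a : R) (a_gt1 : 1 < a) (q : edge G -> R -> R) :
    edge (lengthen e0 a_gt1) -> R -> R :=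
  fun e x => if e == e0 then a ^- 2 * q e (x / a) else q e x.

Arguments lengthen {R G} e0 {a} a_gt1.
Arguments lengthen_potential {R G} e0 {a} a_gt1 q.

(* Main.v *)
From mathcomp Require Import ring lra measurable_realfun.
Require Import Defs.
Set Implicit Arguments.
Unset Strict Implicit.
Unset Printing Implicit Defensive.

Import Order.TTheory GRing.Theory Num.Theory.
Import numFieldNormedType.Exports.

Local Open Scope classical_set_scope.
Local Open Scope ring_scope.

(** Lengthening an edge lowers the eigenvalues because it lowers a Rayleigh
    quotient.  An eigenfunction for a positive eigenvalue kappa is g = f + h with
    f in the domain of S and h in the kernel of the adjoint of S, and then
    S f = kappa g.  As the range of S is orthogonal to that kernel, the positive
    eigenvalues are the critical values of the quotient |S f|^2 / <f, S f> on the
    domain of S.  On the lengthened edge f(x) is replaced by a f(x/a): the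
    derivatives at the endpoints do not change, so that the new function is again
    in the domain of S, while the contribution of the edge to |S f|^2 is divided
    by a and its contribution to <f, S f> is multiplied by a
    ([nform_transplant], [aform_transplant]).

    A function of the domain of S vanishes at the vertices, hence is determined by
    its second derivative w; everything is expressed through w.  Here [prim2 w]
    is f, [schrod q w] is S f, and by Green's formula [dom_S2 w] says that w is
    orthogonal to the continuous edgewise linear functions.

    In place of the min-max principle, eigenfunctions of the long graph are
    produced one by one ([lengthened_eigenfamily]).  Given n independent
    eigenfunctions of the short graph with eigenvalues in (0, mu0], and m < n
    orthogonal eigenfunctions g_k of the long one, some combination of the short
    eigenfunctions has a transplant orthogonal to all g_k ([test_function]), and
    the quotient of the transplant is at most mu0.  Maximising the inverse quotient
    under these orthogonality conditions gives a new eigenfunction, with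
    eigenvalue at most mu0 ([extremal_eigenfunction]).  The maximum is attained
    ([rayleigh_max_attained]) because <f, S f> is compact relative to |S f|^2
    ([aform_compact]), and the maximiser solves the eigenvalue equation because a
    square integrable function orthogonal to the range of S lies in the kernel of
    the adjoint of S ([edge_linear_bipolar], [ker_S_of_bipolar]).

    The eigenspace of 0 is the kernel of the adjoint itself, and h(x) -> h(x/a)
    on the lengthened edge embeds it in the kernel of the long graph
    ([kernel_dilate]).  There are no negative eigenvalues
    ([eigenvalue_ge0]), so the eigenfunctions of the long graph found in these two
    ways are as many as the eigenvalues of the short graph up to a given one, and
    the inequalities follow by counting indices ([size_le_listing]).

    The analysis is done with real functions: real and imaginary parts of complex
    eigenfunctions are real eigenfunctions, and a real orthogonal family is
    linearly independent over the complex numbers. *)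

(** * Square integrable functions on a set of finite measure *)

Section SquareIntegrable.
Context d (T : measurableType d) (R : realType).
Variable mu : {measure set T -> \bar R}.
Variable D : set T.
Hypotheses (mD : measurable D) (finD : (mu D < +oo)%E).
Implicit Types u v w : T -> R.

Definition sq_integrable u :=
  measurable_fun D u /\ mu.-integrable D (EFin \o (fun x => u x ^+ 2)).

Definition inner u v : R := \int[mu]_(x in D) (u x * v x).

Lemma eq_sq_integrable u v : {in D, u =1 v} ->
  sq_integrable u -> sq_integrable v.
Proof.
move=> uv [mu_ iu]; split; first exact: eq_measurable_fun mu_.
by apply: eq_integrable iu => // x xD /=; rewrite uv.
Qed.

Lemma eq_inner u u' v v' : {in D, u =1 u'} -> {in D, v =1 v'} ->
  inner u v = inner u' v'.
Proof. by move=> uu vv; apply: eq_Rintegral => x xD; rewrite uu// vv. Qed.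

(** u v is dominated by u^2 + v^2. *)
Lemma sq_integrableM u v : sq_integrable u -> sq_integrable v ->
  mu.-integrable D (EFin \o (fun x => u x * v x)).
Proof.
move=> [mu_ iu] [mv iv].
apply: (@le_integrable _ _ _ _ _ _ _
  (fun x => (u x ^+ 2)%R%:E + (v x ^+ 2)%R%:E)%E) => //.
- exact/measurable_EFinP/measurable_funM.
- move=> x _ /=; rewrite lee_fin [leRHS]ger0_norm ?addr_ge0 ?sqr_ge0//.
  rewrite normrM -[u x ^+ 2]real_normK ?num_real// -[v x ^+ 2]real_normK ?num_real//.
  have := sqr_ge0 (`|u x| - `|v x|); have := sqr_ge0 (`|u x| + `|v x|).
  by move=> h1 h2; nra.
- exact: integrableD.
Qed.

Lemma sq_integrable_lin c u v : sq_integrable u -> sq_integrable v ->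
  sq_integrable (fun x => c * u x + v x).
Proof.
move=> hu hv; have iuv := sq_integrableM hu hv.
case: hu hv => [mu_ iu] [mv iv]; split.
  by apply: measurable_funD => //; exact: measurable_funM.
rewrite (_ : (EFin \o _) = (fun x => (c ^+ 2)%R%:E * (u x ^+ 2)%R%:E
    + ((c *+ 2)%R%:E * (u x * v x)%R%:E + (v x ^+ 2)%R%:E))%E); last first.
  apply/funext => x /=; rewrite -!EFinM -!EFinD; congr EFin.
  by rewrite -mulr_natr; ring.
apply: integrableD => //; first exact: integrableZl.
by apply: integrableD => //; exact: integrableZl.
Qed.

Lemma sq_integrable0 : sq_integrable (fun=> 0).
Proof.
split; first exact: measurable_cst.
by rewrite (_ : _ \o _ = cst 0%E) ?funeqE//; [exact: integrable0 | move=> x /=; rewrite expr0n].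
Qed.

Lemma sq_integrableZ c u : sq_integrable u -> sq_integrable (fun x => c * u x).
Proof.
move=> hu; have := sq_integrable_lin c hu sq_integrable0.
by under eq_fun do rewrite addr0.
Qed.

Lemma sq_integrableD u v : sq_integrable u -> sq_integrable v ->
  sq_integrable (fun x => u x + v x).
Proof.
by move=> hu hv; have := sq_integrable_lin 1 hu hv; under eq_fun do rewrite mul1r.
Qed.

Lemma sq_integrableN u : sq_integrable u -> sq_integrable (fun x => - u x).
Proof.
by move=> hu; have := sq_integrableZ (-1) hu; under eq_fun do rewrite mulN1r.
Qed.

Lemma sq_integrableB u v : sq_integrable u -> sq_integrable v ->
  sq_integrable (fun x => u x - v x).
Proof. by move=> hu hv; apply: sq_integrableD => //; exact: sq_integrableN. Qed.

Lemma sq_integrable_mulb (b : T -> R) (M : R) u : measurable_fun D b ->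
  (forall x, D x -> `|b x| <= M) -> sq_integrable u ->
  sq_integrable (fun x => b x * u x).
Proof.
move=> mb bM [mu_ iu]; split; first exact: measurable_funM.
apply: (@le_integrable _ _ _ _ _ _ _ (fun x => (M ^+ 2)%R%:E * (u x ^+ 2)%R%:E)%E) => //.
- by apply/measurable_EFinP/measurable_funX/measurable_funM.
- move=> x Dx /=; rewrite lee_fin [leRHS]ger0_norm ?(mulr_ge0 (sqr_ge0 _) (sqr_ge0 _))//.
  rewrite ger0_norm ?sqr_ge0// exprMn; apply: ler_wpM2r; first exact: sqr_ge0.
  have b0 := normr_ge0 (b x); have := bM _ Dx.
  by rewrite -[b x ^+ 2]real_normK ?num_real//; nra.
- exact: integrableZl.
Qed.

Lemma sq_integrable_bounded (b : T -> R) (M : R) : measurable_fun D b ->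
  (forall x, D x -> `|b x| <= M) -> sq_integrable b.
Proof.
move=> mb bM; have h1 : sq_integrable (fun=> 1).
  split; first exact: measurable_cst.
  apply: (@measurable_bounded_integrable _ _ _ mu (fun=> 1 ^+ 2)) => //.
  exact: bounded_cst.
by have := sq_integrable_mulb mb bM h1; under eq_fun do rewrite mulr1.
Qed.

Lemma sq_integrable_cst c : sq_integrable (fun=> c).
Proof. by apply: (@sq_integrable_bounded _ `|c|) => //; exact: measurable_cst. Qed.

(** The constant 1 is square integrable because the measure is finite. *)
Lemma sq_integrable_integrable u : sq_integrable u ->
  mu.-integrable D (EFin \o u).
Proof.
move=> hu; have := sq_integrableM hu (sq_integrable_cst 1).
by under [X in _.-integrable _ (_ \o X)]eq_fun do rewrite mulr1.
Qed.

Lemma innerC u v : inner u v = inner v u.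
Proof. by apply: eq_Rintegral => x _; rewrite mulrC. Qed.

Lemma inner_linl c u v w : sq_integrable u -> sq_integrable v ->
  sq_integrable w ->
  inner (fun x => c * u x + v x) w = c * inner u w + inner v w.
Proof.
move=> hu hv hw; rewrite /inner -RintegralZl//; last exact: sq_integrableM.
rewrite -RintegralD//; last 2 first.
- have := sq_integrableM (sq_integrableZ c hu) hw.
  by under [X in _.-integrable _ (_ \o X)]eq_fun do rewrite -mulrA.
- exact: sq_integrableM.
by apply: eq_Rintegral => x _; ring.
Qed.

Lemma inner0l w : inner (fun=> 0) w = 0.
Proof.
rewrite /inner (@eq_Rintegral _ _ _ _ _ (fun=> 0)) => [|x _]; last by rewrite mul0r.
by rewrite Rintegral_cst// mul0r.
Qed.

Lemma innerDl u v w : sq_integrable u -> sq_integrable v -> sq_integrable w ->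
  inner (fun x => u x + v x) w = inner u w + inner v w.
Proof.
move=> hu hv hw; have := inner_linl 1 hu hv hw.
by under eq_fun do rewrite mul1r; rewrite mul1r.
Qed.

Lemma inner_ge0 u : 0 <= inner u u.
Proof. by apply: Rintegral_ge0 => x _; rewrite -expr2 sqr_ge0. Qed.

Lemma inner_eq0 u : sq_integrable u -> inner u u = 0 ->
  {ae mu, forall x, D x -> u x = 0}.
Proof.
move=> hu u0; have iuu := sq_integrableM hu hu.
have : (\int[mu]_(x in D) `|(u x * u x)%:E| = 0)%E.
  have /fineK <- : (\int[mu]_(x in D) `|(u x * u x)%:E|)%E \is a fin_num.
    by apply: integrable_fin_num => //; exact: integrable_abse.
  congr EFin; rewrite -[RHS]u0; congr fine; apply: eq_integral => x _ /=.
  by rewrite ger0_norm// -expr2 sqr_ge0.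
move/ae_eq_integral_abs => /(_ mD (measurable_int _ iuu)).
apply: filterS => x /= h Dx; move: (h Dx) => [/eqP].
by rewrite mulf_eq0 orbb => /eqP.
Qed.

Lemma ae_eq_inner u u' v v' : sq_integrable u -> sq_integrable u' ->
  sq_integrable v -> sq_integrable v' ->
  {ae mu, forall x, D x -> u x = u' x} ->
  {ae mu, forall x, D x -> v x = v' x} -> inner u v = inner u' v'.
Proof.
move=> hu hu' hv hv' uu vv; congr fine; apply: ae_eq_integral => //.
- exact: (measurable_int _ (sq_integrableM hu hv)).
- exact: (measurable_int _ (sq_integrableM hu' hv')).
- by apply: filterS2 uu vv => x eu ev Dx; rewrite /= eu// ev.
Qed.

End SquareIntegrable.

Lemma discriminant_le (R : realType) (a b c : R) : 0 <= a ->
  (forall t, 0 <= a * t ^+ 2 + 2 * b * t + c) -> b ^+ 2 <= a * c.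
Proof.
move=> a0 h; move: a0; rewrite le_eqVlt => /predU1P[a0|a0].
  have [->|b0] := eqVneq b 0; first by rewrite expr0n -a0 mul0r.
  have := h (- (c + 1) / (2 * b)); rewrite -a0 mul0r add0r.
  have -> : 2 * b * (- (c + 1) / (2 * b)) = - (c + 1) by field.
  by move=> ?; lra.
have := h (- b / a); have -> : a * (- b / a) ^+ 2 + 2 * b * (- b / a) + c
  = (a * c - b ^+ 2) / a by field; rewrite gt_eqF.
by rewrite pmulr_lge0 ?invr_gt0// subr_ge0.
Qed.

Section Completeness.
Context d (T : measurableType d) (R : realType).
Variable mu : {measure set T -> \bar R}.
Variable D : set T.
Hypotheses (mD : measurable D) (finD : (mu D < +oo)%E).
Implicit Types u v w : T -> R.
Local Notation sq_integrable := (sq_integrable mu D).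
Local Notation inner := (inner mu D).

Lemma inner_cauchy_schwarz u v : sq_integrable u -> sq_integrable v ->
  inner u v ^+ 2 <= inner u u * inner v v.
Proof.
move=> hu hv; apply: discriminant_le => [|t]; first exact: inner_ge0.
have := inner_ge0 mu D (fun x => t * u x + v x).
have htuv := sq_integrable_lin mD t hu hv.
rewrite inner_linl// (innerC _ _ u) (innerC _ _ v) !inner_linl//.
by rewrite (innerC _ _ v u) => h; lra.
Qed.

Lemma inner_triangle u v (a b : R) : sq_integrable u -> sq_integrable v ->
  0 <= a -> 0 <= b -> inner u u <= a ^+ 2 -> inner v v <= b ^+ 2 ->
  inner (fun x => u x + v x) (fun x => u x + v x) <= (a + b) ^+ 2.
Proof.
move=> hu hv a0 b0 ua vb; have huv := sq_integrableD mD hu hv.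
have uv : inner u v <= a * b.
  apply: le_trans (ler_norm _) _; rewrite -(ler_pXn2r (n := 2))// ?nnegrE ?mulr_ge0//.
  rewrite real_normK ?num_real// (le_trans (inner_cauchy_schwarz hu hv))//.
  by rewrite exprMn ler_pM// inner_ge0.
rewrite innerDl// (innerC _ _ u) (innerC _ _ v) !innerDl// (innerC _ _ v u).
by nra.
Qed.

(** The Riesz-Fischer theorem for fast Cauchy sequences: the telescoping series
    converges absolutely almost everywhere because its L1 norm is finite (the
    measure is finite), and Fatou's lemma bounds the distance to the limit. *)
Lemma sq_integrable_complete (k : R) (u : nat -> T -> R) : 0 <= k ->
  (forall n, sq_integrable (u n)) ->
  (forall n, inner (fun x => u n.+1 x - u n x) (fun x => u n.+1 x - u n x)
    <= (k / 2 ^+ n) ^+ 2) ->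
  exists2 w, sq_integrable w &
    forall n, inner (fun x => w x - u n x) (fun x => w x - u n x)
      <= (k *+ 2 / 2 ^+ n) ^+ 2.
Proof.
move=> k0 hu hd.
pose d_ n x := u n.+1 x - u n x.
have h_d n : sq_integrable (d_ n) by apply: sq_integrableB.
have p2 n : 0 < 2 ^+ n :> R by rewrite exprn_gt0.
pose C := (fine (mu D) + k ^+ 2) / 2.
(* 2 |d| <= 2^-n + 2^n d^2 turns the L2 bounds into summable L1 bounds. *)
have int_d n : (\int[mu]_(x in D) `|d_ n x|%:E <= (C / 2 ^+ n)%:E)%E.
  have idd : mu.-integrable D
      (fun x => (((2 ^+ n)^-1 / 2)%:E + (2 ^+ n / 2)%:E * (d_ n x * d_ n x)%:E)%E).
    apply: integrableD => //.
      apply: (@measurable_bounded_integrable _ _ _ mu (fun=> (2 ^+ n)^-1 / 2)) => //.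
      exact: bounded_cst.
    apply: integrableZl => //; exact: sq_integrableM.
  apply: (@le_trans _ _ (\int[mu]_(x in D)
      (((2 ^+ n)^-1 / 2)%:E + (2 ^+ n / 2)%:E * (d_ n x * d_ n x)%:E))%E).
    apply: le_integral => //.
      exact: integrable_norm (sq_integrable_integrable mD finD (h_d n)).
    move=> x _; rewrite -EFinM -EFinD lee_fin.
    have := sqr_ge0 (2 ^+ n * `|d_ n x| - 1).
    rewrite -[d_ n x * d_ n x]expr2 -[d_ n x ^+ 2]real_normK ?num_real// => h.
    rewrite -(ler_pM2l (p2 n)) mulrDr.
    rewrite [2 ^+ n * ((2 ^+ n)^-1 / 2)]mulrA mulfV ?gt_eqF//.
    by nra.
  rewrite integralD//; last 2 first.
  - apply: (@measurable_bounded_integrable _ _ _ mu (fun=> (2 ^+ n)^-1 / 2)) => //.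
    exact: bounded_cst.
  - apply: integrableZl => //; exact: sq_integrableM.
  rewrite integralZl//; last exact: sq_integrableM.
  rewrite integral_cst//= -[X in (_ * X + _)%E]fineK ?ge0_fin_numE//.
  have -> : (\int[mu]_(x in D) (d_ n x * d_ n x)%:E)%E = (inner (d_ n) (d_ n))%:E.
    rewrite /inner /Rintegral fineK//.
    by apply: integrable_fin_num => //; exact: sq_integrableM.
  rewrite -!EFinM -EFinD lee_fin.
  apply: (@le_trans _ _ ((2 ^+ n)^-1 / 2 * fine (mu D)
      + 2 ^+ n / 2 * (k / 2 ^+ n) ^+ 2)).
    by rewrite lerD2l ler_wpM2l ?divr_ge0 ?(ltW (p2 n))//; exact: hd.
  by rewrite le_eqVlt; apply/orP; left; apply/eqP; rewrite /C; field; rewrite gt_eqF.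
have md n : measurable_fun D (EFin \o (fun x => `|d_ n x|)).
  by apply/measurable_EFinP; apply: measurableT_comp => //; exact: (h_d n).1.
have sum_fin : (\sum_(0 <= n <oo) \int[mu]_(x in D) `|d_ n x|%:E < +oo)%E.
  apply: (@le_lt_trans _ _ (2 * C)%:E); last exact: ltry.
  apply: lime_le; first by apply: is_cvg_nneseries => n _ _; exact: integral_ge0.
  apply: nearW => n; apply: (@le_trans _ _ (\sum_(0 <= i < n) (C / 2 ^+ i)%:E)%E).
    by apply: lee_sum.
  rewrite sumEFin lee_fin.
  have -> : \sum_(0 <= i < n) C / 2 ^+ i = 2 * C - 2 * C / 2 ^+ n.
    elim: n => [|n ih]; first by rewrite big_geq// expr0 divr1 subrr.
    by rewrite big_nat_recr//= ih exprS; field; rewrite gt_eqF.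
  by rewrite gerBl divr_ge0 ?(ltW (p2 n))// mulr_ge0// divr_ge0// addr_ge0 ?sqr_ge0.
have cvg_ae : {ae mu, forall x, D x -> cvgn (u ^~ x)}.
  have : mu.-integrable D (fun x => \sum_(0 <= n <oo) `|d_ n x|%:E)%E.
    apply/integrableP; split.
      apply: (@ge0_emeasurable_sum _ _ _ D (fun n x => `|d_ n x|%:E) xpredT).
        by move=> n x _ _; rewrite lee_fin.
      by move=> n _; exact: md.
    rewrite (_ : integral _ _ _ =
      (\sum_(0 <= n <oo) \int[mu]_(x in D) `|d_ n x|%:E)%E)//.
    rewrite -integral_nneseries//.
    apply: eq_integral => x _; rewrite gee0_abs//.
    by apply: nneseries_ge0 => n _ _; rewrite lee_fin.
  move/(integrable_ae mD); apply: filterS => x + Dx => /(_ Dx) fin.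
  have ser : cvgn (series (d_ ^~ x)).
    apply: normed_cvg.
    apply: nondecreasing_is_cvgn; first by apply: nondecreasing_series => n _ _; exact: normr_ge0.
    exists (fine (\sum_(0 <= n <oo) `|d_ n x|%:E)%E) => _ [n _ <-].
    rewrite -lee_fin fineK// /series/= -sumEFin.
    by apply: nneseries_lim_ge => i _ _; rewrite lee_fin.
  have -> : u ^~ x = (fun n => u 0%N x + series (d_ ^~ x) n).
    by apply/funext => n; rewrite (eq_sum_telescope (u ^~ x) n).
  by apply: is_cvgD => //; exact: is_cvg_cst.
pose w x := fine (limn_esup (fun n => (u n x)%:E)).
have mw : measurable_fun D w.
  apply: (measurableT_comp (fine_measurable _)) => //.
  by apply: measurable_fun_limn_esup => n; apply/measurable_EFinP; exact: (hu n).1.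
have cvg_w : {ae mu, forall x, D x -> u n x @[n --> \oo] --> w x}.
  apply: filterS cvg_ae => x + Dx => /(_ Dx) /cvg_ex[/= l ul].
  suff -> : w x = l by [].
  by rewrite /w (@cvg_limn_einf_sup _ _ l%:E)//; apply: cvg_EFin => //; exact: nearW.
have dist n m : inner (fun x => u (n + m)%N x - u n x) (fun x => u (n + m)%N x - u n x)
    <= (k *+ 2 / 2 ^+ n - k *+ 2 / 2 ^+ (n + m)) ^+ 2.
  elim: m => [|m ih].
    have eq0 : {in D, (fun x => u (n + 0)%N x - u n x) =1 fun=> 0}.
      by move=> x _; rewrite addn0 subrr.
    by rewrite (eq_inner _ eq0 eq0) inner0l// sqr_ge0.
  have -> : k *+ 2 / 2 ^+ n - k *+ 2 / 2 ^+ (n + m.+1)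
    = (k *+ 2 / 2 ^+ n - k *+ 2 / 2 ^+ (n + m)) + k / 2 ^+ (n + m).
    by rewrite addnS exprS -mulr_natr; field; rewrite !gt_eqF.
  have eqx : {in D, (fun x => u (n + m.+1)%N x - u n x) =1
      (fun x => (u (n + m)%N x - u n x) + d_ (n + m)%N x)}.
    by move=> x _; rewrite /d_ addnS; ring.
  rewrite (eq_inner _ eqx eqx); apply: inner_triangle => //.
  - exact: sq_integrableB.
  - rewrite subr_ge0 ler_wpM2l ?mulrn_wge0// lef_pV2 ?posrE//.
    by rewrite ler_weXn2l ?leq_addr// ler1n.
  - by rewrite divr_ge0// ltW.
  - exact: hd.
have fatou_n n : (\int[mu]_(x in D) ((w x - u n x) ^+ 2)%:E
    <= ((k *+ 2 / 2 ^+ n) ^+ 2)%:E)%E.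
  pose f m x := ((u (n + m)%N x - u n x) ^+ 2)%:E.
  have mf m : measurable_fun D (f m).
    by apply/measurable_EFinP/measurable_funX/measurable_funB;
      [exact: (hu _).1|exact: (hu _).1].
  have f0 m x : D x -> (0 <= f m x)%E by rewrite lee_fin sqr_ge0.
  rewrite (_ : integral _ _ _ = \int[mu]_(x in D) limn_einf (f ^~ x))%E; last first.
    apply: ae_eq_integral => //.
    - apply/measurable_EFinP/measurable_funX/measurable_funB => //; exact: (hu _).1.
    - apply: measurableT_comp => //; apply: measurable_fun_limn_esup => m.
      exact: measurableT_comp.
    - apply: filterS cvg_w => x + Dx => /(_ Dx) uw.
      rewrite (@cvg_limn_einf_sup _ _ ((w x - u n x) ^+ 2)%:E)//.
      apply: cvg_EFin; first exact: nearW.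
      apply: (@cvg_comp _ _ _ _ (fun y : R => y ^+ 2) _ (nbhs (w x - u n x))); last first.
        exact: exprn_continuous.
      apply: cvgB; last exact: cvg_cst.
      rewrite (_ : (fun m => u (n + m)%N x) = [sequence (u ^~ x) (m + n)%N]_m).
        by rewrite (cvg_shiftn n (u ^~ x)).
      by apply/funext => m /=; rewrite addnC.
  apply: le_trans (fatou mu mD mf f0) _.
  rewrite limn_einf_lim; apply: lime_le; first exact: is_cvg_einfs.
  apply: nearW => m; apply: (@le_trans _ _ (\int[mu]_(x in D) f m x)%E).
    by apply: ereal_inf_lbound; exists m => /=.
  rewrite -[leLHS]fineK; last first.
    apply: integrable_fin_num => //.
    by have := (sq_integrableB mD (hu (n + m)%N) (hu n)).2.
  rewrite lee_fin; apply: (@le_trans _ _ ((k *+ 2 / 2 ^+ n - k *+ 2 / 2 ^+ (n + m)) ^+ 2)).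
    apply: le_trans (dist n m); rewrite /inner.
    by under [in leRHS]eq_Rintegral do rewrite -expr2.
  have h1 : 0 <= k *+ 2 / 2 ^+ (n + m) by rewrite divr_ge0 ?mulrn_wge0// ltW.
  have h2 : k *+ 2 / 2 ^+ (n + m) <= k *+ 2 / 2 ^+ n.
    rewrite ler_wpM2l ?mulrn_wge0// lef_pV2 ?posrE//.
    by rewrite ler_weXn2l ?leq_addr// ler1n.
  by nra.
have hwu n : sq_integrable (fun x => w x - u n x).
  have mwu : measurable_fun D (fun x => w x - u n x).
    by apply: measurable_funB => //; exact: (hu n).1.
  split => //; apply/integrableP; split.
    exact/measurable_EFinP/measurable_funX.
  apply: le_lt_trans (ltry ((k *+ 2 / 2 ^+ n) ^+ 2)); apply: le_trans (fatou_n n).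
  by rewrite le_eqVlt; apply/orP; left; apply/eqP; apply: eq_integral => x _ /=;
    rewrite ger0_norm// sqr_ge0.
exists w.
  have := sq_integrableD mD (hwu 0%N) (hu 0%N).
  by under eq_fun do rewrite subrK.
move=> n; rewrite -lee_fin; apply: le_trans (fatou_n n).
rewrite /inner /Rintegral fineK; last first.
  by apply: integrable_fin_num => //; exact: sq_integrableM.
by under eq_integral do rewrite -expr2.
Qed.

End Completeness.

(** * Maximising a quotient of quadratic forms *)

Section Extremal.
Variables (R : realType) (V : lmodType R) (D : V -> Prop).
Hypothesis D_lin : forall c x y, D x -> D y -> D (c *: x + y).

(** Nonnegative symmetric bilinear forms on a subspace D. The space is kept as a
    predicate because it is later cut down by orthogonality conditions. *)
Definition psd_form (Q : V -> V -> R) :=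
  [/\ forall c x y z, D x -> D y -> D z -> Q (c *: x + y) z = c * Q x z + Q y z,
      forall x y, D x -> D y -> Q x y = Q y x &
      forall x, D x -> 0 <= Q x x].

Lemma psd_formE Q c x y : psd_form Q -> D x -> D y ->
  Q (c *: x + y) (c *: x + y) = c ^+ 2 * Q x x + 2 * c * Q x y + Q y y.
Proof.
move=> [Ql Qs _] Dx Dy; have Dxy := D_lin c Dx Dy.
by rewrite Ql// (Qs x)// (Qs y)// !Ql// (Qs y x)//; ring.
Qed.

Lemma psd_form_sub Q x y : psd_form Q -> D x -> D y ->
  Q (x - y) (x - y) <= 2 * Q x x + 2 * Q y y.
Proof.
move=> hQ Dx Dy; have [_ Qs Q0] := hQ.
have -> : x - y = (-1) *: y + x by rewrite scaleN1r addrC.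
have := Q0 _ (D_lin 1 Dy Dx); rewrite !psd_formE//.
by move: (Qs x y Dx Dy) => e; lra.
Qed.

Lemma psd_form_cauchy_schwarz Q x y : psd_form Q -> D x -> D y ->
  Q x y ^+ 2 <= Q x x * Q y y.
Proof.
move=> hQ Dx Dy; have [_ _ Q0] := hQ; apply: discriminant_le => [|t]; first exact: Q0.
by have := Q0 _ (D_lin t Dx Dy); rewrite psd_formE//; lra.
Qed.

Lemma psd_form_null Q x y : psd_form Q -> D x -> D y -> Q x x = 0 -> Q x y = 0.
Proof.
move=> hQ Dx Dy x0; apply/eqP; rewrite -sqrf_eq0 eq_le sqr_ge0 andbT.
by rewrite (le_trans (psd_form_cauchy_schwarz hQ Dx Dy))// x0 mul0r.
Qed.

(** An ultrafilter chooses one class of any finite colouring. *)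
Lemma ultrafilter_fiber (T : finType) (col : V -> T) (U : set_system V) :
  UltraFilter U -> exists t, U [set x | col x = t].
Proof.
move=> UU; apply/not_existsP => h.
have : U [set x | forall t, col x <> t].
  apply: filter_forall => t.
  by case: (in_ultra_setVsetC [set x | col x = t] UU) => // /h.
by move/filter_ex => [x /(_ (col x))].
Qed.

Variables (N A : V -> V -> R) (C : R).
Hypotheses (N_form : psd_form N) (A_form : psd_form A).
Hypothesis A_le : forall x, D x -> A x x <= C * N x x.
Hypothesis A_compact : forall e : R, 0 < e -> exists (T : finType) (col : V -> T),
  forall x y, D x -> D y -> N x x <= 1 -> N y y <= 1 -> col x = col y ->
    A (x - y) (x - y) <= e.
Hypothesis N_complete : forall u : nat -> V, (forall n, D (u n)) ->
  (forall n, N (u n.+1 - u n) (u n.+1 - u n) <= (2 ^+ n)^-1 ^+ 2) ->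
  exists2 x, D x & forall e : R, 0 < e -> exists m, forall n, (m <= n)%N ->
    N (x - u n) (x - u n) <= e.

(** The supremum of the Rayleigh quotient A/N is attained at a critical point.
    Along a maximising sequence the nonnegative form Q = M N - A tends to zero,
    so Q(x - y) is small for any two of its late members; since A(x - y) is small
    too when x and y have the same colour, the parallelogram law turns the
    maximising sequence into an N-Cauchy one.  An ultrafilter selects one colour
    for every accuracy at once. *)
Lemma rayleigh_max_attained p : D p -> 0 < A p p ->
  exists f M, [/\ D f, 0 < N f f, A p p <= M * N p p &
    forall y, D y -> A f y = M * N f y].
Proof.
move=> Dp Ap; have [Nl Ns N0] := N_form; have [Al As A0] := A_form.
have D0 : D 0 by have := D_lin (-1) Dp Dp; rewrite scaleN1r addNr.
have DZ c x : D x -> D (c *: x) by move=> Dx; rewrite -[_ *: _]addr0; exact: D_lin.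
have DB x y : D x -> D y -> D (x - y).
  by move=> Dx Dy; rewrite addrC -scaleN1r; exact: D_lin.
have formZ Q c x : psd_form Q -> D x -> Q (c *: x) (c *: x) = c ^+ 2 * Q x x.
  move=> hQ Dx; rewrite -[_ *: _]addr0 psd_formE// (psd_form_null hQ D0 D0); last first.
    by have [Ql _ _] := hQ; have := Ql (-1) p p 0 Dp Dp D0;
      rewrite scaleN1r addNr => ->; ring.
  have [Ql Qs _] := hQ; rewrite (Qs x 0)//.
  have := Ql (-1) p p x Dp Dp Dx; rewrite scaleN1r addNr => ->; ring.
have Np : 0 < N p p.
  rewrite lt_neqAle N0// andbT; apply/eqP => h.
  by have := A_le Dp; rewrite -h mulr0 leNgt Ap.
pose normalised := [set x | D x /\ N x x = 1].
have unit x : D x -> 0 < N x x -> normalised ((Num.sqrt (N x x))^-1 *: x).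
  move=> Dx Nx; split; first exact: DZ.
  by rewrite (formZ N)// exprVn sqr_sqrtr ?ltW// mulVf// gt_eqF.
pose M := sup [set A x x | x in normalised].
have supM : has_sup [set A x x | x in normalised].
  split; first by eexists; exists ((Num.sqrt (N p p))^-1 *: p); first exact: unit.
  by exists C => _ [x [Dx x1] <-]; have := A_le Dx; rewrite x1 mulr1.
have A_leM x : D x -> A x x <= M * N x x.
  move=> Dx; have := N0 _ Dx; rewrite le_eqVlt => /predU1P[h|h].
    by have := A_le Dx; rewrite -h !mulr0.
  have : A ((Num.sqrt (N x x))^-1 *: x) ((Num.sqrt (N x x))^-1 *: x) <= M.
    by apply: sup_ubound; [exact: supM.2 | exists ((Num.sqrt (N x x))^-1 *: x) => //; exact: unit].
  by rewrite (formZ A)// exprVn sqr_sqrtr ?(ltW h)// [_^-1 * _]mulrC ler_pdivrMr.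
have M0 : 0 < M.
  by rewrite -(pmulr_lgt0 _ Np) (lt_le_trans Ap)// A_leM.
pose Q x y := M * N x y - A x y.
have Q_form : psd_form Q.
  split.
  - by move=> c x y z Dx Dy Dz; rewrite /Q Nl// Al//; ring.
  - by move=> x y Dx Dy; rewrite /Q Ns// As.
  - by move=> x Dx; rewrite subr_ge0 A_leM.
have p2 n : 0 < (2 ^+ n)^-1 ^+ 2 :> R by rewrite exprn_gt0// invr_gt0 exprn_gt0.
(* M N (x - y) will be bounded by 2 Q x + 2 Q y + A (x - y) <= 5 eps. *)
pose eps n := M * (2 ^+ n)^-1 ^+ 2 / 5.
have eps0 n : 0 < eps n by rewrite divr_gt0// mulr_gt0.
pose near_max n := [set x | normalised x /\ Q x x <= eps n].
have eps_dec m n : (m <= n)%N -> eps n <= eps m.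
  move=> mn; rewrite ler_pM2r ?invr_gt0// ler_pM2l//.
  rewrite ler_pXn2r ?nnegrE ?invr_ge0 ?exprn_ge0//.
  by rewrite lef_pV2 ?posrE ?exprn_gt0// ler_weXn2l// ler1n.
have near_max_proper : ProperFilter (filter_from setT near_max).
  apply: filter_from_proper => [|n _].
    apply: filter_from_filter; first by exists 0%N.
    move=> m n _ _; exists (maxn m n) => // x [x1 xQ].
    by split; split => //; apply: le_trans xQ (eps_dec _ _ _);
      rewrite ?leq_maxl ?leq_maxr.
  have [_ [x x1 <-] Mx] := sup_adherent (eps0 n) supM.
  by exists x; split => //; rewrite /Q x1.2 mulr1; move: Mx; rewrite -/M; lra.
have [U [UU sU]] := ultraFilterLemma near_max_proper.
have small n : exists2 B, U B & forall x y, B x -> B y ->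
    [/\ near_max n x, near_max n y & N (x - y) (x - y) <= (2 ^+ n)^-1 ^+ 2].
  have [T [col hcol]] := A_compact (eps0 n).
  have [t Ut] := ultrafilter_fiber col UU.
  exists (near_max n `&` [set x | col x = t]).
    by apply: filterI => //; apply: sU; exists n.
  move=> x y [xn xt] [yn yt]; split => //.
  have [[Dx x1] xQ] := xn; have [[Dy y1] yQ] := yn.
  have h1 : A (x - y) (x - y) <= eps n by apply: hcol; rewrite ?x1 ?y1// xt yt.
  have h2 := psd_form_sub Q_form Dx Dy.
  rewrite -(ler_pM2l M0).
  have : M * N (x - y) (x - y) = Q (x - y) (x - y) + A (x - y) (x - y).
    by rewrite /Q subrK.
  have : M * (2 ^+ n)^-1 ^+ 2 = 5 * eps n by rewrite /eps; field.
  by lra.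
have /choice[B hB] n : exists B, U B /\ forall x y, B x -> B y ->
    [/\ near_max n x, near_max n y & N (x - y) (x - y) <= (2 ^+ n)^-1 ^+ 2].
  by have [b] := small n; exists b.
(* Taking u n in B 0, ..., B n puts u n and u n.+1 both in B n. *)
have pick n : exists x, forall k : 'I_n.+1, B k x.
  by apply: (@filter_ex _ U); apply: filter_forall => k; exact: (hB k).1.
have /choice[u hu] := pick.
have Bu n : B n (u n) by have := hu n ord_max.
have Bu' n : B n (u n.+1) by have := hu n.+1 (widen_ord (leqnSn _) ord_max).
have un n : near_max n (u n) by have [] := (hB n).2 _ _ (Bu n) (Bu n).
have Du n : D (u n) by have [[]] := un n.
have [f Df fu] : exists2 x, D x & forall e : R, 0 < e -> exists m, forall n,
    (m <= n)%N -> N (x - u n) (x - u n) <= e.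
  apply: N_complete => // n.
  by have [] := (hB n).2 _ _ (Bu' n) (Bu n).
have un_split n : u n = f - (f - u n) by rewrite opprB addrC subrK.
have Qf : Q f f = 0.
  apply/eqP; rewrite eq_le; have [_ _ ->//] := Q_form; rewrite andbT.
  apply/ler_addgt0Pr => t t0; rewrite add0r.
  have [m hm] := fu (t / (4 * M)) (divr_gt0 t0 (mulr_gt0 (ltr0n _ 4) M0)).
  pose n := maxn m (Num.bound (M / t)).
  have N_le := hm n (leq_maxl _ _).
  have eps_le : 5 * eps n <= t.
    have tM : M / t < 2 ^+ n.
      apply: (lt_le_trans (archi_boundP _)); first by rewrite divr_ge0// ltW.
      by rewrite -natrX ler_nat (leq_trans _ (ltnW (ltn_expl n (ltnSn 1))))// leq_maxr.
    have i2 : 0 < (2 ^+ n)^-1 :> R by rewrite invr_gt0 exprn_gt0.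
    have i1 : (2 ^+ n)^-1 <= 1 :> R.
      by rewrite invf_le1 ?exprn_gt0// exprn_ege1// ler1n.
    have : M * (2 ^+ n)^-1 <= t.
      by rewrite ler_pdivrMr ?exprn_gt0// mulrC -ler_pdivrMr// ltW.
    move=> h; apply: le_trans h.
    have -> : 5 * eps n = (M * (2 ^+ n)^-1) * (2 ^+ n)^-1 by rewrite /eps; field; rewrite gt_eqF ?exprn_gt0.
    by rewrite ger_pMr// mulr_gt0.
  have Dfu := DB _ _ Df (Du n).
  have Qfu : Q (f - u n) (f - u n) <= M * N (f - u n) (f - u n).
    by rewrite lerBlDr lerDl A0.
  have Q_le : Q f f <= 2 * Q (u n) (u n) + 2 * Q (f - u n) (f - u n).
    have := psd_form_sub Q_form (Du n) (DZ (-1) _ Dfu).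
    by rewrite (formZ Q)// scaleN1r opprK [u n + _]addrC subrK sqrrN expr1n mul1r.
  have MN_le : M * N (f - u n) (f - u n) <= t / 4.
    have := N_le; rewrite -(ler_pM2l M0).
    by have -> : M * (t / (4 * M)) = t / 4 by field; rewrite gt_eqF.
  have [_ Qu] := un n.
  by lra.
have Nf : 0 < N f f.
  have [m hm] := fu 4^-1 (ltac:(by rewrite invr_gt0)).
  have N_le := hm m (leqnn m); have [[_ u1] _] := un m.
  have := psd_form_sub N_form Df (DB _ _ Df (Du m)); rewrite -un_split u1.
  by lra.
exists f, M; split => //; first exact: A_leM.
move=> y Dy; apply/esym/eqP; rewrite -subr_eq0; apply/eqP.
exact: (psd_form_null Q_form Df Dy Qf).
Qed.

End Extremal.

(** * Square integrable functions and their primitives on [0, l] *)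

Section Interval.
Variable R : realType.
Implicit Types (l x y : R) (u v du dv : R -> R).
Local Notation mu := (@lebesgue_measure R).

Definition L2 l u := sq_integrable mu `[0, l] u.
Definition ip l u v : R := inner mu `[0, l] u v.
Definition primitive u x : R := \int[mu]_(t in `[0, x]) u t.

Let mitv (i : interval R) : measurable ([set` i] : set (measurableTypeR R)).
Proof. exact: measurable_itv. Qed.

Let fin_itv l : (mu `[0%R, l]%classic < +oo)%E.
Proof. by rewrite lebesgue_measure_itv/=; case: ifP => // _; rewrite -EFinD ltry. Qed.

Lemma in_itv0 l x : (x \in (`[0, l]%classic : set R)) = (0 <= x <= l).
Proof. by apply/idP/idP; rewrite inE/= in_itv. Qed.

Lemma L2_le l x u : x <= l -> L2 l u -> L2 x u.
Proof.
move=> xl [mu_ iu]; have sub : `[0, x]%classic `<=` (`[0, l]%classic : set R).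
  by apply: subset_itvl; rewrite bnd_simp.
split; first exact: measurable_funS mu_.
exact: integrableS iu.
Qed.

Lemma L2_lin l (c : R) u v : L2 l u -> L2 l v -> L2 l (fun x => c * u x + v x).
Proof. exact: sq_integrable_lin. Qed.

Lemma L2_ext l u v : (forall x, 0 <= x <= l -> u x = v x) -> L2 l u -> L2 l v.
Proof. by move=> uv; apply: (eq_sq_integrable (mitv _)) => x; rewrite in_itv0; exact: uv. Qed.

Lemma ip_ext l u u' v v' : (forall x, 0 <= x <= l -> u x = u' x) ->
  (forall x, 0 <= x <= l -> v x = v' x) -> ip l u v = ip l u' v'.
Proof.
by move=> uu vv; apply: eq_inner => x; rewrite in_itv0; [exact: uu|exact: vv].
Qed.

Lemma ip_cst1 l u : ip l u (fun=> 1) = primitive u l.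
Proof. by rewrite /ip /inner; under eq_Rintegral do rewrite mulr1. Qed.

Lemma ipC l u v : ip l u v = ip l v u.
Proof. exact: innerC. Qed.

Lemma ip_linl l (c : R) u v w : L2 l u -> L2 l v -> L2 l w ->
  ip l (fun x => c * u x + v x) w = c * ip l u w + ip l v w.
Proof. exact: inner_linl. Qed.

Lemma ip_ge0 l u : 0 <= ip l u u.
Proof. exact: inner_ge0. Qed.

Lemma ip0l l u : ip l (fun=> 0) u = 0.
Proof. exact: inner0l. Qed.

Lemma L2_cst l (c : R) : L2 l (fun=> c).
Proof. exact: (sq_integrable_cst (mitv _) (fin_itv l)). Qed.

Lemma ip_cstl l (c : R) u : L2 l u -> ip l (fun=> c) u = c * primitive u l.
Proof.
move=> hu; rewrite -ip_cst1 (ipC _ u).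
rewrite -[RHS]addr0 -(ip0l l u) -ip_linl//; [|exact: L2_cst..].
by apply: ip_ext => // x _; rewrite mulr1 addr0.
Qed.

Lemma ip11 l : 0 <= l -> ip l (fun=> 1) (fun=> 1) = l.
Proof.
move=> l0; rewrite ip_cst1 /primitive Rintegral_cst// mul1r/= lebesgue_measure_itv/=.
move: l0; rewrite le_eqVlt => /predU1P[<-|l0]; first by rewrite ltxx.
by rewrite lte_fin l0 -EFinD/= subr0.
Qed.

Lemma L2_integrable l u : L2 l u -> mu.-integrable `[0, l] (EFin \o u).
Proof. exact: (sq_integrable_integrable (mitv _) (fin_itv l)). Qed.

Lemma primitive0 u : primitive u 0 = 0.
Proof. by rewrite /primitive set_itv1 Rintegral_set1. Qed.

Lemma primitive_ext u v x : (forall t, 0 <= t <= x -> u t = v t) ->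
  primitive u x = primitive v x.
Proof. by move=> uv; apply: eq_Rintegral => t; rewrite in_itv0; exact: uv. Qed.

Lemma primitive_lin l (c : R) u v x : x <= l -> L2 l u -> L2 l v ->
  primitive (fun t => c * u t + v t) x = c * primitive u x + primitive v x.
Proof.
move=> xl /(L2_le xl) hu /(L2_le xl) hv; rewrite -!ip_cst1.
by apply: inner_linl => //; exact: L2_cst.
Qed.

(** By Cauchy-Schwarz on [x, y]: the primitive of a square integrable function is
    Hoelder continuous with exponent 1/2. *)
Lemma primitive_holder l u x y : L2 l u -> 0 <= x -> x <= y -> y <= l ->
  (primitive u y - primitive u x) ^+ 2 <= (y - x) * ip l u u.
Proof.
move=> hu x0 xy yl.
have sub : `]x, y]%classic `<=` (`[0, l]%classic : set R).
  move=> t /=; rewrite !in_itv/= => /andP[xt ty].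
  by rewrite (ltW (le_lt_trans x0 xt)) (le_trans ty yl).
have fin : (mu `]x, y]%classic < +oo)%E.
  by rewrite lebesgue_measure_itv/=; case: ifP => // _; rewrite -EFinD ltry.
have hu' : sq_integrable mu `]x, y] u.
  case: hu => m1 i1; split; first exact: measurable_funS m1.
  exact: integrableS i1.
have -> : primitive u y - primitive u x = inner mu `]x, y] u (fun=> 1).
  rewrite /primitive Rintegral_itvB ?bnd_simp//; last first.
    by apply: L2_integrable; exact: L2_le hu.
  by rewrite /inner; under [RHS]eq_Rintegral do rewrite mulr1.
apply: le_trans (inner_cauchy_schwarz (mitv _) hu' (sq_integrable_cst (mitv _) fin 1)) _ => //.
have -> : inner mu `]x, y] (fun=> 1) (fun=> 1) = y - x.
  rewrite /inner Rintegral_cst// !mul1r/= lebesgue_measure_itv/= lte_fin.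
  move: xy; rewrite le_eqVlt => /predU1P[->|xy]; first by rewrite ltxx subrr.
  by rewrite xy.
rewrite mulrC ler_wpM2l ?subr_ge0//.
rewrite /ip /inner [leLHS]Rintegral_mkcond [leRHS]Rintegral_mkcond.
have iuu := sq_integrableM (mitv _) hu hu.
apply: le_Rintegral => //.
- rewrite -restrict_EFin; apply/integrable_restrict => //; rewrite setTI.
  exact: integrableS iuu.
- by rewrite -restrict_EFin; apply/integrable_restrict => //; rewrite setTI.
- move=> t _; rewrite !patchE; case: ifPn => [|_].
    by rewrite !inE => /sub tl; rewrite mem_set.
  by case: ifPn => // _; rewrite -expr2 sqr_ge0.
Qed.

Lemma primitive_measurable l u : 0 <= l -> L2 l u ->
  measurable_fun `[0, l] (primitive u).
Proof.
move=> l0 hu; apply: subspace_continuous_measurable_fun => //.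
exact: (parameterized_integral_continuous l0 (L2_integrable hu)).
Qed.

Lemma primitive_sq_le l u x : L2 l u -> 0 <= x <= l ->
  primitive u x ^+ 2 <= l * ip l u u.
Proof.
move=> hu /andP[x0 xl]; have := primitive_holder hu (lexx 0) x0 xl.
rewrite primitive0 !subr0 => /le_trans; apply; apply: ler_wpM2r => //.
exact: inner_ge0.
Qed.

Lemma sqr_le_norm (a b : R) : a ^+ 2 <= b -> `|a| <= b + 1.
Proof.
move=> h; have := normr_ge0 a; rewrite -[a ^+ 2]real_normK ?num_real// in h.
by nra.
Qed.

Lemma L2_primitive l u : 0 <= l -> L2 l u -> L2 l (primitive u).
Proof.
move=> l0 hu; apply: (sq_integrable_bounded (M := l * ip l u u + 1) (mitv _) (fin_itv l)).
  exact: primitive_measurable.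
move=> x /=; rewrite in_itv/= => xl.
exact/sqr_le_norm/primitive_sq_le.
Qed.

End Interval.

(** * Integration by parts *)

Section ByParts.
Variable R : realType.
Implicit Types (l x y : R) (u v du dv : R -> R).
Local Notation mu := (@lebesgue_measure R).

Let mitv (i : interval R) : measurable ([set` i] : set (measurableTypeR R)).
Proof. exact: measurable_itv. Qed.

(** Inner integral over the triangle x <= y, for fixed x. *)
Lemma integral_right_part l v x (c : R) : L2 l v -> 0 <= x <= l ->
  (\int[mu]_y (if x <= y then c * (v \_ `[0%R, l]%classic) y else 0)%:E)%E
  = (c * (primitive v l - primitive v x))%:E.
Proof.
move=> hv /andP[x0 xl].
have iv : mu.-integrable `[x, l] (EFin \o v).
  apply: integrableS (L2_integrable hv) => //.
  by apply: subset_itvr; rewrite bnd_simp.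
rewrite /primitive Rintegral_itvB ?bnd_simp//; last exact: L2_integrable.
rewrite Rintegral_itv_obnd_cbnd; last first.
  by apply: integrableS iv => //; apply: subset_itvr; rewrite bnd_simp.
rewrite -RintegralZl// /Rintegral fineK; last first.
  by apply: integrable_fin_num => //; exact: (integrableZl (mitv _) c iv).
rewrite [RHS]integral_mkcond; apply: eq_integral => y _.
rewrite !patchE in_itv0.
case: ifPn => xy; last first.
  by rewrite memNset// /= in_itv/=; apply/negP; rewrite (negbTE xy).
rewrite (le_trans x0 xy)/=.
case: ifPn => yl; first by rewrite mem_set//= in_itv/= xy yl.
by rewrite memNset ?mulr0// /= in_itv/= (negbTE yl) andbF.
Qed.

Lemma integral_left_part l u y (c : R) : L2 l u -> 0 <= y <= l ->
  (\int[mu]_x (if x <= y then (u \_ `[0%R, l]%classic) x * c else 0)%:E)%E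
  = (c * primitive u y)%:E.
Proof.
move=> hu /andP[y0 yl].
have iu : mu.-integrable `[0, y] (EFin \o u) := L2_integrable (L2_le yl hu).
rewrite /primitive -RintegralZl// /Rintegral fineK; last first.
  by apply: integrable_fin_num => //; exact: (integrableZl (mitv _) c iu).
rewrite [RHS]integral_mkcond; apply: eq_integral => x _.
rewrite !patchE !in_itv0.
case: ifPn => xy; last by rewrite andbF.
by rewrite (le_trans xy yl) !andbT; case: ifP => _; rewrite ?mul0r// mulrC.
Qed.

(** Fubini's theorem for u(x) v(y) on the triangle x <= y of the square
    [0, l] x [0, l]. *)
Lemma primitive_by_parts l u v : 0 <= l -> L2 l u -> L2 l v ->
  ip l (primitive u) v + ip l u (primitive v) = primitive u l * primitive v l.
Proof.
move=> l0 hu hv.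
pose D : set (measurableTypeR R) := `[0, l]%classic.
have mD : measurable D by exact: mitv.
pose U : R -> R := u \_ D; pose V : R -> R := v \_ D.
have patch_int w : L2 l w -> mu.-integrable setT (EFin \o (w \_ D)).
  move=> hw; rewrite -restrict_EFin; apply/integrable_restrict => //.
  by rewrite setTI; exact: L2_integrable.
have iU : mu.-integrable setT (EFin \o U) by exact: patch_int.
have iV : mu.-integrable setT (EFin \o V) by exact: patch_int.
have mU : measurable_fun setT U by apply/measurable_EFinP; exact: measurable_int iU.
have mV : measurable_fun setT V by apply/measurable_EFinP; exact: measurable_int iV.
pose g (z : measurableTypeR R * measurableTypeR R) := (U z.1 * V z.2)%:E.
pose f (z : measurableTypeR R * measurableTypeR R) :=
  (if z.1 <= z.2 then U z.1 * V z.2 else 0)%:E.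
have mg : measurable_fun setT g.
  apply/measurable_EFinP/measurable_funM.
    exact: (measurableT_comp mU measurable_fst).
  exact: (measurableT_comp mV measurable_snd).
have mf : measurable_fun setT f.
  apply/measurable_EFinP; apply: measurable_fun_ifT => //.
  - by apply: measurable_fun_ler; [exact: measurable_fst | exact: measurable_snd].
  - exact/measurable_EFinP.
have ig : (mu \x mu)%E.-integrable setT g.
  apply/integrable12ltyP => //.
  pose c := (\int[mu]_y `|(V y)%:E|)%E.
  have c_fin : c \is a fin_num.
    by rewrite ge0_fin_numE ?integral_ge0//; case/integrableP: iV.
  rewrite (_ : integral _ _ _ = (\int[mu]_x (`|(U x)%:E| * c))%E); last first.
    apply: eq_integral => x _; rewrite -ge0_integralZl//; last first.
      by apply: measurableT_comp => //; apply/measurable_EFinP.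
    by apply: eq_integral => y _; rewrite /g/= normrM EFinM.
  rewrite ge0_integralZr//; last 2 first.
  - by apply: measurableT_comp => //; apply/measurable_EFinP.
  - exact: integral_ge0.
  by rewrite muleC; apply: lte_mul_pinfty => //; [exact: integral_ge0 | case/integrableP: iU].
have if_ : (mu \x mu)%E.-integrable setT f.
  apply: le_integrable ig => // z _; rewrite /f /g/= lee_fin.
  by case: ifP => // _; rewrite normr0.
have int_ux x : 0 <= x <= l -> (\int[mu]_y f (x, y))%E
    = (u x * (primitive v l - primitive v x))%:E.
  move=> xl; rewrite -(integral_right_part _ hv xl); apply: eq_integral => y _.
  by rewrite /f/= /U patchE in_itv0 xl.
have int_uxN x : ~~ (0 <= x <= l) -> (\int[mu]_y f (x, y))%E = 0%E.
  move=> xl; apply: integral0_eq => y _.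
  by rewrite /f/= /U patchE in_itv0 (negbTE xl) mul0r if_same.
have int_vy y : 0 <= y <= l -> (\int[mu]_x f (x, y))%E = (v y * primitive u y)%:E.
  move=> yl; rewrite -(integral_left_part _ hu yl); apply: eq_integral => x _.
  by rewrite /f/= /V patchE in_itv0 yl.
have int_vyN y : ~~ (0 <= y <= l) -> (\int[mu]_x f (x, y))%E = 0%E.
  move=> yl; apply: integral0_eq => x _.
  by rewrite /f/= /V patchE in_itv0 (negbTE yl) mulr0 if_same.
have eqx : (\int[mu]_x \int[mu]_y f (x, y))%E =
    (\int[mu]_(x in D) (u x * (primitive v l - primitive v x))%:E)%E.
  rewrite [RHS]integral_mkcond; apply: eq_integral => x _; rewrite patchE in_itv0.
  by case: ifPn => [/int_ux|/int_uxN].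
have eqy : (\int[mu]_y \int[mu]_x f (x, y))%E =
    (\int[mu]_(y in D) (v y * primitive u y)%:E)%E.
  rewrite [RHS]integral_mkcond; apply: eq_integral => y _; rewrite patchE in_itv0.
  by case: ifPn => [/int_vy|/int_vyN].
have fubini : ip l u (fun x => -1 * primitive v x + primitive v l)
    = ip l (primitive u) v.
  rewrite [RHS]ipC /ip /inner /Rintegral -eqy -(Fubini if_) eqx; congr fine.
  by apply: eq_integral => x _; congr EFin; ring.
clear -l0 hu hv fubini.
have hpu := L2_primitive l0 hu; have hpv := L2_primitive l0 hv.
have hc := L2_cst l (primitive v l).
move: fubini; rewrite ipC ip_linl// (ipC _ (primitive v)) => <-.
have -> : ip l (fun=> primitive v l) u = primitive v l * primitive u l.
  by rewrite ip_cstl.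
by ring.
Qed.

End ByParts.

(** * Scaling an interval *)

Section Scaling.
Variables (R : realType) (a : R).
Hypothesis a_gt0 : 0 < a.
Implicit Types (l x y : R) (u v du dv : R -> R).
Local Notation mu := (@lebesgue_measure R).

Let mitv (i : interval R) : measurable ([set` i] : set (measurableTypeR R)).
Proof. exact: measurable_itv. Qed.

Let phi (x : measurableTypeR R) : measurableTypeR R := x / a.

Let mphi : measurable_fun setT phi.
Proof. exact: measurable_funM. Qed.

Let ia_ge0 : 0 <= a^-1. Proof. by rewrite invr_ge0 ltW. Qed.

Let image_measure : {measure set (measurableTypeR R) -> \bar R}.
Proof.
unshelve refine (pushforward mu phi : {measure set (measurableTypeR R) -> \bar R}).
exact: mphi.
Defined.

Let nu := mscale (NngNum ia_ge0) image_measure.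

Let lebesgue_nu A : measurable A -> mu A = nu A.
Proof.
apply: lebesgue_measure_unique => X /ocitvP[->|[[p q]/= pq ->]].
  by rewrite !measure0.
rewrite /nu /mscale/= /pushforward/=.
have -> : phi @^-1` `]p, q] = `]a * p, a * q]%classic.
  apply/seteqP; split => x /=; rewrite !in_itv/= /phi ltr_pdivlMr// ler_pdivrMr//;
    by rewrite ![a * _]mulrC.
rewrite !lebesgue_measure_itv/= !lte_fin ltr_pM2l// pq -!EFinB -EFinM; congr EFin.
by field; rewrite gt_eqF.
Qed.

(** The push-forward of Lebesgue measure under x -> x / a, divided by a, agrees with
    Lebesgue measure on half-open intervals. *)
Lemma lebesgue_scale (A : set (measurableTypeR R)) : measurable A ->
  mu [set x | A (x / a)] = (a%:E * mu A)%E.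
Proof.
move=> mA; rewrite (lebesgue_nu mA) /nu /mscale/= /pushforward muleA -EFinM.
by rewrite mulfV ?gt_eqF// mul1e.
Qed.

Lemma ae_scale (P : R -> Prop) : {ae mu, forall x, P x} ->
  {ae mu, forall x, P (x / a)}.
Proof.
move=> [A [mA A0 sub]]; exists [set x | A (x / a)]; split.
- by rewrite -[X in measurable X]setTI; exact: mphi.
- by rewrite lebesgue_scale// A0 mule0.
- by move=> x /= nP; apply: sub.
Qed.

Let preimage_itv l : phi @^-1` `[0, l]%classic = `[0, a * l]%classic.
Proof.
apply/seteqP; split => x /=; rewrite !in_itv/= /phi ler_pdivlMr// ler_pdivrMr// mul0r;
  by rewrite [a * _]mulrC.
Qed.

Let ge0_integral_scale l (f : R -> \bar R) : measurable_fun `[0, l] f ->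
  (forall x, 0 <= f x)%E ->
  (\int[mu]_(x in `[0%R, (a * l)%R]) f (x / a)%R = a%:E * \int[mu]_(x in `[0%R, l]) f x)%E.
Proof.
move=> mf f0.
have -> : (\int[mu]_(x in `[0%R, l]) f x = \int[nu]_(x in `[0%R, l]) f x)%E.
  by apply: eq_measure_integral => A mA _; exact: lebesgue_nu.
rewrite /nu ge0_integral_mscale// (ge0_integral_pushforward mphi)//.
rewrite muleA -EFinM/= mulfV ?gt_eqF// mul1e.
by rewrite -preimage_itv.
Qed.

Lemma L2_scale l u : L2 l u -> L2 (a * l) (fun x => u (x / a)).
Proof.
move=> [mu_ iu]; have m_scale : measurable_fun `[0, a * l] (fun x => u (x / a)).
  rewrite -preimage_itv; apply: (measurable_comp (F := `[0, l]%classic)) => //.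
    by move=> _ [x xD <-].
  exact: measurable_funS mphi.
split => //; apply/integrableP; split.
  exact/measurable_EFinP/measurable_funX.
have := ge0_integral_scale (f := fun x => `|(u x ^+ 2)%:E|%E).
rewrite /= => ->//; last exact/measurable_EFinP/measurableT_comp/measurable_funX.
by apply: lte_mul_pinfty; rewrite ?lee_fin ?ltW//; case/integrableP: iu.
Qed.

Lemma ip_scale l u v : L2 l u -> L2 l v ->
  ip (a * l) (fun x => u (x / a)) (fun x => v (x / a)) = a * ip l u v.
Proof.
move=> hu hv; have iuv := sq_integrableM (mitv _) hu hv.
have muv := measurable_int _ iuv.
pose w x := (u x * v x)%:E.
rewrite /ip /inner /Rintegral.
have -> : (\int[mu]_(x in `[0%R, (a * l)%R]) (u (x / a) * v (x / a))%:E
    = a%:E * \int[mu]_(x in `[0%R, l]) (w x))%E.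
  rewrite integralE [in RHS]integralE muleBr//; last first.
    exact: integrable_add_def.
  rewrite -!ge0_integral_scale//.
  - congr (_ - _)%E; apply: eq_integral => x _; first by rewrite !funeposE.
    by rewrite !funenegE.
  - exact: measurable_funeneg.
  - exact: measurable_funepos.
by rewrite fineM//; exact: integrable_fin_num.
Qed.

Lemma primitive_scale l u x : L2 l u -> 0 <= x <= l ->
  primitive (fun t => u (t / a)) (a * x) = a * primitive u x.
Proof.
move=> hu /andP[x0 xl]; rewrite -!ip_cst1.
exact: (ip_scale (L2_le xl hu) (L2_cst x 1)).
Qed.

End Scaling.

(** * Absolutely continuous functions and the Dirichlet problem on [0, l] *)

Section AbsolutelyContinuous.
Variable R : realType.
Implicit Types (l x y : R) (u v w du dv : R -> R).

(** The real counterpart of [H1_interval]: du is the weak derivative, and u is the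
    continuous representative, given at every point. *)
Definition ac l u du :=
  L2 l du /\ forall x, 0 <= x <= l -> u x = u 0 + primitive du x.

Lemma ac_le l x u du : x <= l -> ac l u du -> ac x u du.
Proof.
move=> xl [hdu hu]; split; first exact: L2_le hdu.
by move=> y /andP[y0 yx]; rewrite -hu// y0 (le_trans yx).
Qed.

Lemma ac_ext l u u' du : 0 <= l -> (forall x, 0 <= x <= l -> u x = u' x) ->
  ac l u du -> ac l u' du.
Proof.
move=> l0 uu [hdu hu]; split=> // x xl.
by rewrite -!uu ?lexx//; exact: hu.
Qed.

Lemma ac_lin l (c : R) u du v dv : ac l u du -> ac l v dv ->
  ac l (fun x => c * u x + v x) (fun x => c * du x + dv x).
Proof.
move=> [hdu hu] [hdv hv]; split; first exact: L2_lin.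
move=> x xl; have /andP[_ xl'] := xl.
by rewrite (primitive_lin c xl')// hu// hv//; ring.
Qed.

Lemma ac_primitive l u : L2 l u -> ac l (primitive u) u.
Proof. by move=> hu; split=> // x _; rewrite primitive0 add0r. Qed.

Lemma primitive_cst x (c : R) : 0 <= x -> primitive (fun=> c) x = c * x.
Proof.
move=> x0; have /= := ip_cstl c (L2_cst x 1); rewrite -ip_cst1 ip11// => <-.
by rewrite -ip_cst1.
Qed.

Lemma ac_affine l (c b : R) : ac l (fun x => c + b * x) (fun=> b).
Proof.
split; first exact: L2_cst.
by move=> x /andP[x0 _]; rewrite primitive_cst// mulr0 addr0.
Qed.

Lemma ac_L2 l u du : 0 <= l -> ac l u du -> L2 l u.
Proof.
move=> l0 [hdu hu].
apply: (@L2_ext _ _ (fun x => 1 * u 0 + primitive du x)).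
  by move=> x xl; rewrite mul1r -hu.
by apply: L2_lin; [exact: L2_cst | exact: L2_primitive].
Qed.

Lemma ac_by_parts l u du v dv : 0 <= l -> ac l u du -> ac l v dv ->
  ip l u dv + ip l du v = u l * v l - u 0 * v 0.
Proof.
move=> l0 [hdu hu] [hdv hv].
have part w dw z : L2 l dw -> L2 l z ->
    (forall x, 0 <= x <= l -> w x = w 0 + primitive dw x) ->
    ip l w z = w 0 * primitive z l + ip l (primitive dw) z.
  move=> hdw hz hw; rewrite -ip_cst1 (ipC _ z) -ip_linl//; last 2 first.
  - exact: L2_cst.
  - exact: L2_primitive.
  by apply: ip_ext => // x xl; rewrite mulr1 hw.
rewrite (part u du)// (ipC _ du) (part v dv)// (hu l) ?l0 ?lexx// (hv l) ?l0 ?lexx//.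
have := primitive_by_parts l0 hdu hdv; rewrite (ipC _ du) => h.
by move: h; lra.
Qed.

Lemma ac_primitive_eq l u du v dv : (forall x, 0 <= x <= l -> u x = v x) ->
  ac l u du -> ac l v dv -> 0 <= l ->
  forall x, 0 <= x <= l -> primitive (fun t => -1 * du t + dv t) x = 0.
Proof.
move=> uv [hdu hu] [hdv hv] l0 x xl; have /andP[_ xl'] := xl.
rewrite (primitive_lin _ xl')//.
by move: (hu x xl) (hv x xl); rewrite !uv ?lexx ?l0// => -> /addrI ->; ring.
Qed.

(** An absolutely continuous weak derivative is determined everywhere, endpoints
    included: if d is the derivative of zero then d = 0 almost everywhere, so
    d(x)^2 - d(0)^2, the integral of 2 d d', vanishes for every x, and the
    constant d^2 has integral zero. *)
Lemma ac_deriv_eq0 l d e : 0 < l -> ac l d e ->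
  (forall x, 0 <= x <= l -> primitive d x = 0) ->
  forall x, 0 <= x <= l -> d x = 0.
Proof.
move=> l_gt0 hd d0; have l0 := ltW l_gt0; have hdL := ac_L2 l0 hd.
have hPd : ac l (primitive d) d by exact: ac_primitive.
have dd : ip l d d = 0.
  have := ac_by_parts l0 hPd hd; rewrite !d0 ?lexx ?l0// !mul0r subrr.
  by rewrite (ip_ext (u' := fun=> 0) (v' := e))// ip0l add0r.
have sq_cst x : 0 <= x <= l -> d x ^+ 2 = d 0 ^+ 2.
  move=> /andP[x0 xl]; have hdx := ac_le xl hd.
  have := ac_by_parts x0 hdx hdx; rewrite (ipC _ e) -!expr2 => h.
  have hdLx := L2_le xl hdL.
  have de : ip x d e ^+ 2 <= ip x d d * ip x e e.
    by apply: inner_cauchy_schwarz => //; exact: hdx.1.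
  have ddx : ip x d d = 0.
    have hPx := ac_primitive hdLx.
    have := ac_by_parts x0 hPx hdx; rewrite !d0 ?lexx ?l0 ?x0// !mul0r subrr.
    rewrite (ip_ext (u' := fun=> 0) (v' := e))// ?ip0l ?add0r// => y /andP[y0 yx].
    by rewrite d0// y0 (le_trans yx).
  move: de; rewrite ddx mul0r => de.
  have de0 : ip x d e = 0 by apply/eqP; rewrite -sqrf_eq0 eq_le de sqr_ge0.
  by move: h; rewrite de0; lra.
have d00 : d 0 ^+ 2 = 0.
  have : ip l d d = d 0 ^+ 2 * l.
    rewrite -primitive_cst// /primitive /ip /inner.
    by apply: eq_Rintegral => x; rewrite in_itv0 -expr2; exact: sq_cst.
  rewrite dd => /esym/eqP; rewrite mulf_eq0 (gt_eqF l_gt0) orbF => /eqP.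
  by [].
by move=> x xl; apply/eqP; rewrite -sqrf_eq0 sq_cst// d00.
Qed.

Lemma ac_sup l u du x : 0 <= x <= l -> ac l u du -> u 0 = 0 ->
  u x ^+ 2 <= l * ip l du du.
Proof.
by move=> xl [hdu hu] u0; rewrite hu// u0 add0r; exact: primitive_sq_le.
Qed.

Lemma ip_le_sup l u (B : R) : 0 <= l -> L2 l u ->
  (forall x, 0 <= x <= l -> u x ^+ 2 <= B) -> ip l u u <= l * B.
Proof.
move=> l0 hu uB; rewrite mulrC -primitive_cst// /primitive /ip /inner.
apply: le_Rintegral => //.
- exact: sq_integrableM.
- exact: L2_integrable (L2_cst l B).
Qed.

(** The solution of f'' = w with zero boundary values, and its derivative. *)
Definition dirichlet_deriv l w x := primitive w x - primitive (primitive w) l / l.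
Definition dirichlet l w x :=
  primitive (primitive w) x - primitive (primitive w) l / l * x.

Lemma dirichlet_ac l w : 0 <= l -> L2 l w ->
  ac l (dirichlet l w) (dirichlet_deriv l w) /\ ac l (dirichlet_deriv l w) w.
Proof.
move=> l0 hw; have hPw := L2_primitive l0 hw.
pose c := - (primitive (primitive w) l / l); split.
  have [h1 h2] := ac_lin 1 (ac_primitive hPw) (ac_affine l 0 c); split.
    by apply: L2_ext h1 => x _; rewrite mul1r.
  move=> x xl; have := h2 x xl; rewrite /dirichlet !mul1r !add0r mulr0 addr0.
  rewrite mulNr => ->; rewrite mulr0 subr0; congr (_ + _).
  by apply: primitive_ext => t _; rewrite mul1r.
have [h1 h2] := ac_lin 1 (ac_primitive hw) (ac_affine l c 0); split=> // x xl.
have := h2 x xl; rewrite /dirichlet_deriv !mul1r !mul0r !addr0 => ->; congr (_ + _).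
by apply: primitive_ext => t _; rewrite mul1r addr0.
Qed.

Lemma dirichlet_at0 l w : dirichlet l w 0 = 0.
Proof. by rewrite /dirichlet primitive0 mulr0 subrr. Qed.

Lemma dirichlet_at_end l w : 0 < l -> dirichlet l w l = 0.
Proof. by move=> l0; rewrite /dirichlet divfK ?gt_eqF// subrr. Qed.

(** Integrating twice leaves f' 0 as the only unknown, and the boundary value at l
    fixes it. *)
Lemma dirichlet_unique l f f1 f2 : 0 < l -> ac l f f1 -> ac l f1 f2 ->
  f 0 = 0 -> f l = 0 -> forall x, 0 <= x <= l ->
    f x = dirichlet l f2 x /\ f1 x = dirichlet_deriv l f2 x.
Proof.
move=> l_gt0 [hf1 hf] [hf2 hf1'] f0 fl; have l0 := ltW l_gt0.
have fE x : 0 <= x <= l -> f x = f1 0 * x + primitive (primitive f2) x.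
  move=> xl; have /andP[x0 xl'] := xl; rewrite hf// f0 add0r.
  rewrite (@primitive_ext _ _ (fun t => 1 * f1 0 + primitive f2 t)); last first.
    by move=> t /andP[t0 tx]; rewrite mul1r -hf1'// t0 (le_trans tx).
  rewrite (primitive_lin _ xl')// ?mul1r ?primitive_cst//.
  - exact: L2_cst.
  - exact: L2_primitive.
have f10 : f1 0 = - (primitive (primitive f2) l / l).
  have := fE l; rewrite fl lexx l0 => /(_ isT) h.
  apply: (mulIf (lt0r_neq0 l_gt0)); rewrite mulNr divfK ?gt_eqF//; lra.
by move=> x xl; rewrite fE// (hf1' x xl) f10 /dirichlet /dirichlet_deriv; split; ring.
Qed.

Lemma dirichlet_lin l (c : R) u v x : 0 <= x <= l -> L2 l u -> L2 l v ->
  dirichlet l (fun t => c * u t + v t) x = c * dirichlet l u x + dirichlet l v x.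
Proof.
move=> /andP[x0 xl] hu hv; have l0 := le_trans x0 xl.
have PP y : 0 <= y <= l -> primitive (primitive (fun t => c * u t + v t)) y
    = c * primitive (primitive u) y + primitive (primitive v) y.
  move=> /andP[y0 yl].
  rewrite -(primitive_lin _ yl); [|exact: L2_primitive..].
  apply: primitive_ext => t /andP[t0 ty].
  by rewrite (primitive_lin _ (le_trans ty yl)).
have xl' : 0 <= x <= l by rewrite x0.
have ll : 0 <= l <= l by rewrite l0 lexx.
rewrite /dirichlet (PP x xl') (PP l ll).
move: (primitive (primitive u) x) (primitive (primitive v) x).
by move: (primitive (primitive u) l) (primitive (primitive v) l) => *; ring.
Qed.

Lemma ac_scale (a : R) l u du : 0 < a -> ac l u du ->
  ac (a * l) (fun x => a * u (x / a)) (fun x => du (x / a)).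
Proof.
move=> a0 [hdu hu]; split; first exact: L2_scale.
move=> x /andP[x0 xal].
have xl : 0 <= x / a <= l.
  by rewrite divr_ge0 ?(ltW a0)//= ler_pdivrMr// [l * a]mulrC.
rewrite mul0r hu// mulrDr -(primitive_scale a0 hdu xl).
by rewrite mulrCA mulfV ?mulr1// gt_eqF.
Qed.

End AbsolutelyContinuous.

(** * Square integrable functions on the graph *)

Section AlmostEverywhere.
Variable R : realType.
Local Notation mu := (@lebesgue_measure R).
Implicit Types P Q S : R -> Prop.

Lemma lebesgue_ae1 P Q : (forall x, P x -> Q x) ->
  {ae mu, forall x, P x} -> {ae mu, forall x, Q x}.
Proof. by move=> h; apply: (@filterS _ _ (ae_filter_ringOfSetsType mu)). Qed.

Lemma lebesgue_ae2 P Q S : (forall x, P x -> Q x -> S x) ->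
  {ae mu, forall x, P x} -> {ae mu, forall x, Q x} -> {ae mu, forall x, S x}.
Proof. by move=> h; apply: (@filterS2 _ _ (ae_filter_ringOfSetsType mu)). Qed.

(** The two endpoints form a null set. *)
Lemma ae_closed_itv (l : R) P : {ae mu, forall x, 0 < x < l -> P x} ->
  {ae mu, forall x, `[0, l]%classic x -> P x}.
Proof.
move=> h; have ne (y : R) : {ae mu, forall x, x <> y}.
  exists [set y]; split; [exact: measurable_set1 | exact: lebesgue_measure_set1|].
  by move=> x /= /contrapT ->.
have ne0l := lebesgue_ae2 (fun x => @conj _ _) (ne 0) (ne l).
apply: lebesgue_ae2 h ne0l => x h [/eqP x0 /eqP xl] /=.
rewrite in_itv/= => /andP[x1 x2]; apply: h.
by rewrite !lt_neqAle eq_sym x0 x1 xl x2.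
Qed.

Let mitv (i : interval R) : measurable ([set` i] : set (measurableTypeR R)).
Proof. exact: measurable_itv. Qed.

Lemma ip_ae (l : R) (u u' v v' : R -> R) : L2 l u -> L2 l u' -> L2 l v -> L2 l v' ->
  {ae mu, forall x, 0 < x < l -> u x = u' x} ->
  {ae mu, forall x, 0 < x < l -> v x = v' x} -> ip l u v = ip l u' v'.
Proof.
move=> hu hu' hv hv' /ae_closed_itv uu /ae_closed_itv vv.
exact: (ae_eq_inner (mitv _) hu hu' hv hv' uu vv).
Qed.

Lemma ip_eq0 (l : R) (u : R -> R) : L2 l u -> ip l u u = 0 ->
  {ae mu, forall x, 0 < x < l -> u x = 0}.
Proof.
move=> hu uu; apply: lebesgue_ae1 (inner_eq0 (mitv _) hu uu) => x hx /andP[x0 xl].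
by apply: hx; rewrite /= in_itv/= !ltW.
Qed.

Lemma L2_mul_bounded (l : R) (b u : R -> R) (M : R) : measurable_fun `[0, l] b ->
  (forall x, 0 <= x <= l -> `|b x| <= M) -> L2 l u -> L2 l (fun x => b x * u x).
Proof.
move=> mb bM hu; apply: (sq_integrable_mulb (mitv _) mb _ hu) => x /=.
by rewrite in_itv/=; exact: bM.
Qed.

End AlmostEverywhere.

Section GraphForms.
Variables (R : realType) (G : metric_graph R).
Local Notation mu := (@lebesgue_measure R).
Local Notation V := (edge G -> R -> R^o).
Implicit Types (u v w f h : V) (e : edge G) (p : endpoint G).

Definition graph_L2 (u : V) := forall e, L2 (len e) (u e).
Definition gip (u v : V) : R := \sum_e ip (len e) (u e) (v e).
Definition graph_ac (u du : V) := forall e, ac (len e) (u e) (du e).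

Let len_ge0 e : 0 <= len e. Proof. exact/ltW/len_gt0. Qed.

Lemma graph_L2_lin (c : R) u v : graph_L2 u -> graph_L2 v -> graph_L2 (c *: u + v).
Proof. by move=> hu hv e; apply: L2_lin. Qed.

Lemma graph_L2_0 : graph_L2 0.
Proof. by move=> e; exact: L2_cst. Qed.

Lemma graph_L2_sum (I : Type) (r : seq I) (P : pred I) (F : I -> V) :
  (forall i, graph_L2 (F i)) -> graph_L2 (\sum_(i <- r | P i) F i).
Proof.
move=> hF; elim/big_rec: _ => [|i x _ hx]; first exact: graph_L2_0.
by rewrite -[F i]scale1r; exact: graph_L2_lin.
Qed.

Lemma graph_sumE (I : Type) (r : seq I) (P : pred I) (F : I -> V) e x :
  (\sum_(i <- r | P i) F i) e x = \sum_(i <- r | P i) F i e x.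
Proof. by elim/big_rec2: _ => // i y z _ <-. Qed.

Lemma graph_scaleE (c : R) u e x : (c *: u) e x = c * u e x.
Proof. by []. Qed.

Lemma graph_L2Z (c : R) u : graph_L2 u -> graph_L2 (c *: u).
Proof. by move=> hu; rewrite -[_ *: _]addr0; exact: graph_L2_lin hu graph_L2_0. Qed.

Lemma graph_L2B u v : graph_L2 u -> graph_L2 v -> graph_L2 (u - v).
Proof. by move=> hu hv; rewrite addrC -scaleN1r; exact: graph_L2_lin. Qed.

Lemma graph_ac_L2 u du : graph_ac u du -> graph_L2 u.
Proof. by move=> h e; exact: ac_L2 (h e). Qed.

Lemma gip_form : psd_form graph_L2 gip.
Proof.
split.
- move=> c x y z hx hy hz; rewrite /gip mulr_sumr -big_split/=.
  by apply: eq_bigr => e _; exact: ip_linl.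
- by move=> x y _ _; apply: eq_bigr => e _; exact: ipC.
- by move=> x _; apply: sumr_ge0 => e _; exact: ip_ge0.
Qed.

Lemma gipC u v : gip u v = gip v u.
Proof. by apply: eq_bigr => e _; exact: ipC. Qed.

Lemma gip_ge0 u : 0 <= gip u u.
Proof. by apply: sumr_ge0 => e _; exact: ip_ge0. Qed.

Lemma gip_linl (c : R) u v w : graph_L2 u -> graph_L2 v -> graph_L2 w ->
  gip (c *: u + v) w = c * gip u w + gip v w.
Proof. by move=> *; have [->] := gip_form. Qed.

Lemma gip_linr (c : R) u v w : graph_L2 u -> graph_L2 v -> graph_L2 w ->
  gip w (c *: u + v) = c * gip w u + gip w v.
Proof. by move=> *; rewrite gipC gip_linl// !(gipC w). Qed.

Lemma gip0l u : gip 0 u = 0.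
Proof. by apply: big1 => e _; exact: ip0l. Qed.

Lemma gip_sumr (I : Type) (r : seq I) (P : pred I) (c : I -> R) (F : I -> V) u :
  graph_L2 u -> (forall i, graph_L2 (F i)) ->
  gip u (\sum_(i <- r | P i) c i *: F i) = \sum_(i <- r | P i) c i * gip u (F i).
Proof.
move=> hu hF; suff [_ ->//] : graph_L2 (\sum_(i <- r | P i) c i *: F i) /\
  gip u (\sum_(i <- r | P i) c i *: F i) = \sum_(i <- r | P i) c i * gip u (F i).
elim/big_rec2: _ => [|i y x _ [hx <-]].
  by split; [exact: graph_L2_0 | rewrite gipC gip0l].
by split; [exact: graph_L2_lin | rewrite gip_linr].
Qed.

Lemma gip_suml (I : Type) (r : seq I) (P : pred I) (c : I -> R) (F : I -> V) u :
  graph_L2 u -> (forall i, graph_L2 (F i)) ->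
  gip (\sum_(i <- r | P i) c i *: F i) u = \sum_(i <- r | P i) c i * gip (F i) u.
Proof.
by move=> hu hF; rewrite gipC gip_sumr//; apply: eq_bigr => i _; rewrite gipC.
Qed.

Lemma gip_ext u u' v v' : (forall e x, 0 <= x <= len e -> u e x = u' e x) ->
  (forall e x, 0 <= x <= len e -> v e x = v' e x) -> gip u v = gip u' v'.
Proof.
by move=> uu vv; apply: eq_bigr => e _; apply: ip_ext => x; [exact: uu|exact: vv].
Qed.

Definition graph_ae_eq (u v : V) :=
  forall e, {ae mu, forall x, 0 < x < len e -> u e x = v e x}.

Lemma gip_ae u u' v v' : graph_L2 u -> graph_L2 u' -> graph_L2 v -> graph_L2 v' ->
  graph_ae_eq u u' -> graph_ae_eq v v' -> gip u v = gip u' v'.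
Proof.
move=> hu hu' hv hv' uu vv; apply: eq_bigr => e _.
exact: ip_ae (hu e) (hu' e) (hv e) (hv' e) (uu e) (vv e).
Qed.

Lemma gip_eq0 u : graph_L2 u -> gip u u = 0 -> graph_ae_eq u 0.
Proof.
move=> hu /eqP; rewrite psumr_eq0 => [/allP h e|e _]; last exact: ip_ge0.
have /eqP ue : ip (len e) (u e) (u e) == 0 by apply: h; rewrite mem_index_enum.
exact: ip_eq0 (hu e) ue.
Qed.

Lemma graph_ae_refl u : graph_ae_eq u u.
Proof. by move=> e; exact: nearW. Qed.

Definition rtrace (f : V) p : R := if p.2 then f p.1 (len p.1) else f p.1 0.
Definition rnormal (f1 : V) (v : vert G) : R :=
  \sum_(p : endpoint G | end_vert p == v) (if p.2 then rtrace f1 p else - rtrace f1 p).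

(** The boundary terms of an integration by parts on every edge, regrouped by
    vertices. *)
Lemma boundary_sum (f1 h : V) (c : vert G -> R) :
  (forall p, rtrace h p = c (end_vert p)) ->
  \sum_e (f1 e (len e) * h e (len e) - f1 e 0 * h e 0) = \sum_v rnormal f1 v * c v.
Proof.
move=> hc.
transitivity (\sum_(p : endpoint G)
    (if p.2 then rtrace f1 p else - rtrace f1 p) * c (end_vert p)).
  rewrite -(pair_bigA _ (fun e b =>
    (if b then rtrace f1 (e, b) else - rtrace f1 (e, b)) * c (end_vert (e, b))))/=.
  by apply: eq_bigr => e _; rewrite big_bool/= -!hc mulNr.
rewrite (partition_big (@end_vert R G) xpredT)//=; apply: eq_bigr => v _.
by rewrite mulr_suml; apply: eq_bigr => p /eqP ->.
Qed.

(** Continuous functions that are linear on every edge: by Green's formula, the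
    second derivatives of the functions in the domain of S are exactly the
    square integrable functions orthogonal to these. *)
Definition edge_linear (c : vert G -> R) : V := fun e x =>
  c (src e) + (c (tgt e) - c (src e)) / len e * x.

Lemma edge_linear_trace c p : rtrace (edge_linear c) p = c (end_vert p).
Proof.
rewrite /rtrace /edge_linear /end_vert; case: p => e [] /=; last by rewrite mulr0 addr0.
by rewrite divfK ?gt_eqF ?len_gt0// addrC subrK.
Qed.

Lemma edge_linear_ac c :
  graph_ac (edge_linear c) (fun e _ => (c (tgt e) - c (src e)) / len e).
Proof. by move=> e; exact: ac_affine. Qed.

Lemma edge_linear_L2 c : graph_L2 (edge_linear c).
Proof. exact: graph_ac_L2 (edge_linear_ac c). Qed.

Lemma edge_linear_sum c : edge_linear c =
  \sum_(v : vert G) c v *: edge_linear (fun y => (y == v)%:R).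
Proof.
have delta y : \sum_(v : vert G) c v * (y == v)%:R = c y.
  rewrite (bigD1 y)//= eqxx mulr1 big1 ?addr0// => v.
  by rewrite eq_sym => /negbTE ->; rewrite mulr0.
apply/funext => e; apply/funext => x; rewrite graph_sumE /edge_linear.
rewrite -(delta (src e)) -(delta (tgt e)) -sumrB !mulr_suml -big_split/=.
by apply: eq_bigr => v _; rewrite graph_scaleE; ring.
Qed.

(** Orthogonal projection onto the span of a finite family: the system given by
    the Gram matrix is solvable since a vector of its kernel gives a combination
    of norm zero, to which every inner product is zero. *)
Lemma gip_projection (n : nat) (psi : 'I_n -> V) z : graph_L2 z ->
  (forall i, graph_L2 (psi i)) ->
  exists c : 'I_n -> R, forall i, gip (\sum_j c j *: psi j) (psi i) = gip z (psi i).
Proof.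
move=> hz hpsi.
pose M : 'M[R]_n := \matrix_(i, j) gip (psi i) (psi j).
pose b : 'rV[R]_n := \row_j gip z (psi j).
have : (b <= M)%MS.
  rewrite submxE; apply/eqP/rowP => k; rewrite mxE [RHS]mxE.
  pose x i := cokermx M i k; pose y := \sum_i x i *: psi i.
  have hy : graph_L2 y by apply: graph_L2_sum => i; exact: graph_L2Z.
  have My i : gip (psi i) y = 0.
    have <- : (M *m cokermx M) i k = 0 by rewrite mulmx_coker mxE.
    by rewrite gip_sumr// [RHS]mxE; apply: eq_bigr => j _; rewrite [M i j]mxE mulrC.
  have yy : gip y y = 0 by rewrite {1}/y gip_suml// big1// => i _; rewrite My mulr0.
  have := psd_form_null (@graph_L2_lin) gip_form hy hz yy.
  rewrite gipC [gip z y]gip_sumr// => yz; rewrite -[RHS]yz.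
  by apply: eq_bigr => i _; rewrite [b 0 i]mxE mulrC.
move=> /submxP[c bc]; exists (fun i => c 0 i) => i.
have <- : b 0 i = gip z (psi i) by rewrite mxE.
by rewrite bc [RHS]mxE gip_suml//; apply: eq_bigr => j _; rewrite [M j i]mxE.
Qed.

(** The edgewise linear functions form a finite-dimensional space, hence a closed
    one: the projection onto it is given by [gip_projection], and the remainder is
    orthogonal to itself. *)
Lemma edge_linear_bipolar z : graph_L2 z ->
  (forall y, graph_L2 y -> (forall c, gip y (edge_linear c) = 0) -> gip z y = 0) ->
  exists c, graph_ae_eq z (edge_linear c).
Proof.
move=> hz hzy.
pose psi (i : 'I_#|vert G|) : V := edge_linear (fun y => (y == enum_val i)%:R).
have hpsi i : graph_L2 (psi i) by exact: edge_linear_L2.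
have [d hd] := gip_projection hz hpsi.
pose c (v : vert G) := d (enum_rank v); exists c.
have cE : edge_linear c = \sum_i d i *: psi i.
  rewrite edge_linear_sum (reindex (fun i : 'I_#|vert G| => enum_val i)) /=; last first.
    by exists enum_rank => x _; [exact: enum_valK | exact: enum_rankK].
  by apply: eq_bigr => i _; rewrite /c enum_valK.
have hc := edge_linear_L2 c.
have hy := graph_L2B hz hc; set y := z - _ in hy.
have yE : y = (-1) *: edge_linear c + z by rewrite /y scaleN1r addrC.
have y_psi i : gip y (psi i) = 0.
  by rewrite yE gip_linl// cE hd; ring.
have y_lin c' : gip y (edge_linear c') = 0.
  rewrite edge_linear_sum gip_sumr// => [|v]; last exact: edge_linear_L2.
  rewrite big1// => v _; have := y_psi (enum_rank v).
  by rewrite /psi enum_rankK => ->; rewrite mulr0.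
have yy : gip y y = 0 by rewrite {1}yE gip_linl// hzy// (gipC _ y) y_lin; ring.
move=> e; have := gip_eq0 hy yy e.
by apply: lebesgue_ae1 => x h /h; rewrite /y => /eqP; rewrite subr_eq0 => /eqP.
Qed.

End GraphForms.

(** * The operator S and the eigenfunctions of its Krein extension *)

Section Operator.
Variables (R : realType) (G : metric_graph R) (q : edge G -> R -> R).
Hypothesis q_adm : admissible_potential q.
Local Notation V := (edge G -> R -> R^o).
Implicit Types (u v w y z f g h : V) (e : edge G) (p : endpoint G).

Let len_ge0 e : 0 <= len e. Proof. exact/ltW/len_gt0. Qed.

Lemma potential_measurable e : measurable_fun `[0, len e] (q e).
Proof. by have [mq _ _] := q_adm; exact: measurable_fun_itv_cc (mq e). Qed.

(** The bound holds on open edges; the values of q at the two endpoints of each edge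
    are added so that it holds on closed edges. *)
Lemma potential_bounded :
  exists2 M : R, 0 <= M & forall e (x : R), 0 <= x <= len e -> `|q e x| <= M.
Proof.
have [_ [M hM] _] := q_adm.
exists (`|M| + \sum_e (`|q e 0| + `|q e (len e)|)).
  by rewrite addr_ge0// sumr_ge0// => e _; rewrite addr_ge0.
have ends e : `|q e 0| + `|q e (len e)| <= \sum_e (`|q e 0| + `|q e (len e)|).
  by rewrite (bigD1 e)//= lerDl sumr_ge0// => i _; rewrite addr_ge0.
move=> e x /andP[]; rewrite le_eqVlt => /predU1P[<- _|x0].
  by rewrite (le_trans _ (lerD (normr_ge0 M) (ends e)))// add0r lerDl.
rewrite le_eqVlt => /predU1P[->|xl].
  by rewrite (le_trans _ (lerD (normr_ge0 M) (ends e)))// add0r lerDr.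
by rewrite (le_trans (hM e x _)) ?x0// (le_trans (ler_norm M))// lerDl sumr_ge0.
Qed.

Lemma potential_mul_L2 u : graph_L2 u -> graph_L2 (fun e x => q e x * u e x).
Proof.
have [M M0 qM] := potential_bounded; move=> hu e.
by apply: (L2_mul_bounded _ _ (hu e)); [exact: potential_measurable | exact: qM].
Qed.

(** The function f with second derivative w that vanishes at the vertices, its
    derivative [prim1 w], and [schrod w] = - f'' + q f. *)
Definition prim2 w : V := fun e => dirichlet (len e) (w e).
Definition prim1 w : V := fun e => dirichlet_deriv (len e) (w e).
Definition schrod w : V := fun e x => - w e x + q e x * prim2 w e x.

Lemma prim2_ac w : graph_L2 w -> graph_ac (prim2 w) (prim1 w) /\ graph_ac (prim1 w) w.
Proof. by move=> hw; split=> e; have [] := dirichlet_ac (len_ge0 e) (hw e). Qed.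

Lemma prim2_L2 w : graph_L2 w -> graph_L2 (prim2 w).
Proof. by move=> /prim2_ac[/graph_ac_L2]. Qed.

Lemma prim1_L2 w : graph_L2 w -> graph_L2 (prim1 w).
Proof. by move=> /prim2_ac[_ /graph_ac_L2]. Qed.

Lemma schrodE w : schrod w = (-1) *: w + (fun e x => q e x * prim2 w e x).
Proof.
apply/funext => e; apply/funext => x.
by rewrite -[RHS]/(-1 * w e x + q e x * prim2 w e x) mulN1r.
Qed.

Lemma schrod_L2 w : graph_L2 w -> graph_L2 (schrod w).
Proof.
by move=> hw; rewrite schrodE; apply: graph_L2_lin => //; exact/potential_mul_L2/prim2_L2.
Qed.

Lemma prim2_lin (c : R) u v e x : graph_L2 u -> graph_L2 v -> 0 <= x <= len e ->
  prim2 (c *: u + v) e x = (c *: prim2 u + prim2 v) e x.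
Proof. by move=> hu hv xl; exact: dirichlet_lin. Qed.

Lemma schrod_lin (c : R) u v e x : graph_L2 u -> graph_L2 v -> 0 <= x <= len e ->
  schrod (c *: u + v) e x = (c *: schrod u + schrod v) e x.
Proof.
move=> hu hv xl; rewrite /schrod prim2_lin//.
rewrite -[RHS]/(c * (- u e x + q e x * prim2 u e x) + (- v e x + q e x * prim2 v e x)).
rewrite -[(c *: u + v) e x]/(c * u e x + v e x).
rewrite -[(c *: prim2 u + prim2 v) e x]/(c * prim2 u e x + prim2 v e x).
have distr (b a1 a2 b1 b2 : R) : - (c * a1 + a2) + b * (c * b1 + b2)
    = c * (- a1 + b * b1) + (- a2 + b * b2) by ring.
exact: distr.
Qed.

Lemma prim2_at0 w e : prim2 w e 0 = 0.
Proof. exact: dirichlet_at0. Qed.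

Lemma prim2_at_end w e : prim2 w e (len e) = 0.
Proof. exact/dirichlet_at_end/len_gt0. Qed.

Lemma ip_prim2 w u u1 e : graph_L2 w -> graph_ac u u1 ->
  ip (len e) (prim2 w e) (u1 e) = - ip (len e) (prim1 w e) (u e).
Proof.
move=> hw hu; have [hj hj1] := prim2_ac hw.
have := ac_by_parts (len_ge0 e) (hj e) (hu e).
by rewrite prim2_at0 prim2_at_end !mul0r subrr => /eqP; rewrite addr_eq0 => /eqP.
Qed.

(** Integration by parts, without boundary terms as prim2 u vanishes at the
    endpoints. It makes [prim2] symmetric. *)
Lemma gip_prim2_prim1 u v : graph_L2 u -> graph_L2 v -> gip (prim2 u) v = - gip (prim1 u) (prim1 v).
Proof.
move=> hu hv; rewrite /gip -sumrN; apply: eq_bigr => e _.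
by apply: ip_prim2 => //; have [] := prim2_ac hv.
Qed.

Lemma gip_prim2C u v : graph_L2 u -> graph_L2 v -> gip (prim2 u) v = gip (prim2 v) u.
Proof.
move=> hu hv; apply: etrans (gip_prim2_prim1 hu hv) _.
exact: etrans (congr1 -%R (gipC _ _)) (esym (gip_prim2_prim1 hv hu)).
Qed.

Lemma gip_mulC u v : gip (fun e x => q e x * u e x) v = gip u (fun e x => q e x * v e x).
Proof. by apply: eq_bigr => e _; apply: eq_Rintegral => x _; ring. Qed.

(** By [gip_edge_linear], w is orthogonal to the edgewise linear functions exactly
    when the normal derivatives of prim2 w vanish at all vertices: w is the second
    derivative of a function in the domain of S. *)
Definition dom_S2 w := graph_L2 w /\ forall c, gip w (edge_linear c) = 0.

(** Green's formula; prim2 w has no boundary values and edgewise linear functions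
    have no second derivative. *)
Lemma gip_edge_linear w c : graph_L2 w ->
  gip w (edge_linear c) = \sum_v rnormal (prim1 w) v * c v.
Proof.
move=> hw; rewrite -(boundary_sum _ (edge_linear_trace c)).
have [hj hj1] := prim2_ac hw.
apply: eq_bigr => e _; have := ac_by_parts (len_ge0 e) (hj1 e) (edge_linear_ac c e).
move=> <-; rewrite [X in X + _](_ : _ = 0) ?add0r//.
rewrite ipC (ip_cstl _ (prim1_L2 hw e)).
have [_ /(_ (len e))] := hj e; rewrite len_ge0 lexx => /(_ isT).
by rewrite prim2_at0 prim2_at_end add0r => <-; rewrite mulr0.
Qed.

(** h is in the kernel of the adjoint of S, with h' = h1 and h'' = h2. *)
Definition ker_S h h1 h2 := [/\ graph_ac h h1, graph_ac h1 h2,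
  exists c : vert G -> R, forall p, rtrace h p = c (end_vert p) &
  graph_ae_eq h2 (fun e x => q e x * h e x)].

Lemma ker_S_L2 h h1 h2 : ker_S h h1 h2 -> graph_L2 h.
Proof. by move=> [/graph_ac_L2]. Qed.

(** The range of S is orthogonal to the kernel of its adjoint. All boundary terms of
    Green's formula vanish: those with the values of prim2 y on every edge, and
    those with its normal derivatives after summation over the vertices. *)
Lemma schrod_ker_S y h h1 h2 : dom_S2 y -> ker_S h h1 h2 -> gip (schrod y) h = 0.
Proof.
move=> [hy ylin] hk; have hh := ker_S_L2 hk; case: hk => hh1 hh2 [c hc] h2E.
have [hj hj1] := prim2_ac hy; have hJ := prim2_L2 hy.
have h2L : graph_L2 h2 by move=> e; have [] := hh2 e.
have bdry : \sum_e (prim1 y e (len e) * h e (len e) - prim1 y e 0 * h e 0) = 0.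
  by rewrite (boundary_sum _ hc) -gip_edge_linear.
have yh : gip y h = gip (prim2 y) h2.
  apply/eqP; rewrite -subr_eq0 -[X in _ == X]bdry /gip -sumrB; apply/eqP.
  apply: eq_bigr => e _; rewrite (ip_prim2 e hy hh2).
  by have := ac_by_parts (len_ge0 e) (hj1 e) (hh1 e) => <-; rewrite opprK addrC.
have hqh := potential_mul_L2 hh; have hqj := potential_mul_L2 hJ.
rewrite schrodE gip_linl// yh gip_mulC.
rewrite (gip_ae hJ hJ h2L hqh (graph_ae_refl (prim2 y)) h2E).
by rewrite mulN1r addNr.
Qed.

(** g is in the eigenspace of kappa for the Krein-von Neumann extension (g = 0 is
    allowed); w is the second derivative of its component in the domain of S. *)
Definition krein_eig (kappa : R) w g := dom_S2 w /\ exists h h1 h2,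
  [/\ ker_S h h1 h2, forall e x, 0 <= x <= len e -> g e x = prim2 w e x + h e x &
      graph_ae_eq (kappa *: g) (schrod w)].

Lemma krein_eig_L2 kappa w g : krein_eig kappa w g -> graph_L2 g.
Proof.
move=> [[hw _] [h [h1 [h2 [hk gE _]]]]] e.
apply: (@L2_ext _ _ (fun x => 1 * prim2 w e x + h e x)) => [x xl|].
  by rewrite mul1r gE.
by apply: L2_lin; [exact: prim2_L2 | exact: ker_S_L2 hk e].
Qed.

(** The component of g in the kernel of the adjoint is orthogonal to the range of
    S. *)
Lemma gip_schrod_eig kappa w g y : krein_eig kappa w g -> dom_S2 y ->
  gip (schrod y) g = gip (schrod y) (prim2 w).
Proof.
move=> [[hw _] [h [h1 [h2 [hk gE _]]]]] hY; have hy := hY.1.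
rewrite (gip_ext (u' := schrod y) (v' := 1 *: prim2 w + h))//; last first.
  by move=> e x xl; rewrite gE// -[RHS]/(1 * prim2 w e x + h e x) mul1r.
rewrite gip_linr ?(schrod_ker_S hY hk) ?mul1r ?addr0//.
- exact: prim2_L2.
- exact: ker_S_L2 hk.
- exact: schrod_L2.
Qed.

Lemma gip_eig kappa w g u : krein_eig kappa w g -> graph_L2 u ->
  gip u (schrod w) = kappa * gip u g.
Proof.
move=> hg hu; have hgL := krein_eig_L2 hg; case: hg => -[hw _] [h [h1 [h2 [_ _ gw]]]].
have hB := schrod_L2 hw; have hkg := graph_L2Z kappa hgL.
rewrite -(gip_ae hu hu hkg hB (graph_ae_refl u) gw) -[_ *: _]addr0 gip_linr//.
  by rewrite [gip u 0]gipC gip0l addr0.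
exact: graph_L2_0.
Qed.

(** The forms <f, S f> and |S f|^2, as functions of f''. Their quotient has the
    positive eigenvalues as critical values. *)
Definition aform y z := gip (prim2 y) (schrod z).
Definition nform y z := gip (schrod y) (schrod z).

Lemma aformE y z : graph_L2 y -> graph_L2 z ->
  aform y z = gip (prim1 y) (prim1 z) + gip (prim2 y) (fun e x => q e x * prim2 z e x).
Proof.
move=> hy hz; rewrite /aform schrodE gip_linr//; last 2 first.
- exact/potential_mul_L2/prim2_L2.
- exact: prim2_L2.
by rewrite gip_prim2_prim1// mulN1r opprK.
Qed.

Lemma aformC y z : graph_L2 y -> graph_L2 z -> aform y z = aform z y.
Proof.
move=> hy hz; apply: etrans (aformE hy hz) (etrans _ (esym (aformE hz hy))).
exact: (congr2 +%R (gipC _ _) (etrans (gipC _ _) (gip_mulC _ _))).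
Qed.

Lemma aform_lin (c : R) x y z : graph_L2 x -> graph_L2 y -> graph_L2 z ->
  aform (c *: x + y) z = c * aform x z + aform y z.
Proof.
move=> hx hy hz; rewrite /aform -gip_linl//; last exact: schrod_L2; last 2 first.
- exact: prim2_L2.
- exact: prim2_L2.
by apply: gip_ext => // e t; exact: prim2_lin.
Qed.

Lemma nform_lin (c : R) x y z : graph_L2 x -> graph_L2 y -> graph_L2 z ->
  nform (c *: x + y) z = c * nform x z + nform y z.
Proof.
move=> hx hy hz; rewrite /nform -gip_linl//; last exact: schrod_L2; last 2 first.
- exact: schrod_L2.
- exact: schrod_L2.
by apply: gip_ext => // e t; exact: schrod_lin.
Qed.

Lemma potential_form_ge0 u e : graph_L2 u ->
  0 <= ip (len e) (u e) (fun x => q e x * u e x).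
Proof.
move=> hu; have hqu := potential_mul_L2 hu.
pose v := fun (e : edge G) x => `|q e x| * u e x.
have hv : L2 (len e) (v e).
  have [M M0 qM] := potential_bounded.
  apply: (L2_mul_bounded (M := M)) (hu e) => [|x xl].
    by apply: measurableT_comp => //; exact: potential_measurable.
  by rewrite normr_id; exact: qM.
rewrite (ip_ae (hu e) (hu e) (hqu e) hv); first last.
- have [_ _ q0] := q_adm; apply: lebesgue_ae1 (q0 e) => x h /h q0x.
  by rewrite /v ger0_norm.
- by apply: nearW.
apply: Rintegral_ge0 => x _; rewrite /v mulrCA mulr_ge0// -expr2 sqr_ge0//.
Qed.

Lemma aform_ge y : graph_L2 y -> gip (prim1 y) (prim1 y) <= aform y y.
Proof.
move=> hy; rewrite aformE// lerDl; apply: sumr_ge0 => e _.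
exact/potential_form_ge0/prim2_L2.
Qed.

Lemma aform_psd : psd_form (@graph_L2 R G) aform.
Proof.
split; [exact: aform_lin | exact: aformC |].
by move=> y hy; exact: le_trans (gip_ge0 _) (aform_ge hy).
Qed.

Lemma nform_psd : psd_form (@graph_L2 R G) nform.
Proof.
split; [exact: nform_lin | by move=> *; exact: gipC |].
by move=> y hy; exact: gip_ge0.
Qed.

End Operator.

(** * Boundedness and compactness of the energy form *)

Section Estimates.
Variable R : realType.

Let mitv (i : interval R) : measurable ([set` i] : set (measurableTypeR R)).
Proof. exact: measurable_itv. Qed.

Lemma ac_holder (l x y : R) (u du : R -> R) : ac l u du -> 0 <= x -> x <= y -> y <= l ->
  (u y - u x) ^+ 2 <= (y - x) * ip l du du.
Proof.
move=> [hdu hu] x0 xy yl; rewrite (hu y) ?(le_trans x0 xy)// (hu x) ?x0 ?(le_trans xy yl)//.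
by rewrite opprD addrACA subrr add0r; exact: primitive_holder.
Qed.

Lemma ip_mul_bounded (l M : R) (b u : R -> R) : 0 <= M -> L2 l u ->
  L2 l (fun x => b x * u x) -> (forall x, 0 <= x <= l -> `|b x| <= M) ->
  ip l (fun x => b x * u x) (fun x => b x * u x) <= M ^+ 2 * ip l u u.
Proof.
move=> M0 hu hbu bM; have iuu := sq_integrableM (mitv _) hu hu.
rewrite /ip /inner -RintegralZl//; apply: le_Rintegral => //.
- exact: sq_integrableM.
- exact: (integrableZl (mitv _) (M ^+ 2) iuu).
- move=> x /=; rewrite in_itv/= => /bM; rewrite -!expr2 exprMn => h.
  apply: ler_wpM2r; first exact: sqr_ge0.
  by rewrite -[b x ^+ 2]real_normK ?num_real//; have := normr_ge0 (b x); nra.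
Qed.

Lemma le_of_sq_le (a c : R) : 0 <= a -> 0 <= c -> a ^+ 2 <= c * a -> a <= c.
Proof.
move=> a0 c0 h; move: a0; rewrite le_eqVlt => /predU1P[<-//|a0].
by rewrite -(ler_pM2r a0) -expr2.
Qed.

Lemma norm_le_of_sq (a d : R) : 0 <= d -> a ^+ 2 <= d ^+ 2 -> `|a| <= d.
Proof.
move=> d0; rewrite -[a ^+ 2]real_normK ?num_real// => h.
by rewrite -(@ler_pXn2r _ 2) ?nnegrE.
Qed.

(** Numbers with the same rounding to multiples of d are d-close. *)
Lemma truncn_eq_close (a b c d : R) : 0 < d -> `|a| <= c -> `|b| <= c ->
  Num.truncn ((a + c) / d) = Num.truncn ((b + c) / d) -> `|a - b| <= d.
Proof.
move=> d0 ac bc ab.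
have pos w : `|w| <= c -> 0 <= (w + c) / d.
  by rewrite ler_norml => /andP[h _]; rewrite divr_ge0 ?(ltW d0)// -lerBlDr sub0r.
have := truncn_itv (pos _ ac); have := truncn_itv (pos _ bc); rewrite ab.
move: (Num.truncn _) => k; rewrite -natr1 => /andP[]; rewrite ler_pdivlMr// ltr_pdivrMr// mulrDl mul1r => h1 h2.
move=> /andP[]; rewrite ler_pdivlMr// ltr_pdivrMr// mulrDl mul1r => h3 h4.
by rewrite ler_norml; apply/andP; split; lra.
Qed.

Lemma sqr_sub_le (a a' b b' d : R) : `|a - a'| <= d -> `|b - b'| <= d ->
  `|a' - b'| <= d -> (a - b) ^+ 2 <= 9 * d ^+ 2.
Proof.
rewrite !ler_norml => /andP[a1 a2] /andP[b1 b2] /andP[c1 c2].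
have h1 : 0 <= 3 * d - (a - b) by lra.
have h2 : 0 <= 3 * d + (a - b) by lra.
by have := mulr_ge0 h1 h2; lra.
Qed.

Lemma double_sum_le4 (s t : R) : s <= 1 -> t <= 1 -> 2 * s + 2 * t <= 4.
Proof. by move=> *; lra. Qed.

Lemma ffun_inord_inj (T : finType) (K : nat) (c c' : T -> nat) :
  (forall p, c p < K.+1)%N -> (forall p, c' p < K.+1)%N ->
  [ffun p => inord (c p) : 'I_K.+1] = [ffun p => inord (c' p)] -> c =1 c'.
Proof.
move=> hc hc' /ffunP cc p; have := cc p.
by rewrite !ffunE => /(congr1 (@nat_of_ord _)); rewrite !inordK.
Qed.

Lemma L2_complete (l k : R) (u : nat -> R -> R) : 0 <= k -> (forall n, L2 l (u n)) ->
  (forall n, ip l (fun x => u n.+1 x - u n x) (fun x => u n.+1 x - u n x)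
    <= (k / 2 ^+ n) ^+ 2) ->
  exists2 w, L2 l w & forall n, ip l (fun x => w x - u n x) (fun x => w x - u n x)
    <= (k *+ 2 / 2 ^+ n) ^+ 2.
Proof.
apply: (sq_integrable_complete (mitv `[0, l])).
by rewrite /= lebesgue_measure_itv/=; case: ifP => // _; rewrite -EFinD ltry.
Qed.

Lemma geometric_small (c k t : R) : 0 <= c -> 0 < t ->
  exists N, forall n, (N <= n)%N -> c * (k / 2 ^+ n) ^+ 2 <= t.
Proof.
move=> c0 t0; exists (Num.bound (c * k ^+ 2 / t)) => n Nn.
have p1 : 1 <= 2 ^+ n :> R by rewrite exprn_ege1// ler1n.
have p0 : 0 < 2 ^+ n :> R := lt_le_trans ltr01 p1.
have ck : 0 <= c * k ^+ 2 := mulr_ge0 c0 (sqr_ge0 k).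
have : c * k ^+ 2 / t <= 2 ^+ n.
  apply: ltW; apply: (lt_le_trans (archi_boundP (divr_ge0 ck (ltW t0)))).
  by rewrite -natrX ler_nat (leq_trans Nn)// ltnW// ltn_expl.
rewrite ler_pdivrMr// => h.
rewrite exprMn exprVn mulrA ler_pdivrMr ?exprn_gt0//.
apply: le_trans h _; rewrite mulrC ler_pM2l//.
by rewrite expr2 ler_peMl// ltW.
Qed.

End Estimates.

Section Variational.
Variables (R : realType) (G : metric_graph R) (q : edge G -> R -> R).
Hypothesis q_adm : admissible_potential q.
Local Notation V := (edge G -> R -> R^o).
Local Notation schrod := (@schrod R G q).
Local Notation aform := (@aform R G q).
Local Notation nform := (@nform R G q).
Implicit Types (u v w y z f g h : V) (e : edge G).

Let len_ge0 e : 0 <= len e. Proof. exact/ltW/len_gt0. Qed.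

Let L : R := 1 + \sum_(e : edge G) len e.

Let L_ge1 : 1 <= L. Proof. by rewrite lerDl sumr_ge0. Qed.
Let L_gt0 : 0 < L. Proof. exact: lt_le_trans ltr01 L_ge1. Qed.

Let len_le e : len e <= L.
Proof. by rewrite /L (bigD1 e)//= addrCA lerDl addr_ge0// sumr_ge0. Qed.

Lemma ip_le_gip e u : ip (len e) (u e) (u e) <= gip u u.
Proof. by rewrite /gip (bigD1 e)//= lerDl sumr_ge0// => i _; exact: ip_ge0. Qed.

Lemma prim2_sup_le y e x : graph_L2 y -> 0 <= x <= len e ->
  prim2 y e x ^+ 2 <= L * ip (len e) (prim1 y e) (prim1 y e).
Proof.
move=> hy xl; apply: le_trans (ac_sup xl ((prim2_ac hy).1 e) (prim2_at0 _ _)) _.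
by rewrite ler_wpM2r ?ip_ge0.
Qed.

(** The Poincare inequality, with a constant that serves all edges at once. *)
Lemma gip_prim2_le_prim1 y : graph_L2 y ->
  gip (prim2 y) (prim2 y) <= L ^+ 2 * gip (prim1 y) (prim1 y).
Proof.
move=> hy; rewrite /gip mulr_sumr; apply: ler_sum => e _.
apply: le_trans (ip_le_sup (len_ge0 e) (prim2_L2 hy e) (fun x xl => prim2_sup_le hy xl)) _.
by rewrite expr2 -mulrA ler_wpM2r// mulr_ge0 ?ip_ge0// ltW.
Qed.

Lemma gip_prim2_le y : graph_L2 y -> gip (prim2 y) (prim2 y) <= L ^+ 4 * gip y y.
Proof.
move=> hy; have hJ := prim2_L2 hy; have h := gip_prim2_le_prim1 hy.
have cs := psd_form_cauchy_schwarz (@graph_L2_lin R G) (@gip_form R G) hJ hy.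
have j1 : gip (prim1 y) (prim1 y) <= L ^+ 2 * gip y y.
  apply: le_of_sq_le; [exact: gip_ge0 | exact: mulr_ge0 (sqr_ge0 _) (gip_ge0 _) |].
  move: cs; rewrite (gip_prim2_prim1 hy hy) sqrrN => cs; apply: le_trans cs _.
  by rewrite mulrAC ler_wpM2r ?gip_ge0.
apply: le_trans h _; rewrite (_ : 4 = 2 + 2)%N// exprD -mulrA.
by rewrite ler_wpM2l ?sqr_ge0.
Qed.

(** By Cauchy-Schwarz and the Poincare inequality, the square of the form is at most
    L^2 nform times the form itself. *)
Lemma aform_le_nform y : graph_L2 y -> aform y y <= L ^+ 2 * nform y y.
Proof.
move=> hy; have hJ := prim2_L2 hy; have hB := schrod_L2 q_adm hy.
have a1 := aform_ge q_adm hy.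
have a0 : 0 <= aform y y := le_trans (gip_ge0 _) a1.
apply: le_of_sq_le => //; first exact: mulr_ge0 (sqr_ge0 _) (gip_ge0 _).
apply: le_trans (psd_form_cauchy_schwarz (@graph_L2_lin R G) (@gip_form R G) hJ hB) _.
rewrite mulrAC; apply: ler_wpM2r; first exact: gip_ge0.
by apply: le_trans (gip_prim2_le_prim1 hy) _; rewrite ler_wpM2l ?sqr_ge0.
Qed.

Lemma gip_mul_potential_le : exists2 M : R, 0 <= M & forall u, graph_L2 u ->
  gip (fun e x => q e x * u e x) (fun e x => q e x * u e x) <= M * gip u u.
Proof.
have [M M0 qM] := potential_bounded q_adm; exists (M ^+ 2); first exact: sqr_ge0.
move=> u hu; rewrite /gip mulr_sumr; apply: ler_sum => e _.
exact: (ip_mul_bounded M0 (hu e) (potential_mul_L2 q_adm hu e) (qM e)).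
Qed.

(** nform is the square of a norm equivalent to that of w in L^2: potential terms are
    controlled by the Poincare inequality. This gives completeness for nform. *)
Lemma nform_equiv : exists2 K : R, 0 <= K & forall y, graph_L2 y ->
  gip y y <= K * nform y y /\ nform y y <= K * gip y y.
Proof.
have [M M0 qM] := gip_mul_potential_le.
exists (2 + 2 * M * L ^+ 4); first by rewrite addr_ge0// mulr_ge0 ?exprn_ge0 ?(ltW L_gt0)// mulr_ge0.
move=> y hy; have hJ := prim2_L2 hy; have hB := schrod_L2 q_adm hy.
have hq := potential_mul_L2 q_adm hJ; have qJ := qM _ hJ.
set qj := (fun e x => q e x * prim2 y e x) in hq qJ.
have y_eq : y = qj - schrod y.
  apply/funext => e; apply/funext => x.
  rewrite -[RHS]/(q e x * prim2 y e x - (- y e x + q e x * prim2 y e x)).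
  by rewrite opprD opprK addrCA subrr addr0.
have b_eq : schrod y = qj - y.
  by apply/funext => e; apply/funext => x; exact: addrC.
have sub := psd_form_sub (@graph_L2_lin R G) (@gip_form R G).
have n0 : 0 <= nform y y by exact: gip_ge0.
split.
  have := sub _ _ hq hB; rewrite -y_eq.
  have JN : gip (prim2 y) (prim2 y) <= L ^+ 4 * nform y y.
    apply: le_trans (gip_prim2_le_prim1 hy) _; rewrite (_ : 4 = 2 + 2)%N// exprD -mulrA.
    rewrite ler_wpM2l ?sqr_ge0//.
    exact: le_trans (aform_ge q_adm hy) (aform_le_nform hy).
  have := ler_wpM2l M0 JN; rewrite -[gip (schrod y) (schrod y)]/(nform y y).
  by move: qJ; rewrite mulrA mulrDl -!mulrA; lra.
have := sub _ _ hq hy; rewrite -b_eq -[gip (schrod y) (schrod y)]/(nform y y).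
have := ler_wpM2l M0 (gip_prim2_le hy).
by move: qJ; rewrite mulrA mulrDl -!mulrA; lra.
Qed.

Lemma prim2_sub y z e x : graph_L2 y -> graph_L2 z -> 0 <= x <= len e ->
  prim2 (y - z) e x = prim2 y e x - prim2 z e x.
Proof.
move=> hy hz xl; have -> : y - z = (-1) *: z + y by rewrite scaleN1r addrC.
by rewrite prim2_lin// -[LHS]/(-1 * prim2 z e x + prim2 y e x) mulN1r addrC.
Qed.

(** Functions with nform at most 1 are uniformly bounded and uniformly Hoelder
    continuous, so up to a small error they are determined by their rounded
    values on a fine grid. *)
Lemma prim2_compact (delta : R) : 0 < delta -> exists (T : finType) (col : V -> T),
  forall y z, graph_L2 y -> graph_L2 z -> nform y y <= 1 -> nform z z <= 1 ->
    col y = col z -> forall e x, 0 <= x <= len e ->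
      prim2 (y - z) e x ^+ 2 <= 9 * delta ^+ 2.
Proof.
move=> delta0.
(* bd bounds |f|; on a grid of step len e / n the Hoelder bound is at most delta. *)
pose bd : R := L * L ^+ 2 + 1.
pose n := (Num.bound (L * L ^+ 2 / delta ^+ 2)).+1.
have n0 : 0 < n%:R :> R by [].
have hn : L * L ^+ 2 / n%:R <= delta ^+ 2.
  rewrite ler_pdivrMr// [delta ^+ 2 * _]mulrC -ler_pdivrMr ?exprn_gt0//.
  apply: ltW; apply: (lt_le_trans (archi_boundP _)); last by rewrite ler_nat.
  exact: divr_ge0 (mulr_ge0 (ltW L_gt0) (sqr_ge0 _)) (sqr_ge0 _).
pose node e (i : 'I_n.+1) : R := len e * i%:R / n%:R.
pose K := Num.truncn (2 * bd / delta).
pose code y (e : edge G) (i : 'I_n.+1) := Num.truncn ((prim2 y e (node e i) + bd) / delta).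
exists {ffun edge G * 'I_n.+1 -> 'I_K.+1}.
exists (fun y => [ffun p => inord (code y p.1 p.2)]).
have node_in e i : 0 <= node e i <= len e.
  rewrite /node divr_ge0 ?mulr_ge0//= ler_pdivrMr// ler_wpM2l// ler_nat.
  by rewrite -ltnS.
have prim1_le y : graph_L2 y -> nform y y <= 1 -> gip (prim1 y) (prim1 y) <= L ^+ 2.
  move=> hy y1; apply: le_trans (aform_ge q_adm hy) (le_trans (aform_le_nform hy) _).
  by rewrite ler_piMr ?sqr_ge0.
have prim2_bd y e x : graph_L2 y -> nform y y <= 1 -> 0 <= x <= len e -> `|prim2 y e x| <= bd.
  move=> hy y1 xl; apply: sqr_le_norm; apply: le_trans (prim2_sup_le hy xl) _.
  apply: ler_wpM2l; first exact: ltW.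
  exact: le_trans (ip_le_gip _ _) (prim1_le _ hy y1).
have code_lt y e i : graph_L2 y -> nform y y <= 1 -> (code y e i < K.+1)%N.
  move=> hy y1; rewrite ltnS; apply: le_truncn.
  rewrite ler_pM2r ?invr_gt0// mulr_natl mulr2n lerD2r.
  by apply: le_trans (ler_norm _) _; exact: prim2_bd.
have near_node e x : 0 <= x <= len e -> exists i, forall z, graph_L2 z -> nform z z <= 1 ->
    `|prim2 z e x - prim2 z e (node e i)| <= delta.
  move=> /andP[x0 xl]; have l0 := len_gt0 e.
  pose t := x * n%:R / len e.
  have t0 : 0 <= t by rewrite divr_ge0 ?mulr_ge0.
  have /andP[k1 k2] := truncn_itv t0.
  have kn : (Num.truncn t < n.+1)%N.
    rewrite ltnS -(ler_nat R); apply: le_trans k1 _.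
    by rewrite ler_pdivrMr// [n%:R * _]mulrC ler_wpM2r.
  exists (Ordinal kn) => z hz z1; set nd := node _ _.
  have nd_x : nd <= x.
    rewrite /nd /node /= ler_pdivrMr// [len e * _]mulrC -ler_pdivlMr//.
  have x_nd : x - nd <= L / n%:R.
    rewrite lerBlDr /nd /node/= -mulrDl ler_pdivlMr//.
    have : x * n%:R <= len e + len e * (Num.truncn t)%:R.
      rewrite -[X in X + _]mulr1 -mulrDr mulrC.
      have := ltW k2; rewrite /t ler_pdivrMr// -natr1.
      by rewrite [_ * len e]mulrC [n%:R * x]mulrC [1 + _]addrC.
    by move=> h; apply: le_trans h _; rewrite lerD2r.
  have /andP[nd0 _] := node_in e (Ordinal kn).
  have := ac_holder ((prim2_ac hz).1 e) nd0 nd_x xl.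
  have j_le := le_trans (ip_le_gip e (prim1 z)) (prim1_le _ hz z1).
  move=> h; apply: norm_le_of_sq; first exact: ltW.
  apply: le_trans h (le_trans _ hn); rewrite mulrAC.
  by apply: ler_pM => //; [rewrite subr_ge0 | exact: ip_ge0].
have same_code y z e i : graph_L2 y -> graph_L2 z -> nform y y <= 1 -> nform z z <= 1 ->
    code y e i = code z e i -> `|prim2 y e (node e i) - prim2 z e (node e i)| <= delta.
  move=> hy hz y1 z1; apply: truncn_eq_close => //.
  - exact: prim2_bd hy y1 (node_in e i).
  - exact: prim2_bd hz z1 (node_in e i).
move=> y z hy hz y1 z1 cyz.
have cE e i : code y e i = code z e i.
  apply: (ffun_inord_inj (c := fun p => code y p.1 p.2) (c' := fun p => code z p.1 p.2)
    _ _ cyz (e, i)) => p; exact: code_lt.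
move=> e x xl; have [i hi] := near_node e x xl; rewrite (prim2_sub hy hz xl).
exact: sqr_sub_le (hi y hy y1) (hi z hz z1) (same_code y z e i hy hz y1 z1 (cE e i)).
Qed.

(** <f, S f> is at most |f| |S f|; the first factor is made small by
    [prim2_compact], the second stays bounded. *)
Lemma aform_compact (eps : R) : 0 < eps -> exists (T : finType) (col : V -> T),
  forall y z, graph_L2 y -> graph_L2 z -> nform y y <= 1 -> nform z z <= 1 ->
    col y = col z -> aform (y - z) (y - z) <= eps.
Proof.
(* With |f|^2 <= 9 L delta^2 and |S f|^2 <= 4, the product is at most eps^2. *)
move=> eps0; pose delta := eps / (6 * L).
have delta0 : 0 < delta by rewrite divr_gt0// mulr_gt0.
have [T [col hcol]] := prim2_compact delta0; exists T, col => y z hy hz y1 z1 cyz.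
have jyz := hcol y z hy hz y1 z1 cyz; clear hcol cyz.
have hyz := graph_L2B hy hz.
have nyz : nform (y - z) (y - z) <= 4.
  have := psd_form_sub (@graph_L2_lin R G) (nform_psd q_adm) hy hz.
  by move/le_trans; apply; exact: double_sum_le4.
have prim2_small : gip (prim2 (y - z)) (prim2 (y - z)) <= L * (9 * delta ^+ 2).
  apply: (@le_trans _ _ (\sum_(e : edge G) len e * (9 * delta ^+ 2))).
    by apply: ler_sum => e _; apply: ip_le_sup; [| exact: prim2_L2 | exact: jyz].
  rewrite -mulr_suml; apply: ler_wpM2r; first exact: mulr_ge0 (ler0n _ _) (sqr_ge0 _).
  by rewrite /L lerDr.
have a0 : 0 <= aform (y - z) (y - z) by have [_ _] := aform_psd q_adm; apply.
have cs := psd_form_cauchy_schwarz (@graph_L2_lin R G) (@gip_form R G) (prim2_L2 hyz) (schrod_L2 q_adm hyz).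
apply: le_trans (ler_norm _) (norm_le_of_sq (ltW eps0) _); apply: le_trans cs _.
apply: (@le_trans _ _ (L * (9 * delta ^+ 2) * 4)).
  by apply: ler_pM => //; exact: gip_ge0.
have -> : L * (9 * delta ^+ 2) * 4 = eps ^+ 2 / L by rewrite /delta; field; rewrite gt_eqF.
by rewrite ler_pdivrMr// ler_peMr ?sqr_ge0.
Qed.

End Variational.

(** * New eigenfunctions from constrained maxima *)

Section Extremals.
Variables (R : realType) (G : metric_graph R) (q : edge G -> R -> R).
Hypothesis q_adm : admissible_potential q.
Local Notation V := (edge G -> R -> R^o).
Local Notation schrod := (@schrod R G q).
Local Notation aform := (@aform R G q).
Local Notation nform := (@nform R G q).
Implicit Types (u v w y z f g h : V) (e : edge G).

Lemma graph_addE u v e x : (u + v) e x = u e x + v e x.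
Proof. by []. Qed.

Lemma graph_L2_complete (k : R) (u : nat -> V) : 0 <= k ->
  (forall n, graph_L2 (u n)) ->
  (forall n, gip (u n.+1 - u n) (u n.+1 - u n) <= (k / 2 ^+ n) ^+ 2) ->
  exists2 w, graph_L2 w & forall n,
    gip (w - u n) (w - u n) <= #|edge G|%:R * (k *+ 2 / 2 ^+ n) ^+ 2.
Proof.
move=> k0 hu hd.
have lim e : exists w : R -> R, L2 (len e) w /\ forall n,
    ip (len e) (fun x => w x - u n e x) (fun x => w x - u n e x) <= (k *+ 2 / 2 ^+ n) ^+ 2.
  have hd' n := le_trans (ip_le_gip e (u n.+1 - u n)) (hd n).
  have [w hw wu] := L2_complete k0 (fun n => hu n e) hd'.
  by exists w.
have /choice[w hw] := lim; exists w => [e|n]; first exact: (hw e).1.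
rewrite /gip -[#|_|%:R]/(#|edge G|%:R) mulr_natl -sumr_const.
by apply: ler_sum => e _; exact: (hw e).2.
Qed.

Definition constrained (m : nat) (g : 'I_m -> V) w :=
  dom_S2 w /\ forall k, gip (prim2 w) (g k) = 0.

Lemma dom_S2_lin (c : R) u v : dom_S2 u -> dom_S2 v -> dom_S2 (c *: u + v).
Proof.
move=> [hu ul] [hv vl]; split; first exact: graph_L2_lin.
by move=> d; rewrite gip_linl ?ul ?vl ?mulr0 ?addr0//; exact: edge_linear_L2.
Qed.

Lemma gip_prim2_lin (c : R) u v z : graph_L2 u -> graph_L2 v -> graph_L2 z ->
  gip (prim2 (c *: u + v)) z = c * gip (prim2 u) z + gip (prim2 v) z.
Proof.
move=> hu hv hz; rewrite -(gip_linl c (prim2_L2 hu) (prim2_L2 hv) hz).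
by apply: gip_ext => // e x; exact: prim2_lin.
Qed.

Lemma gip_limit (w z : V) (u : nat -> V) : graph_L2 w -> graph_L2 z ->
  (forall n, graph_L2 (u n)) -> (forall n, gip (u n) z = 0) ->
  (forall t : R, 0 < t -> exists n, gip (w - u n) (w - u n) <= t) -> gip w z = 0.
Proof.
move=> hw hz hu uz wu; apply/eqP; rewrite -sqrf_eq0 eq_le sqr_ge0 andbT.
apply/ler_addgt0Pr => t t0; rewrite add0r.
have z1 : 0 < gip z z + 1 by rewrite ltr_wpDl ?gip_ge0.
have [n hn] := wu _ (divr_gt0 t0 z1).
have hd := graph_L2B hw (hu n).
have -> : gip w z = gip (w - u n) z.
  have -> : w - u n = (-1) *: u n + w by rewrite scaleN1r addrC.
  by rewrite gip_linl// uz mulr0 add0r.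
apply: le_trans (psd_form_cauchy_schwarz (@graph_L2_lin R G) (@gip_form R G) hd hz) _.
apply: (@le_trans _ _ (t / (gip z z + 1) * gip z z)).
  by apply: ler_wpM2r => //; exact: gip_ge0.
rewrite mulrAC ler_pdivrMr// ler_wpM2l ?(ltW t0)//.
by rewrite lerDl.
Qed.

(** The constraints are closed for the norm of L^2, hence [rayleigh_max_attained]
    applies to the constrained functions. *)
Lemma constrained_max (m : nat) (g : 'I_m -> V) p : (forall k, graph_L2 (g k)) ->
  constrained g p -> 0 < aform p p ->
  exists f M, [/\ constrained g f, 0 < nform f f, aform p p <= M * nform p p &
    forall y, constrained g y -> aform f y = M * nform f y].
Proof.
move=> hg hp ap.
have conL w : constrained g w -> graph_L2 w by case => -[].
have con_lin (c : R) x y : constrained g x -> constrained g y -> constrained g (c *: x + y).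
  move=> [hx xg] [hy yg]; split; first exact: dom_S2_lin.
  move=> k; apply: etrans (gip_prim2_lin c hx.1 hy.1 (hg k)) _.
  by apply: etrans (congr2 (fun s t => c * s + t) (xg k) (yg k)) _; rewrite mulr0 addr0.
have restrict Q : psd_form (@graph_L2 R G) Q -> psd_form (constrained g) Q.
  move=> [Ql Qs Q0]; split.
  - by move=> c x y z hx hy hz; apply: Ql; exact: conL.
  - by move=> x y hx hy; apply: Qs; exact: conL.
  - by move=> x hx; apply: Q0; exact: conL.
have [K K0 hK] := nform_equiv q_adm.
have [C hC] : exists C : R, forall x, constrained g x -> aform x x <= C * nform x x.
  by eexists => x /conL hx; exact: aform_le_nform.
apply: (rayleigh_max_attained con_lin (restrict _ (nform_psd q_adm))
  (restrict _ (aform_psd q_adm)) hC) hp ap.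
  move=> t t0; have [T [col hcol]] := aform_compact q_adm t0; exists T, col.
  by move=> x y hx hy; apply: hcol; exact: conL.
move=> u hu du; pose k := Num.sqrt K.
have hd n : gip (u n.+1 - u n) (u n.+1 - u n) <= (k / 2 ^+ n) ^+ 2.
  have hun := graph_L2B (conL _ (hu n.+1)) (conL _ (hu n)).
  apply: le_trans (hK _ hun).1 _; rewrite exprMn sqr_sqrtr//.
  by apply: ler_wpM2l => //; exact: du.
have [w hw wu] := graph_L2_complete (sqrtr_ge0 K) (fun n => conL _ (hu n)) hd.
have small (t : R) : 0 < t -> exists N, forall n, (N <= n)%N ->
    #|edge G|%:R * (k *+ 2 / 2 ^+ n) ^+ 2 <= t.
  by move=> t0; exact: geometric_small (ler0n _ _) t0.
have wu0 t : 0 < t -> exists n, gip (w - u n) (w - u n) <= t.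
  by move=> /small[N hN]; exists N; apply: le_trans (wu N) (hN _ (leqnn _)).
exists w.
  split; first split => //.
    move=> c; apply: gip_limit wu0 => //; first exact: edge_linear_L2.
    - by move=> n; exact: conL (hu n).
    - by move=> n; have [[_ ->]] := hu n.
  move=> i; rewrite gip_prim2C//; apply/etrans/(gip_limit hw (prim2_L2 (hg i)) _ _ wu0).
  - exact: gipC.
  - by move=> n; exact: conL (hu n).
  - by move=> n; rewrite gipC gip_prim2C//; [have [_ ->] := hu n | exact: conL (hu n)].
move=> t t0; have K1 : 0 < K + 1 by rewrite ltr_wpDl.
have [N hN] := small _ (divr_gt0 t0 K1); exists N => n /hN hn.
have hwu := graph_L2B hw (conL _ (hu n)).
apply: le_trans (hK _ hwu).2 (le_trans (ler_wpM2l K0 (le_trans (wu n) hn)) _).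
rewrite mulrCA ler_piMr ?(ltW t0)// ler_pdivrMr// mul1r lerDl//.
Qed.

(** [schrod] is the operator - 1 + q prim2, and both prim2 and multiplication by q
    are symmetric. *)
Lemma gip_schrod_adj z y : graph_L2 z -> graph_L2 y ->
  gip z (schrod y) = gip ((-1) *: z + prim2 (fun e x => q e x * z e x)) y.
Proof.
move=> hz hy; have hqz := potential_mul_L2 q_adm hz.
have qzy : gip z (fun e x => q e x * prim2 y e x) = gip (prim2 (fun e x => q e x * z e x)) y.
  apply: etrans (esym (gip_mulC q z (prim2 y))) _.
  exact: etrans (gipC _ _) (gip_prim2C hy hqz).
rewrite schrodE gip_linr//; last first.
  by apply: (potential_mul_L2 q_adm); exact: prim2_L2.
rewrite gip_linl//; last exact: prim2_L2.
exact: (congr2 +%R (erefl _) qzy).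
Qed.

Lemma dom_S2_sum (I : Type) (r : seq I) (P : pred I) (c : I -> R) (F : I -> V) :
  (forall i, dom_S2 (F i)) -> dom_S2 (\sum_(i <- r | P i) c i *: F i).
Proof.
move=> hF; elim/big_rec: _ => [|i x _ hx]; last exact: dom_S2_lin.
by split; [exact: graph_L2_0 | move=> c0; exact: gip0l].
Qed.

Lemma krein_eig_schrod kappa f h h1 h2 : dom_S2 f -> ker_S q h h1 h2 ->
  graph_ae_eq (kappa *: (prim2 f + h)) (schrod f) -> krein_eig q kappa f (prim2 f + h).
Proof. by move=> hf hk hae; split=> //; exists h, h1, h2. Qed.

(** If z = prim2 (q z) - (edgewise linear) almost everywhere, the right-hand side is
    a representative of z that is continuous at the vertices and solves z'' = q z. *)
Lemma ker_S_of_bipolar z c : graph_L2 z ->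
  graph_ae_eq ((-1) *: z + prim2 (fun e x => q e x * z e x)) (edge_linear c) ->
  exists h h1 h2, ker_S q h h1 h2 /\ graph_ae_eq h z.
Proof.
move=> hz zc; have hqz := potential_mul_L2 q_adm hz.
have [hj hj1] := prim2_ac hqz; set qz := (fun e x => q e x * z e x) in zc hqz hj hj1 *.
pose slope : V := fun e _ => (c (tgt e) - c (src e)) / len e.
exists ((-1) *: edge_linear c + prim2 qz), ((-1) *: slope + prim1 qz), qz.
have hz_eq : graph_ae_eq ((-1) *: edge_linear c + prim2 qz) z.
  move=> e; apply: lebesgue_ae1 (zc e) => x h /h.
  rewrite !graph_addE !graph_scaleE => <-.
  by rewrite mulrDr mulN1r mulN1r opprK mulN1r subrK.
split => //; split.
- by move=> e; apply: ac_lin (hj e); exact: edge_linear_ac.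
- have slope_ac : graph_ac slope (fun _ _ => 0).
    move=> e; have := ac_affine (len e) ((c (tgt e) - c (src e)) / len e) 0.
    by apply: ac_ext => [|x _]; [exact/ltW/len_gt0 | rewrite mul0r addr0].
  move=> e; have [L2s hs] := ac_lin (-1) (slope_ac e) (hj1 e); split.
    by apply: L2_ext L2s => x _; rewrite mulr0 add0r.
  move=> x xl; rewrite -[LHS]/(-1 * slope e x + prim1 qz e x) hs//.
  by congr (_ + _); apply: primitive_ext => t _; rewrite mulr0 add0r.
- exists (fun v : vert G => - c v) => p.
  rewrite -(edge_linear_trace c p) /rtrace.
  by case: ifP => _; rewrite graph_addE graph_scaleE ?prim2_at_end ?prim2_at0 addr0 mulN1r.
- move=> e; apply: lebesgue_ae1 (hz_eq e) => x h /h ->.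
  by [].
Qed.

Lemma ker_S_opp h h1 h2 : ker_S q h h1 h2 ->
  ker_S q ((-1) *: h) ((-1) *: h1) ((-1) *: h2).
Proof.
have ac0 e : ac (len e) (fun=> 0) (fun=> 0 : R).
  have := ac_affine (len e) 0 0; apply: ac_ext => [|x _]; first exact/ltW/len_gt0.
  by rewrite mul0r addr0.
have acN u du : graph_ac u du -> graph_ac ((-1) *: u) ((-1) *: du).
  move=> hu e; have [L2d hd] := ac_lin (-1) (hu e) (ac0 e); split.
    by apply: L2_ext L2d => x _; rewrite addr0.
  move=> x xl; have := hd x xl; rewrite !addr0 !graph_scaleE => ->; congr (_ + _).
  by apply: primitive_ext => t _; rewrite addr0.
move=> [hh1 h12 [c hc] hE]; split; [exact: acN | exact: acN | |].
  exists (fun v : vert G => - c v) => p; rewrite -hc /rtrace.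
  by case: ifP => _; rewrite graph_scaleE mulN1r.
move=> e; apply: lebesgue_ae1 (hE e) => x hx /hx.
by rewrite !graph_scaleE => ->; rewrite mulrCA.
Qed.

(** A maximiser f of aform / nform on the orthogonal complement of eigenfunctions
    yields a further eigenfunction. The critical point equation says that
    z = f - M S f is orthogonal to S y for all y that satisfy the constraints. Any
    y in the domain of S can be brought to satisfy them by adding a combination of
    the components of the g k in the domain of S, and z is orthogonal to the images
    of these under S, the functions kap k g k, as well. So z is in the kernel of
    the adjoint, and f - z = M S f is an eigenfunction with eigenvalue 1 / M. *)
Lemma extremal_eigenfunction (m : nat) (kap : 'I_m -> R) (W g : 'I_m -> V) p mu0 :
  (forall k, 0 < kap k) -> (forall k, krein_eig q (kap k) (W k) (g k)) ->
  (forall k j, k != j -> gip (g k) (g j) = 0) -> (forall k, 0 < gip (g k) (g k)) ->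
  constrained g p -> 0 < aform p p -> nform p p <= mu0 * aform p p ->
  exists kappa w g', [/\ 0 < kappa <= mu0, krein_eig q kappa w g', 0 < gip g' g' &
    forall k, gip g' (g k) = 0].
Proof.
move=> kap0 hW g_orth g_pos hp ap np.
have hg k : graph_L2 (g k) := krein_eig_L2 (hW k).
have [f [M [hf nf aM crit]]] := constrained_max hg hp ap.
have hYf := hf.1; have hfL := hYf.1; have hWY k : dom_S2 (W k) := (hW k).1.
have np0 : 0 < nform p p.
  rewrite lt_neqAle gip_ge0 andbT; apply/eqP => h.
  by move: aM; rewrite -h mulr0 leNgt ap.
have M0 : 0 < M by rewrite -(pmulr_lgt0 _ np0) (lt_le_trans ap).
have Mmu : M^-1 <= mu0.
  have mu0_gt0 : 0 < mu0 by rewrite -(pmulr_lgt0 _ ap) (lt_le_trans np0).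
  rewrite -(ler_pM2l M0) mulfV ?gt_eqF// -(ler_pM2r np0) mul1r.
  by apply: le_trans np _; rewrite [M * mu0]mulrC -mulrA ler_pM2l.
have bf_g k : gip (schrod f) (g k) = 0.
  rewrite (gip_schrod_eig q_adm (hW k) hYf) gipC -[LHS]/(aform (W k) f).
  rewrite (aformC q_adm (hWY k).1 hfL) /aform (gip_eig q_adm (hW k) (prim2_L2 hfL)).
  by rewrite hf.2 mulr0.
have jW_g k j : gip (prim2 (W k)) (g j) = gip (g k) (g j).
  apply: (mulfI (lt0r_neq0 (kap0 j))).
  rewrite -(gip_eig q_adm (hW j) (prim2_L2 (hWY k).1)) gipC.
  rewrite -(gip_schrod_eig q_adm (hW k) (hWY j)) gipC.
  by rewrite (gip_eig q_adm (hW j) (hg k)).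
pose z : V := (- M) *: schrod f + prim2 f.
have hBf := schrod_L2 q_adm hfL; have hJf := prim2_L2 hfL.
have hz : graph_L2 z by exact: graph_L2_lin.
pose zt := (-1) *: z + prim2 (fun e x => q e x * z e x).
have hzt : graph_L2 zt.
  exact: graph_L2_lin hz (prim2_L2 (potential_mul_L2 q_adm hz)).
have ztE y : graph_L2 y -> gip zt y = aform f y - M * nform f y.
  move=> hy; rewrite -(gip_schrod_adj hz hy) (gip_linl _ hBf hJf (schrod_L2 q_adm hy)).
  by rewrite mulNr addrC.
have zt_con y : constrained g y -> gip zt y = 0.
  by move=> hy; rewrite (ztE _ hy.1.1) crit// subrr.
have zt_W k : gip zt (W k) = 0.
  rewrite -(gip_schrod_adj hz (hWY k).1) (gip_eig q_adm (hW k) hz).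
  by rewrite (gip_linl _ hBf hJf (hg k)) bf_g hf.2 mulr0 addr0 mulr0.
have zt_dom_S2 y : graph_L2 y -> (forall c, gip y (edge_linear c) = 0) -> gip zt y = 0.
  move=> hy ylin; have hyy : dom_S2 y by [].
  (* Adding s to y makes it orthogonal to all g k, by jW_g. *)
  pose c k := - (gip (prim2 y) (g k) / gip (g k) (g k)).
  pose s := \sum_k c k *: W k.
  have hs : dom_S2 s by exact: dom_S2_sum.
  have := zt_con (1 *: s + y); rewrite (gip_linr _ hs.1 hy hzt).
  rewrite (gip_sumr _ _ _ hzt (fun k => (hWY k).1)).
  rewrite big1 => [|k _]; last by rewrite zt_W mulr0.
  rewrite mulr0 add0r; apply; split; first exact: dom_S2_lin.
  move=> k; have sE : gip (prim2 s) (g k) = c k * gip (g k) (g k).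
    apply: etrans (gip_prim2C hs.1 (hg k)) _.
    apply: etrans (gip_sumr _ _ _ (prim2_L2 (hg k)) (fun k => (hWY k).1)) _.
    rewrite (bigD1 k)//= big1 ?addr0 => [|j jk].
      exact: (congr1 (fun t => c k * t) (etrans (gip_prim2C (hg k) (hWY k).1) (jW_g k k))).
    apply: etrans (congr1 (fun t => c j * t) (etrans (gip_prim2C (hg k) (hWY j).1) (jW_g j k))) _.
    by rewrite g_orth// mulr0.
  apply: etrans (gip_prim2_lin _ hs.1 hy (hg k)) _.
  rewrite mul1r -[RHS](addNr (gip (prim2 y) (g k))); apply: (congr2 +%R _ (erefl _)).
  by apply: etrans sE _; rewrite /c mulNr divfK ?gt_eqF.
have [c zc] := edge_linear_bipolar hzt zt_dom_S2.
have [h [h1 [h2 [hk hz_eq]]]] := ker_S_of_bipolar hz zc.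
have hk' := ker_S_opp hk.
have eig : krein_eig q M^-1 f (prim2 f + (-1) *: h).
  apply: krein_eig_schrod hYf hk' _ => e; apply: lebesgue_ae1 (hz_eq e) => x hx /hx.
  rewrite graph_scaleE graph_addE graph_scaleE => ->.
  rewrite /z graph_addE graph_scaleE mulN1r opprD mulNr opprK addrCA subrr addr0.
  by rewrite mulrA mulVf ?mul1r// gt_eqF.
have hg' := krein_eig_L2 eig.
exists M^-1, f, (prim2 f + (-1) *: h); split => //; first by rewrite invr_gt0 M0.
  have := nf; rewrite /nform (gip_eig q_adm eig hBf) gipC (gip_eig q_adm eig hg').
  by rewrite mulrA pmulr_rgt0// mulr_gt0 ?invr_gt0.
move=> k; have := bf_g k; rewrite gipC (gip_eig q_adm eig (hg k)) => /eqP.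
by rewrite mulf_eq0 invr_eq0 (gt_eqF M0)/= gipC => /eqP.
Qed.

End Extremals.

(** * Transplantation to the lengthened graph *)

Section IntervalScaling.
Variables (R : realType) (a : R).
Hypothesis a_gt0 : 0 < a.
Implicit Types (l x : R) (w : R -> R).

Lemma L2Z l (c : R) w : L2 l w -> L2 l (fun x => c * w x).
Proof.
move=> hw; apply: (@L2_ext _ _ (fun x => c * w x + 0)) => [x _|]; first by rewrite addr0.
exact: L2_lin hw (L2_cst l 0).
Qed.

Lemma ipZl l (c : R) u w : L2 l u -> L2 l w -> ip l (fun x => c * u x) w = c * ip l u w.
Proof.
move=> hu hw; have h0 := L2_cst l (0 : R).
rewrite -[RHS]addr0 -(ip0l l w) -(ip_linl c hu h0 hw).
by apply: ip_ext => // x _; rewrite addr0.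
Qed.

Lemma acZ l (c : R) u du : 0 <= l -> ac l u du ->
  ac l (fun x => c * u x) (fun x => c * du x).
Proof.
move=> l0 [hdu hu]; split; first exact: L2Z.
move=> x xl; have /andP[_ xl'] := xl.
rewrite hu// mulrDr; congr (_ + _).
have := primitive_lin c xl' hdu (L2_cst l 0); rewrite primitive_cst; last by case/andP: xl.
rewrite mul0r addr0 => <-; by apply: primitive_ext => t _; rewrite addr0.
Qed.

Lemma dirichlet_scale l w x : 0 < l -> L2 l w -> 0 <= x <= a * l ->
  dirichlet (a * l) (fun t => a^-1 * w (t / a)) x = a * dirichlet l w (x / a).
Proof.
move=> l0 hw xl; have [h1 h2] := dirichlet_ac (ltW l0) hw.
have al0 : 0 < a * l by rewrite mulr_gt0.
have k1 := ac_scale a_gt0 h1.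
have k2 : ac (a * l) (fun x => dirichlet_deriv l w (x / a)) (fun t => a^-1 * w (t / a)).
  have := ac_scale a_gt0 (acZ a^-1 (ltW l0) h2).
  apply: ac_ext; first exact: ltW.
  by move=> t _; rewrite mulrA mulfV ?mul1r// gt_eqF.
have k0 : a * dirichlet l w (0 / a) = 0 by rewrite mul0r dirichlet_at0 mulr0.
have kl : a * dirichlet l w (a * l / a) = 0.
  by rewrite [a * l]mulrC mulfK ?gt_eqF// dirichlet_at_end// mulr0.
by have [] := dirichlet_unique al0 k1 k2 k0 kl xl.
Qed.

End IntervalScaling.

Section Transplant.
Variables (R : realType) (G : metric_graph R) (q : edge G -> R -> R).
Hypothesis q_adm : admissible_potential q.
Variables (e0 : edge G) (a : R).
Hypothesis a_gt1 : 1 < a.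
Local Notation V := (edge G -> R -> R^o).
Local Notation G' := (lengthen e0 a_gt1).
Local Notation V' := (edge G' -> R -> R^o).
Local Notation q' := (lengthen_potential e0 a_gt1 q).
Implicit Types (w u v : V) (e : edge G).

Let a_gt0 : 0 < a. Proof. exact: lt_trans a_gt1. Qed.
Let a_neq0 : a != 0. Proof. exact: lt0r_neq0. Qed.

Lemma len_lengthen (e : edge G') : len e = if e == e0 then a * @len R G e else @len R G e.
Proof. by []. Qed.

Lemma lengthen_admissible : admissible_potential q'.
Proof.
have [mq [M hM] q0] := q_adm; split.
- move=> e; rewrite len_lengthen /lengthen_potential.
  have [->|_] := eqVneq e e0; last exact: mq.
  apply: measurable_funM => //.
  apply: (measurable_comp (F := `]0, @len R G e0[%classic)) => //.
  + move=> _ [x /= + <-]; rewrite !in_itv/= => /andP[x0 xl].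
    by rewrite divr_gt0//= ltr_pdivrMr// [_ * a]mulrC.
  + exact: measurable_funM.
- exists `|M| => e x; rewrite len_lengthen /lengthen_potential.
  case: eqP => [->|_] /andP[x0 xl]; last first.
    by apply: le_trans (hM e x _) (ler_norm M); rewrite x0.
  have qM : `|q e0 (x / a)| <= `|M|.
    apply: le_trans (hM e0 (x / a) _) (ler_norm M).
    by rewrite divr_gt0//= ltr_pdivrMr// [_ * a]mulrC.
  have a2 : 0 <= a ^- 2 by rewrite invr_ge0 sqr_ge0.
  rewrite normrM (ger0_norm a2).
  apply: le_trans qM; rewrite ler_piMl//.
  by rewrite invf_le1 ?exprn_gt0// exprn_ege1// ltW.
- move=> e; rewrite len_lengthen /lengthen_potential.
  have [->|_] := eqVneq e e0; last exact: q0.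
  apply: lebesgue_ae1 (ae_scale a_gt0 (q0 e0)) => x h /andP[x0 xl].
  apply: mulr_ge0; first by rewrite invr_ge0 sqr_ge0.
  apply: h.
  by rewrite divr_gt0//= ltr_pdivrMr// [_ * a]mulrC.
Qed.

(** On the lengthened edge the test function f becomes a f(x/a): the derivatives
    at the endpoints, hence the vertex conditions, are unchanged. Functions are
    represented by their second derivatives, hence the factor a^-1. *)
Definition transplant w : V' := fun e x => if e == e0 then a^-1 * w e (x / a) else w e x.

Lemma transplant_lin (c : R) u v :
  transplant (c *: u + v) = c *: transplant u + transplant v.
Proof.
apply/funext => e; apply/funext => x.
rewrite graph_addE graph_scaleE /transplant graph_addE graph_scaleE.
by case: ifP => _ //; rewrite mulrDr mulrCA.
Qed.

Lemma transplant_L2 w : graph_L2 w -> graph_L2 (transplant w).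
Proof.
move=> hw e; rewrite /transplant len_lengthen; case: ifP => _; last exact: hw.
by apply: L2Z; exact: L2_scale.
Qed.

Lemma prim2_transplant w (e : edge G') x : graph_L2 w -> 0 <= x <= len e ->
  prim2 (transplant w) e x = if e == e0 then a * prim2 w e (x / a) else prim2 w e x.
Proof.
rewrite /prim2 /transplant len_lengthen => hw.
by case: ifP => // _ xl; apply: dirichlet_scale => //; exact: len_gt0.
Qed.

Lemma schrod_transplant w (e : edge G') x : graph_L2 w -> 0 <= x <= len e ->
  schrod q' (transplant w) e x =
  if e == e0 then a^-1 * schrod q w e (x / a) else schrod q w e x.
Proof.
move=> hw xl; rewrite /schrod prim2_transplant// /transplant /lengthen_potential.
have alg (j y r : R) : - (a^-1 * y) + a ^- 2 * r * (a * j) = a^-1 * (- y + r * j).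
  by field.
by case: ifP => // _; exact: alg.
Qed.

(** An edgewise linear function on the long graph is, after rescaling, edgewise
    linear on the short one with the same vertex values; the factor a of the
    substitution cancels a^-1. *)
Lemma transplant_dom_S2 w : dom_S2 w -> dom_S2 (transplant w).
Proof.
move=> [hw wl]; split=> [|c]; first exact: transplant_L2.
rewrite -(wl c); apply: eq_bigr => e _.
rewrite /transplant /edge_linear len_lengthen; case: eqP => // ->.
have hlin := edge_linear_L2 (G := G) c e0.
rewrite ipZl; last 2 first.
- exact: L2_scale.
- by apply: ac_L2 (ac_affine _ _ _); rewrite mulr_ge0 ?ltW// len_gt0.
rewrite (ip_ext (u' := fun x => w e0 (x / a)) (v' := fun x => @edge_linear R G c e0 (x / a)))//.
  by rewrite (ip_scale a_gt0 (hw e0) hlin) mulKf.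
by move=> x _; rewrite /edge_linear; field; rewrite a_neq0 gt_eqF ?len_gt0.
Qed.

Lemma aform_edge_ge0 w e : graph_L2 w -> 0 <= ip (len e) (prim2 w e) (schrod q w e).
Proof.
move=> hw; have hJ := prim2_L2 hw; have [hj hj1] := prim2_ac hw.
have hqJ := potential_mul_L2 q_adm hJ.
rewrite (ip_ext (u' := prim2 w e) (v' := fun x => -1 * w e x + q e x * prim2 w e x))//; last first.
  by move=> x _; rewrite /schrod mulN1r.
rewrite ipC (ip_linl _ (hw e) (hqJ e) (hJ e)) ipC (ip_prim2 e hw hj1) mulN1r opprK.
by rewrite addr_ge0 ?ip_ge0// ipC; exact: potential_form_ge0.
Qed.

(** prim2 gains a factor a, schrod a factor a^-1, and the substitution a factor a:
    the contribution of the edge is multiplied by a. It is nonnegative. *)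
Lemma aform_transplant w : graph_L2 w ->
  aform q w w <= aform q' (transplant w) (transplant w).
Proof.
move=> hw; apply: ler_sum => e _; have hJ := prim2_L2 hw; have hB := schrod_L2 q_adm hw.
rewrite (ip_ext (fun x => prim2_transplant hw) (fun x => schrod_transplant hw)) len_lengthen.
case: eqP => [->|//]; rewrite ipZl; [|exact: L2_scale|exact/L2Z/L2_scale].
rewrite [X in _ <= a * X]ipC ipZl; [|exact: L2_scale|exact: L2_scale].
rewrite (ip_scale a_gt0 (hB e0) (hJ e0)) mulKf// [X in _ <= a * X]ipC.
by apply: ler_peMl; [exact: aform_edge_ge0 | exact: ltW].
Qed.

(** Here the two factors a^-1 and the factor a of the substitution leave a^-1. *)
Lemma nform_transplant w : graph_L2 w ->
  nform q' (transplant w) (transplant w) <= nform q w w.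
Proof.
move=> hw; apply: ler_sum => e _; have hB := schrod_L2 q_adm hw.
rewrite (ip_ext (fun x => schrod_transplant hw) (fun x => schrod_transplant hw)) len_lengthen.
case: eqP => [->|//]; rewrite ipZl; [|exact: L2_scale|exact/L2Z/L2_scale].
rewrite [X in a^-1 * X]ipC ipZl; [|exact: L2_scale|exact: L2_scale].
rewrite (ip_scale a_gt0 (hB e0) (hB e0)) mulKf//.
by apply: ler_piMl; [exact: ip_ge0 | rewrite invf_le1// ltW].
Qed.

End Transplant.

(** * Complex and real eigenfunctions *)

Section ComplexParts.
Variable R : realType.
Local Notation mu := (@lebesgue_measure R).
Local Notation C := R[i].

(** One name for both, as real and imaginary parts are treated alike throughout. *)
Definition part (b : bool) (z : C) : R := if b then complex.Re z else complex.Im z.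

Lemma partD b (x y : C) : part b (x + y) = part b x + part b y.
Proof. by case: b x y => -[x1 x2] [y1 y2]. Qed.

Lemma partN b (x : C) : part b (- x) = - part b x.
Proof. by case: b x => -[x1 x2]. Qed.

Lemma part0 b : part b 0 = 0.
Proof. by case: b. Qed.

Lemma part_realM b (r : R) (x : C) : part b (r%:C%C * x) = r * part b x.
Proof. by case: b x => -[x1 x2] /=; rewrite mul0r ?subr0 ?addr0. Qed.

Lemma part_sum b (I : Type) (r : seq I) (P : pred I) (F : I -> C) :
  part b (\sum_(i <- r | P i) F i) = \sum_(i <- r | P i) part b (F i).
Proof.
elim/big_rec2: _ => [|i y z _ <-]; first exact: part0.
by rewrite partD.
Qed.

Lemma partM b (x y : C) : part b (x * y) =
  (if b then part true x else part false x) * part true y +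
  (if b then - part false x else part true x) * part false y.
Proof. by case: b x y => -[x1 x2] [y1 y2] /=; [rewrite mulNr | rewrite addrC]. Qed.

Lemma eq_parts (x y : C) : (forall b, part b x = part b y) -> x = y.
Proof. by case: x y => [x1 x2] [y1 y2] h; congr Complex; [exact: (h true)|exact: (h false)]. Qed.

Let mitv (i : interval R) : measurable ([set` i] : set (measurableTypeR R)).
Proof. exact: measurable_itv. Qed.

(** The functions on (0, l) extended by zero against the restrictions to [0, l]: the
    endpoints do not matter for the integral. *)
Lemma L2_LfunP (l : R) (u : R -> R) :
  L2 l u <-> (fun x => if 0 < x < l then u x else 0) \in Lfun mu 2%:E.
Proof.
pose D : set (measurableTypeR R) := `]0, l[%classic.
have mD : measurable D by exact: mitv.
have sub : D `<=` (`[0, l]%classic : set (measurableTypeR R)).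
  by move=> x; rewrite /D/= !in_itv/= => /andP[x0 xl]; rewrite !ltW.
have -> : (fun x => if 0 < x < l then u x else 0) = u \_ D.
  apply/funext => x; rewrite patchE; have -> // : (x \in D) = (0 < x < l).
  by apply/idP/idP; rewrite inE /D/= in_itv.
split.
- move=> [mu_ iu]; have mD_u : measurable_fun D u by exact: measurable_funS mu_.
  rewrite inE; apply/andP; split; rewrite inE/=.
    by apply/(measurable_restrictT _ mD).
  rewrite /finite_norm unlock poweR_lty//.
  have /integrableP[_] : mu.-integrable setT ((EFin \o (fun x => u x ^+ 2)) \_ D).
    by apply/integrable_restrict => //; rewrite setTI; exact: integrableS iu.
  apply: le_lt_trans; rewrite le_eqVlt; apply/orP; left; apply/eqP.
  apply: eq_integral => x _ /=; rewrite !patchE.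
  case: ifP => _ /=; last by rewrite normr0 powR0// ?normr0.
  by rewrite normrX powR_mulrn.
- move=> hu; have i2 := Lfun2_integrable_sqr hu.
  have mu_ : measurable_fun setT (u \_ D).
    by move: hu; rewrite inE => /andP[+ _]; rewrite inE.
  have mD_u : measurable_fun D u by apply/(measurable_restrictT _ mD).
  have mI : measurable_fun `[0, l] u by exact: measurable_fun_itv_cc mD_u.
  split => //; apply/integrableP; split; first exact/measurable_EFinP/measurable_funX.
  rewrite -integral_itv_bndo_bndc; last first.
    apply: measurableT_comp => //; apply/measurable_EFinP/measurable_funX.
    by apply: measurable_funS mI => //; apply: subset_itvl; rewrite bnd_simp.
  rewrite -integral_itv_obnd_cbnd; last first.
    by apply: measurableT_comp => //; apply/measurable_EFinP; exact: measurable_funX.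
  have /integrableP[_] := i2; apply: le_lt_trans; rewrite [leLHS]integral_mkcond.
  rewrite le_eqVlt; apply/orP; left; apply/eqP; apply: eq_integral => x _ /=.
  by rewrite !patchE; case: ifP => _ //=; rewrite expr0n normr0.
Qed.

Lemma part_integral0 b (u : R -> C) x : part b (integral0 u x) = primitive (part b \o u) x.
Proof. by case: b. Qed.

Lemma H1_intervalP (l : R) (u du : R -> C) :
  H1_interval l u du <-> forall b, ac l (part b \o u) (part b \o du).
Proof.
split=> [[[dr di] hu] b|h].
  split; first by apply/L2_LfunP; case: b.
  by move=> x /hu; rewrite /= => ->; rewrite partD part_integral0.
split.
  by split; apply/L2_LfunP; [exact: (h true).1 | exact: (h false).1].
move=> x xl; apply: eq_parts => b; rewrite partD part_integral0.
exact: (h b).2.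
Qed.

End ComplexParts.

Section ComplexEigenfunctions.
Variables (R : realType) (G : metric_graph R) (q : edge G -> R -> R).
Hypothesis q_adm : admissible_potential q.
Local Notation V := (edge G -> R -> R^o).
Local Notation C := R[i].
Implicit Types (F : graph_fun G) (w g h : V) (e : edge G) (p : endpoint G).

Let len_ge0 e : 0 <= len e. Proof. exact/ltW/len_gt0. Qed.

Definition gpart b F : V := fun e x => part b (F e x).
Definition complexify g : graph_fun G := fun e x => (g e x)%:C%C.

Lemma gpart_trace b F p : rtrace (gpart b F) p = part b (trace F p).
Proof. by rewrite /rtrace /trace; case: ifP. Qed.

Lemma gpart_normal b F v : rnormal (gpart b F) v = part b (normal_deriv F v).
Proof.
rewrite /normal_deriv part_sum; apply: eq_bigr => p _.
by rewrite gpart_trace; case: ifP => // _; rewrite partN.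
Qed.

Lemma vertex_valueP F b : vertex_continuous F ->
  exists c : vert G -> R, forall p, rtrace (gpart b F) p = c (end_vert p).
Proof.
move=> hF; exists (fun v => if [pick p | end_vert p == v] is Some p then
  part b (trace F p) else 0) => p.
rewrite gpart_trace; case: pickP => [p' /eqP p'p|/(_ p)]; last by rewrite eqxx.
by rewrite (hF _ _ p'p).
Qed.

Lemma H2_tilde_part b F F1 F2 : H2_tilde F F1 F2 ->
  graph_ac (gpart b F) (gpart b F1) /\ graph_ac (gpart b F1) (gpart b F2).
Proof.
move=> h; split=> e; have [/H1_intervalP h1 /H1_intervalP h2] := h e.
  exact: (h1 b).
exact: (h2 b).
Qed.

(** The component f0 of F in the domain of S has second derivative F2 - h2. Its first
    derivatives obtained from the two descriptions agree almost everywhere to begin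
    with; [ac_deriv_eq0] makes them agree at the endpoints too, which is where the
    normal derivatives are taken. *)
Lemma krein_eig_part b kappa F : in_eigenspace q kappa F ->
  exists w, krein_eig q kappa w (gpart b F).
Proof.
move=> [[f0 [h [[f01 [f02 [hf0 _ f0v]]] [h1 [h2 [hh hc h_ae]]] Feq]]]
  [F1 [F2 [hF _ F_ae]]]].
have [a1 a2] := H2_tilde_part b hf0.
have [b1 b2] := H2_tilde_part b hh.
have [c1 c2] := H2_tilde_part b hF.
pose w : V := (-1) *: gpart b h2 + gpart b F2.
pose d1 : V := (-1) *: gpart b h1 + gpart b F1.
have ac_d1 : graph_ac d1 w by move=> e; exact: ac_lin.
have ac_d0 : graph_ac (gpart b f0) d1.
  move=> e; have := ac_lin (-1) (b1 e) (c1 e); apply: ac_ext => // x xl.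
  by rewrite /gpart Feq// partD mulN1r addrCA addNr addr0.
have d1E e x : 0 <= x <= len e -> d1 e x = gpart b f01 e x.
  move=> xl; have dac := ac_lin (-1) (ac_d1 e) (a2 e).
  have := ac_deriv_eq0 (len_gt0 e) dac
    (ac_primitive_eq (fun _ _ => erefl) (ac_d0 e) (a1 e) (len_ge0 e)) xl.
  by rewrite mulN1r addrC => /eqP; rewrite subr_eq0 => /eqP.
have f0_ends e : gpart b f0 e 0 = 0 /\ gpart b f0 e (len e) = 0.
  have /(_ (e, false)) t0 := (f0v (src e)).1.
  have /(_ (e, true)) tl := (f0v (tgt e)).1.
  have := gpart_trace b f0 (e, false); rewrite t0// part0 => z0.
  by have := gpart_trace b f0 (e, true); rewrite tl// part0.
have jE e x : 0 <= x <= len e ->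
    gpart b f0 e x = prim2 w e x /\ d1 e x = prim1 w e x.
  by apply: (dirichlet_unique (len_gt0 e) (ac_d0 e) (ac_d1 e)); have [] := f0_ends e.
have hw : graph_L2 w by move=> e; exact: (ac_d1 e).1.
exists w; split.
  split=> // c; rewrite gip_edge_linear// big1// => v _.
  have -> : rnormal (prim1 w) v = 0; last by rewrite mul0r.
  have := gpart_normal b f01 v; rewrite (f0v v).2 part0 => <-.
  apply: eq_bigr => -[e t] _; have l0 := len_ge0 e.
  rewrite /rtrace /= -!d1E ?lexx ?l0//.
  have xl b0 : 0 <= (if b0 then len e else 0) <= len e by case: b0; rewrite lexx l0.
  by case: t; rewrite -?(jE e _ (xl true)).2 -?(jE e _ (xl false)).2.
have h_eq : graph_ae_eq (gpart b h2) (fun e x => q e x * gpart b h e x).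
  move=> e; apply: lebesgue_ae1 (h_ae e) => x hx /hx /(congr1 (part b)).
  rewrite part0 partD partN part_realM => /eqP; rewrite eq_sym addrC subr_eq0.
  by move=> /eqP ->.
exists (gpart b h), (gpart b h1), (gpart b h2); split.
- by split => //; exact: vertex_valueP.
- by move=> e x xl; rewrite -(jE e x xl).1 /gpart Feq// partD.
- move=> e; apply: lebesgue_ae2 (F_ae e) (h_eq e) => x Fx hx xl.
  have xl' : 0 <= x <= len e by case/andP: xl => x0 xl; rewrite !ltW.
  have := congr1 (part b) (Fx xl); rewrite partD partN !part_realM => FE.
  rewrite graph_scaleE /gpart FE /schrod -(jE e x xl').1.
  rewrite /w graph_addE graph_scaleE hx// /gpart Feq// partD.
  by rewrite mulN1r opprD opprK mulrDr; ring.
Qed.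

Lemma ac_realify (l : R) (u du : R -> R) : 0 <= l -> ac l u du ->
  H1_interval l (fun x => (u x)%:C%C) (fun x => (du x)%:C%C).
Proof.
move=> l0 hu; apply/H1_intervalP => b.
have -> : part b \o (fun x => (u x)%:C%C) = if b then u else fun=> 0 by case: b.
have -> : part b \o (fun x => (du x)%:C%C) = if b then du else fun=> 0 by case: b.
case: b => //; have := ac_affine l 0 0; apply: ac_ext => // x _.
by rewrite mul0r addr0.
Qed.

Lemma complexify_trace g p : trace (complexify g) p = (rtrace g p)%:C%C.
Proof. by rewrite /trace /rtrace; case: ifP. Qed.

Lemma dom_S2_normal w v : dom_S2 w -> rnormal (prim1 w) v = 0.
Proof.
move=> [hw wl]; have := wl (fun y => (y == v)%:R); rewrite gip_edge_linear//.
by rewrite (bigD1 v)//= eqxx mulr1 big1 ?addr0// => y /negbTE ->; rewrite mulr0.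
Qed.

Lemma in_eigenspace_complexify kappa w g : krein_eig q kappa w g ->
  in_eigenspace q kappa (complexify g).
Proof.
move=> [hY [h [h1 [h2 [[hh1 hh2 [c hc] h_ae] gE g_ae]]]]].
have hw := hY.1; have [hj hj1] := prim2_ac hw.
split.
  exists (complexify (prim2 w)), (complexify h); split.
  - exists (complexify (prim1 w)), (complexify w); split.
    + by move=> e; split; exact: ac_realify.
    + move=> p p' _; rewrite !complexify_trace /rtrace.
      by case: ifP; case: ifP; rewrite ?prim2_at0 ?prim2_at_end.
    + move=> v; split.
        by move=> p _; rewrite complexify_trace /rtrace; case: ifP; rewrite ?prim2_at0 ?prim2_at_end.
      apply: eq_parts => b; rewrite -gpart_normal part0.
      case: b; first exact: dom_S2_normal.
      rewrite /rnormal big1// => p _.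
      by rewrite /rtrace /gpart /=; case: ifP => _; rewrite ?oppr0 if_same ?oppr0.
  - exists (complexify h1), (complexify h2); split.
    + by move=> e; split; exact: ac_realify.
    + by move=> p p' pp; rewrite !complexify_trace !hc pp.
    + move=> e; apply: lebesgue_ae1 (h_ae e) => x hx /hx h2x.
      by rewrite /complexify h2x rmorphM/= addNr.
  - by move=> e x xl; rewrite /complexify gE// rmorphD.
exists (complexify (1 *: prim1 w + h1)), (complexify (1 *: w + h2)); split.
- move=> e; split; apply: ac_realify => //; last exact: ac_lin.
  have := ac_lin 1 (hj e) (hh1 e); apply: ac_ext => // x xl.
  by rewrite mul1r gE.
- move=> p p' pp; rewrite !complexify_trace; congr (_%:C%C).
  have traceE p0 : rtrace g p0 = rtrace h p0.
    rewrite /rtrace; case: ifP => _; rewrite gE ?lexx ?len_ge0//.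
      by rewrite prim2_at_end add0r.
    by rewrite prim2_at0 add0r.
  by rewrite !traceE !hc pp.
- move=> e; apply: lebesgue_ae2 (g_ae e) (h_ae e) => x gx hx xl.
  have xl' : 0 <= x <= len e by case/andP: xl => x0 xl; rewrite !ltW.
  rewrite /complexify -!rmorphM -rmorphN -rmorphD; congr (_%:C%C).
  rewrite -graph_scaleE gx// graph_addE graph_scaleE hx// gE// /schrod.
  have alg (w0 q0 h0 j : R) : - w0 + q0 * j = - (1 * w0 + q0 * h0) + q0 * (j + h0) by ring.
  exact: alg.
Qed.

End ComplexEigenfunctions.

Section ComplexIndependence.
Variables (R : realType) (G : metric_graph R).
Local Notation V := (edge G -> R -> R^o).

(** Real and imaginary parts of the coefficients can be read off by inner products
    with the members of the family. *)
Lemma complexify_lin_indep n (g : 'I_n -> V) : (forall k, graph_L2 (g k)) ->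
  (forall k j, k != j -> gip (g k) (g j) = 0) -> (forall k, 0 < gip (g k) (g k)) ->
  lin_indep (fun k => complexify (g k)).
Proof.
move=> hg orth pos c c0 k; apply: eq_parts => b; rewrite part0.
pose s : V := \sum_i part b (c i) *: g i.
have hs : graph_L2 s by apply: graph_L2_sum => i; exact: graph_L2Z.
have s0 : graph_ae_eq s 0.
  move=> e; apply: lebesgue_ae1 (c0 e) => x h /h /(congr1 (part b)).
  rewrite part0 part_sum => s0; rewrite /s graph_sumE -[RHS]s0.
  by apply: eq_bigr => i _; rewrite graph_scaleE mulrC -part_realM mulrC.
have := gip_ae hs (@graph_L2_0 _ G) (hg k) (hg k) s0 (graph_ae_refl (g k)).
rewrite gip0l gip_suml// (bigD1 k)//= big1 ?addr0 => [/eqP|i ik]; last first.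
  by rewrite orth ?mulr0.
by rewrite mulf_eq0 [_ (g k) == 0]gt_eqF ?orbF// => /eqP.
Qed.

End ComplexIndependence.

(** * Quadratic forms on combinations of eigenfunctions *)

Section FormSums.
Variables (R : realType) (V : lmodType R) (D : V -> Prop).
Hypothesis D_lin : forall c x y, D x -> D y -> D (c *: x + y).
Hypothesis D0 : D 0.

Lemma linear_on_sum (L : V -> R) (I : finType) (r : I -> R) (x : I -> V) :
  (forall c y z, D y -> D z -> L (c *: y + z) = c * L y + L z) ->
  (forall i, D (x i)) -> L (\sum_i r i *: x i) = \sum_i r i * L (x i).
Proof.
move=> L_lin Dx.
suff [_ ->//] : D (\sum_i r i *: x i) /\ L (\sum_i r i *: x i) = \sum_i r i * L (x i).
elim/big_rec2: _ => [|i b z _ [hz <-]].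
  by split=> //; have := L_lin (-1) 0 0 D0 D0; rewrite scaler0 addr0 mulN1r addNr.
by split; [exact: D_lin | rewrite L_lin].
Qed.

Variable Q : V -> V -> R.
Hypothesis Q_form : psd_form D Q.

Lemma psd_form_suml (I : finType) (r : I -> R) (x : I -> V) y :
  (forall i, D (x i)) -> D y -> Q (\sum_i r i *: x i) y = \sum_i r i * Q (x i) y.
Proof.
move=> Dx Dy; have [Ql _ _] := Q_form.
by apply: (linear_on_sum (L := Q^~ y)) => // c u v Du Dv; exact: Ql.
Qed.

Lemma psd_form_sum2 (I : finType) (r : I -> R) (x : I -> V) : (forall i, D (x i)) ->
  Q (\sum_i r i *: x i) (\sum_i r i *: x i) =
  \sum_i \sum_j r i * r j * Q (x i) (x j).
Proof.
move=> Dx; have [_ Qs _] := Q_form.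
have Ds : D (\sum_i r i *: x i) by elim/big_rec: _ => // i z _; exact: D_lin.
rewrite psd_form_suml//; apply: eq_bigr => i _; rewrite Qs// psd_form_suml// mulr_sumr.
by apply: eq_bigr => j _; rewrite Qs// mulrA.
Qed.

End FormSums.

Section EigenCombinations.
Variables (R : realType) (G : metric_graph R) (q : edge G -> R -> R).
Hypothesis q_adm : admissible_potential q.
Local Notation V := (edge G -> R -> R^o).
Variables (T : finType) (nu : T -> R) (w g : T -> V) (mu0 : R).
Hypothesis eig : forall p, krein_eig q (nu p) (w p) (g p).
Hypothesis nu_in : forall p, 0 < nu p <= mu0.
Variable r : T -> R.

Let hw p : graph_L2 (w p). Proof. by have [[]] := eig p. Qed.
Let hg p : graph_L2 (g p). Proof. exact: krein_eig_L2 (eig p). Qed.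
Let nu_ge0 p : 0 <= nu p. Proof. by have /andP[/ltW] := nu_in p. Qed.

(** For f = prim2 (w p) and f' = prim2 (w p'): <f, S f'> = <g p, S f'> since g p - f is
    orthogonal to the range of S, and S f' = nu p' g p'. *)
Lemma aform_krein_eig p p' : aform q (w p) (w p') = nu p' * gip (g p) (g p').
Proof.
rewrite /aform gipC -(gip_schrod_eig q_adm (eig p) (eig p').1) gipC.
exact: gip_eig (eig p') (hg p).
Qed.

Lemma nform_krein_eig p p' : nform q (w p) (w p') = nu p * nu p' * gip (g p) (g p').
Proof.
rewrite /nform (gip_eig q_adm (eig p'))//; last exact: schrod_L2.
by rewrite gipC (gip_eig q_adm (eig p))// gipC mulrCA mulrA.
Qed.

(** The symmetry of aform. *)
Lemma krein_eig_orthogonal p p' : nu p != nu p' -> gip (g p) (g p') = 0.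
Proof.
move=> pp'; have := aform_krein_eig p p'; rewrite (aformC q_adm (hw p) (hw p')).
rewrite aform_krein_eig (gipC (g p')) => /eqP; rewrite -subr_eq0 -mulrBl mulf_eq0.
by rewrite subr_eq0 (negbTE pp') => /eqP.
Qed.

(** The weight sqrt (f (nu p)) multiplies the block of the Gram matrix that belongs to
    the value nu p by f (nu p); the other blocks vanish by orthogonality. *)
Lemma gip_weighted (f : R -> R) : (forall p, 0 <= f (nu p)) ->
  let y := \sum_p (r p * Num.sqrt (f (nu p))) *: g p in
  gip y y = \sum_p \sum_p' r p * r p' * (f (nu p') * gip (g p) (g p')).
Proof.
move=> f0 /=; rewrite (psd_form_sum2 (@graph_L2_lin R G) (@graph_L2_0 R G) (gip_form G))//.
apply: eq_bigr => p _; apply: eq_bigr => p' _.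
have [<-|pp'] := eqVneq (nu p) (nu p'); last by rewrite krein_eig_orthogonal// !mulr0.
by rewrite -{3}[f (nu p)]sqr_sqrtr//; ring.
Qed.

Let s : V := \sum_p r p *: w p.

Lemma aform_combination : aform q s s =
  \sum_p \sum_p' r p * r p' * (nu p' * gip (g p) (g p')).
Proof.
rewrite (psd_form_sum2 (@graph_L2_lin R G) (@graph_L2_0 R G) (aform_psd q_adm))//.
by apply: eq_bigr => p _; apply: eq_bigr => p' _; rewrite aform_krein_eig.
Qed.

(** mu0 aform - nform has the weights nu (mu0 - nu), which are nonnegative: it is
    the square norm of a weighted combination of the g p. *)
Lemma nform_combination_le : nform q s s <= mu0 * aform q s s.
Proof.
rewrite -subr_ge0.
have f0 p : 0 <= nu p * (mu0 - nu p).
  by rewrite mulr_ge0// subr_ge0; have /andP[] := nu_in p.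
suff -> : mu0 * aform q s s - nform q s s =
  \sum_p \sum_p' r p * r p' * (nu p' * (mu0 - nu p') * gip (g p) (g p')).
  by rewrite -(gip_weighted (f := fun t => t * (mu0 - t)) f0); exact: gip_ge0.
rewrite aform_combination.
rewrite (psd_form_sum2 (@graph_L2_lin R G) (@graph_L2_0 R G) (nform_psd q_adm))//.
rewrite mulr_sumr -sumrB; apply: eq_bigr => p _.
rewrite mulr_sumr -sumrB; apply: eq_bigr => p' _; rewrite nform_krein_eig.
have [->|pp'] := eqVneq (nu p) (nu p'); last by rewrite krein_eig_orthogonal//; ring.
by ring.
Qed.

(** aform is the square norm of the combination with weights sqrt nu, whose
    components for different eigenvalues are orthogonal. *)
Lemma aform_combination_eq0 : aform q s s = 0 ->
  forall t, graph_ae_eq (\sum_p (if nu p == t then r p else 0) *: g p) 0.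
Proof.
rewrite aform_combination -(gip_weighted (f := id) nu_ge0); set y := \sum_p _ => yy0 t.
have hy : graph_L2 y by apply: graph_L2_sum => p; exact: graph_L2Z.
set B := \sum_p _.
have hB : graph_L2 B by apply: graph_L2_sum => p; exact: graph_L2Z.
apply: gip_eq0 => //; rewrite {1}/B gip_suml// big1// => p _.
case: eqP => [nu_t|_]; last by rewrite mul0r.
have nup : 0 < Num.sqrt (nu p) by rewrite sqrtr_gt0; have /andP[] := nu_in p.
have := psd_form_null (@graph_L2_lin R G) (gip_form G) hy (hg p) yy0.
rewrite /y gip_suml// => yg; apply/eqP; rewrite mulf_eq0; apply/orP; right.
rewrite -(mulrI_eq0 _ (mulfI (lt0r_neq0 nup))) -[X in _ == X]yg gip_sumr// mulr_sumr.
apply/eqP; apply: eq_bigr => p' _.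
have [p't|p't] := eqVneq (nu p') t.
  by rewrite p't nu_t (gipC (g p)); ring.
by rewrite (gipC (g p')) krein_eig_orthogonal ?nu_t 1?eq_sym// !mulr0.
Qed.

End EigenCombinations.

(** * Eigenfunctions of the lengthened graph *)

Section Realification.
Variable R : realType.
Local Notation C := R[i].

Lemma nonzero_kernel (K : fieldType) (m n : nat) (A : 'M[K]_(n, m)) : (m < n)%N ->
  exists2 c : 'rV_n, c != 0 & c *m A = 0.
Proof.
move=> mn; exists (nz_row (kermx A)); last exact/sub_kermxP/nz_row_sub.
by rewrite nz_row_eq0 -mxrank_eq0 mxrank_ker -lt0n subn_gt0 (leq_ltn_trans (rank_leq_col A)).
Qed.

(** The coefficients with which part true z and part false z enter part b (c z):
    multiplication by c as a real 2 x 2 matrix. *)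
Definition real_coef (b b' : bool) (z : C) : R :=
  if b' then part b z else if b then - part false z else part true z.

Lemma part_combination b (I : finType) (c z : I -> C) :
  part b (\sum_i c i * z i) =
  \sum_(p : I * bool) real_coef b p.2 (c p.1) * part p.2 (z p.1).
Proof.
rewrite part_sum -(pair_bigA _ (fun i b' => real_coef b b' (c i) * part b' (z i)))/=.
by apply: eq_bigr => i _; rewrite big_bool partM /real_coef; case: b.
Qed.

End Realification.

Section TestFunctions.
Variables (R : realType) (G : metric_graph R) (q : edge G -> R -> R).
Hypothesis q_adm : admissible_potential q.
Local Notation V := (edge G -> R -> R^o).
Variables (n : nat) (nu : 'I_n -> R) (F : 'I_n -> graph_fun G) (mu0 : R).
Hypothesis nu_in : forall i, 0 < nu i <= mu0.
Hypothesis F_indep : forall (c : 'I_n -> R[i]) t,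
  ae_eq_graph (fun e x => \sum_(i | nu i == t) c i * F i e x) (fun _ _ => 0) ->
  forall i, nu i = t -> c i = 0.
Variable w : 'I_n * bool -> V.
Hypothesis w_eig : forall p, krein_eig q (nu p.1) (w p) (gpart p.2 (F p.1)).

Let combination b (c : 'I_n -> R[i]) : V := \sum_p real_coef b p.2 (c p.1) *: w p.

(** Otherwise both the real and the imaginary part of the complex combination vanish
    on every block of equal eigenvalues, against the independence. *)
Lemma aform_combination_neq0 (c : 'I_n -> R[i]) i : c i != 0 ->
  exists b, aform q (combination b c) (combination b c) != 0.
Proof.
move=> ci; apply: contrapT => /forallNP all0; move/eqP: ci; apply.
apply: (@F_indep c (nu i)) => // e.
have zero b : graph_ae_eq (\sum_p (if nu p.1 == nu i then real_coef b p.2 (c p.1) else 0)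
    *: gpart p.2 (F p.1)) 0.
  apply: (aform_combination_eq0 q_adm w_eig (fun p => nu_in p.1)).
  by apply/eqP; rewrite -[_ == _]negbK; apply/negP; exact: all0.
apply: lebesgue_ae2 (zero true e) (zero false e) => x h1 h2 xl; apply: eq_parts => b.
rewrite part0 big_mkcond/=.
rewrite (eq_bigr (fun j => (if nu j == nu i then c j else 0) * F j e x)); last first.
  by move=> j _; case: ifP => // _; rewrite mul0r.
rewrite part_combination.
have : (\sum_p (if nu p.1 == nu i then real_coef b p.2 (c p.1) else 0)
    *: gpart p.2 (F p.1)) e x = 0 by case: b; [exact: h1 | exact: h2].
rewrite graph_sumE => z0; rewrite -[RHS]z0; apply: eq_bigr => p _; rewrite graph_scaleE; case: ifP => // _.
by rewrite /real_coef /part !if_same oppr0 !if_same.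
Qed.

(** The m functionals on the real and imaginary parts of the n eigenfunctions make a
    complex m x n system, which has a nonzero solution c as m < n. The combinations
    belonging to the real and the imaginary part of the complex function with
    coefficients c satisfy all conditions, and one of them has positive energy. *)
Lemma test_function m (ell : 'I_m -> V -> R) : (m < n)%N ->
  (forall k c u v, graph_L2 u -> graph_L2 v ->
    ell k (c *: u + v) = c * ell k u + ell k v) ->
  exists s, [/\ dom_S2 s, forall k, ell k s = 0, 0 < aform q s s &
    nform q s s <= mu0 * aform q s s].
Proof.
move=> mn ell_lin.
(* The values on w (i, true) and w (i, false), read as one complex number. *)
pose A : 'M[R[i]]_(n, m) := \matrix_(i, k) Complex (ell k (w (i, true))) (ell k (w (i, false))).
have [c c0 cA] := nonzero_kernel A mn.
have [i ci] : exists i, c 0 i != 0.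
  apply: contrapT => /forallNP h; move/negP: c0; apply; apply/eqP/rowP => i.
  by rewrite [RHS]mxE; apply/eqP; rewrite -[_ == _]negbK; apply/negP.
have [b sb] := aform_combination_neq0 (c := fun i => c 0 i) ci.
have hw p : graph_L2 (w p) by have [[]] := w_eig p.
exists (combination b (fun i => c 0 i)); split.
- by apply: dom_S2_sum => p; have [] := w_eig p.
- move=> k; rewrite (linear_on_sum (@graph_L2_lin R G) (@graph_L2_0 R G) _ (ell_lin k))//.
  have := congr1 (fun M : 'rV_m => part b (M 0 k)) cA.
  rewrite mxE [X in _ = part b X]mxE part0 part_combination => z0; rewrite -[RHS]z0.
  by apply: eq_bigr => -[j []] _ /=; rewrite mxE.
- rewrite lt_neqAle eq_sym sb; have [_ _ ->//] := aform_psd q_adm.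
  by apply: graph_L2_sum => p; exact: graph_L2Z.
- exact: (nform_combination_le q_adm w_eig (fun p => nu_in p.1)).
Qed.

End TestFunctions.

Section Eigenfamilies.
Variables (R : realType) (G : metric_graph R) (q : edge G -> R -> R).
Hypothesis q_adm : admissible_potential q.
Local Notation V := (edge G -> R -> R^o).

Definition eigenfamily (mu0 : R) (m : nat) (kap : 'I_m -> R) (W g : 'I_m -> V) :=
  [/\ forall k, 0 < kap k <= mu0, forall k, krein_eig q (kap k) (W k) (g k),
      forall k j, k != j -> gip (g k) (g j) = 0 & forall k, 0 < gip (g k) (g k)].

Definition extend (A : Type) m (f : 'I_m -> A) (x : A) (i : 'I_m.+1) : A :=
  if unlift ord_max i is Some j then f j else x.

Lemma eigenfamily_extend mu0 m (kap : 'I_m -> R) (W g : 'I_m -> V) p :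
  eigenfamily mu0 kap W g -> constrained g p -> 0 < aform q p p ->
  nform q p p <= mu0 * aform q p p ->
  exists (kap' : 'I_m.+1 -> R) (W' g' : 'I_m.+1 -> V), eigenfamily mu0 kap' W' g'.
Proof.
move=> [kin eig orth pos] hp ap np.
have kpos k : 0 < kap k by have /andP[] := kin k.
have [kappa [w [f [kapin f_eig fpos forth]]]] :=
  extremal_eigenfunction q_adm kpos eig orth pos hp ap np.
exists (extend kap kappa), (extend W w), (extend g f).
split=> [k|k|k j|k]; rewrite /extend.
- by case: unlift => [k'|]; [exact: kin | exact: kapin].
- by case: unlift => [k'|]; [exact: eig | exact: f_eig].
- case: (unliftP ord_max k) => [k' ->|->]; case: (unliftP ord_max j) => [j' ->|->].
  + by rewrite (inj_eq lift_inj); exact: orth.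
  + by move=> _; rewrite gipC; exact: forth.
  + by move=> _; exact: forth.
  + by move/negP; case; exact: eqxx.
- by case: unlift => [k'|]; [exact: pos | exact: fpos].
Qed.

End Eigenfamilies.

Section LengthenedFamily.
Variables (R : realType) (G : metric_graph R) (q : edge G -> R -> R).
Hypothesis q_adm : admissible_potential q.
Variables (e0 : edge G) (a : R).
Hypothesis a_gt1 : 1 < a.
Local Notation V := (edge G -> R -> R^o).
Local Notation G' := (lengthen e0 a_gt1).
Local Notation V' := (edge G' -> R -> R^o).
Local Notation q' := (lengthen_potential e0 a_gt1 q).
Variables (n : nat) (nu : 'I_n -> R) (F : 'I_n -> graph_fun G) (mu0 : R).
Hypothesis nu_in : forall i, 0 < nu i <= mu0.
Hypothesis F_eig : forall i, in_eigenspace q (nu i) (F i).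
Hypothesis F_indep : forall (c : 'I_n -> R[i]) t,
  ae_eq_graph (fun e x => \sum_(i | nu i == t) c i * F i e x) (fun _ _ => 0) ->
  forall i, nu i = t -> c i = 0.

(** One more eigenfunction at a time. As long as m < n there is a test function on
    the short graph whose transplant is orthogonal to the m eigenfunctions already
    found. *)
Lemma lengthened_eigenfamily m : (m <= n)%N ->
  exists (kap : 'I_m -> R) (W g : 'I_m -> V'), eigenfamily q' mu0 kap W g.
Proof.
elim: m => [_|m IHm mn].
  by exists (fun=> 0), (fun=> 0), (fun=> 0); split=> [[]|[]|[]|[]].
have [kap [W [g fam]]] := IHm (ltnW mn); have [kin eig _ _] := fam.
have q'_adm := lengthen_admissible q_adm e0 a_gt1.
have hg k : graph_L2 (g k) by exact: krein_eig_L2 (eig k).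
have [w w_eig] := choice (fun p => krein_eig_part p.2 (F_eig p.1)).
pose ell k (u : V) := gip (prim2 (transplant u : V')) (g k).
have ell_lin k c u v : graph_L2 u -> graph_L2 v ->
    ell k (c *: u + v) = c * ell k u + ell k v.
  move=> hu hv; rewrite /ell transplant_lin.
  have hu' := transplant_L2 (a_gt1 := a_gt1) (e0 := e0) hu.
  have hv' := transplant_L2 (a_gt1 := a_gt1) (e0 := e0) hv.
  exact: (gip_prim2_lin (G := G') c hu' hv' (hg k)).
have [s [hs s0 spos sn]] := test_function q_adm nu_in F_indep w_eig mn ell_lin.
have mu0_ge0 : 0 <= mu0.
  by have /andP[nu0 /(le_trans (ltW nu0))] := nu_in (Ordinal mn).
have sa := aform_transplant q_adm e0 a_gt1 hs.1.
apply: (eigenfamily_extend q'_adm fam (p := transplant s : V')).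
- by split; [exact: transplant_dom_S2 | exact: s0].
- exact: lt_le_trans spos sa.
- apply: le_trans (nform_transplant q_adm e0 a_gt1 hs.1) _.
  by apply: le_trans sn _; rewrite ler_wpM2l.
Qed.

End LengthenedFamily.

(** * The kernel of the adjoint on the lengthened graph *)

Section KernelTransplant.
Variables (R : realType) (G : metric_graph R) (q : edge G -> R -> R).
Variables (e0 : edge G) (a : R).
Hypothesis a_gt1 : 1 < a.
Local Notation C := R[i].
Local Notation G' := (lengthen e0 a_gt1).
Local Notation q' := (lengthen_potential e0 a_gt1 q).
Implicit Types (F : graph_fun G).

Let a_gt0 : 0 < a. Proof. exact: lt_trans a_gt1. Qed.
Let a_neq0 : a != 0. Proof. exact: lt0r_neq0. Qed.

(** For k = 0, 1, 2 these are the rescalings of a function and of its first two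
    derivatives. *)
Definition dilate (k : nat) F : graph_fun G' := fun e x =>
  if e == e0 then (a ^- k)%:C%C * F e (x / a) else F e x.

Lemma dilate_H1 (k : nat) F F1 (e : edge G') :
  H1_interval (@len R G e) (F e) (F1 e) ->
  H1_interval (len e) (dilate k F e) (dilate k.+1 F1 e).
Proof.
rewrite len_lengthen /dilate; case: ifP => // _ /H1_intervalP h; apply/H1_intervalP => b.
have l0 : 0 <= a * @len R G e by rewrite mulr_ge0 ?ltW// len_gt0.
have := acZ (a ^- k.+1) l0 (ac_scale a_gt0 (h b)).
have -> : part b \o (fun x => (a ^- k.+1)%:C%C * F1 e (x / a)) =
    fun x => a ^- k.+1 * (part b \o F1 e) (x / a).
  by apply/funext => x; exact: part_realM.
apply: ac_ext => // x xl /=; rewrite part_realM exprS invfM mulrACA mulrA.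
by rewrite mulVf// mul1r.
Qed.

Lemma S_adjoint_dilate F : S_adjoint q F (fun _ _ => 0) ->
  S_adjoint q' (dilate 0 F) (fun _ _ => 0).
Proof.
move=> [F1 [F2 [hF F_cont F_ae]]]; exists (dilate 1 F1), (dilate 2 F2); split.
- by move=> e; have [h1 h2] := hF e; split; exact: dilate_H1.
- have tr p : trace (dilate 0 F) p = trace F p.
    rewrite /trace /dilate; case: p => e [] /=; last first.
      by case: ifP => // _; rewrite mul0r expr0 invr1 mul1r.
    rewrite /lengthened_len; case: (e == e0) => //; rewrite expr0 invr1 mul1r.
    by congr F; rewrite mulrC mulKf.
  by move=> p p' pp'; rewrite !tr; exact: F_cont.
- move=> e; rewrite len_lengthen /dilate /lengthen_potential.
  case: ifP => [_|_]; last exact: F_ae.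
  apply: lebesgue_ae1 (ae_scale a_gt0 (F_ae e)) => x h /andP[x0 xl].
  have xal : 0 < x / a < @len R G e by rewrite divr_gt0//= ltr_pdivrMr// [_ * a]mulrC.
  have -> : - ((a ^- 2)%:C%C * F2 e (x / a)) +
      (a ^- 2 * q e (x / a))%:C%C * ((a ^- 0)%:C%C * F e (x / a)) =
    (a ^- 2)%:C%C * (- F2 e (x / a) + (q e (x / a))%:C%C * F e (x / a)).
    by rewrite expr0 invr1 mul1r rmorphM mulrDr mulrN mulrA.
  by rewrite -h// mulr0.
Qed.

(** If the adjoint maps F to 0 then F is in the domain of the extension, with zero
    component in the domain of S. *)
Lemma in_eigenspace0 (G0 : metric_graph R) (q0 : edge G0 -> R -> R) (F : graph_fun G0) :
  in_eigenspace q0 0 F <-> S_adjoint q0 F (fun _ _ => 0).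
Proof.
have mul0 : (fun e x => 0%:C%C * F e x) = (fun _ _ => 0).
  by apply/funext => e; apply/funext => x; rewrite mul0r.
rewrite /in_eigenspace /Krein_laplacian mul0; split=> [[]//|hF]; split=> //.
exists (fun _ _ => 0), F; split=> [|//|e x _]; last by rewrite add0r.
exists (fun _ _ => 0), (fun _ _ => 0); split.
- have z e : H1_interval (@len R G0 e) (fun=> 0) (fun=> 0).
    have := ac_realify (ltW (len_gt0 e)) (ac_affine (len e) 0 0).
    by have -> // : (fun x : R => (0 + 0 * x)%:C%C) = fun=> 0;
      by apply/funext => x; rewrite mul0r addr0.
  by move=> e; split.
- by move=> p p' _; rewrite /trace !if_same.
- move=> v; split; first by move=> p _; rewrite /trace if_same.
  by rewrite /normal_deriv big1// => p _; rewrite /trace !if_same oppr0 if_same.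
Qed.

Lemma kernel_dilate n : multiplicity_ge q 0 n -> multiplicity_ge q' 0 n.
Proof.
move=> [u [u_eig u_indep]]; exists (fun i => dilate 0 (u i)); split=> [i|c c0].
  by apply/in_eigenspace0/S_adjoint_dilate/in_eigenspace0.
apply: u_indep => e; have := c0 e; rewrite len_lengthen /dilate.
case: ifP => // _ h0; have ainv_gt0 : 0 < a^-1 by rewrite invr_gt0.
apply: lebesgue_ae1 (ae_scale ainv_gt0 h0) => x h /andP[x0 xl].
rewrite invrK in h.
have := h; rewrite mulr_gt0//= [x * a]mulrC ltr_pM2l// => /(_ xl) h1.
rewrite -[RHS]h1; apply: eq_bigr => i _.
by rewrite expr0 invr1 mul1r [a * x]mulrC mulfK.
Qed.

End KernelTransplant.

(** * Counting eigenvalues *)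

Section Counting.
Variable R : realType.
Implicit Types (lam : nat -> R) (nu : R).

Lemma occurs_ge_inj lam n (f : 'I_n -> nat) nu : injective f ->
  occurs_ge lam nu #|[pred k | lam (f k) == nu]|.
Proof.
move=> f_inj; exists (map f (enum [pred k | lam (f k) == nu])); split.
- by rewrite map_inj_uniq// enum_uniq.
- by rewrite size_map -cardE.
- by move=> _ /mapP[k + ->]; rewrite mem_enum => /eqP.
Qed.

Lemma count_mem_map_enum n (kap : 'I_n -> R) nu :
  count_mem nu (map kap (enum 'I_n)) = #|[pred k | kap k == nu]|.
Proof. by rewrite cardE -size_filter filter_map size_map enumT. Qed.

(** All the occurrences of values at most m in the listing have an index below j. *)
Lemma size_le_listing lam (kappa : seq R) m j :
  {homo lam : i j / (i <= j)%N >-> i <= j} ->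
  (forall nu, nu \in kappa -> nu <= m /\ occurs_ge lam nu (count_mem nu kappa)) ->
  m < lam j -> (size kappa <= j)%N.
Proof.
move=> lam_homo hk mj.
have : forall nu, (count_mem nu kappa <= count_mem nu (map lam (iota 0 j)))%N.
  move=> nu; have [/hk[num [s [s_uniq <- s_nu]]]|] := boolP (nu \in kappa); last first.
    by move=> /count_memPn ->.
  rewrite count_map -size_filter; apply: uniq_leq_size => // i si.
  rewrite mem_filter mem_iota/= (s_nu i si) eqxx/= add0n ltnNge; apply/negP => ji.
  by have := le_lt_trans num mj; rewrite -(s_nu i si) ltNge lam_homo.
move=> /count_subseqP[s s_sub /perm_size ->].
by rewrite (leq_trans (size_subseq s_sub))// size_map size_iota.
Qed.

End Counting.

Section EigenvaluesOfGraph.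
Variables (R : realType) (G : metric_graph R) (q : edge G -> R -> R).
Hypothesis q_adm : admissible_potential q.
Local Notation V := (edge G -> R -> R^o).
Local Notation C := R[i].

(** The index set is cut into blocks of equal values; a block of size k takes its
    functions from k independent elements of the eigenspace. *)
Lemma eigenspace_families n (nu : 'I_n -> R) :
  (forall i, multiplicity_ge q (nu i) #|[pred j | nu j == nu i]|) ->
  exists F : 'I_n -> graph_fun G, (forall i, in_eigenspace q (nu i) (F i)) /\
    forall (c : 'I_n -> C) t,
      ae_eq_graph (fun e x => \sum_(i | nu i == t) c i * F i e x) (fun _ _ => 0) ->
      forall i, nu i = t -> c i = 0.
Proof.
move=> mult.
have : forall t, exists U : 'I_n -> graph_fun G,
    (forall i, nu i = t -> in_eigenspace q t (U i)) /\
    forall c : 'I_n -> C,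
      ae_eq_graph (fun e x => \sum_(i | nu i == t) c i * U i e x) (fun _ _ => 0) ->
      forall i, nu i = t -> c i = 0.
  move=> t; have [[i0 nu_i0]|no_t] := pselect (exists i, nu i = t); last first.
    by exists (fun _ _ _ => 0); split=> [i it|c _ i it]; case: no_t; exists i.
  have [u [u_eig u_indep]] := mult i0; rewrite nu_i0 in u u_eig u_indep.
  have A0 : i0 \in [pred j | nu j == t] by rewrite inE nu_i0.
  exists (fun i => u (enum_rank_in A0 i)); split=> [i _|c c0 i nu_i]; first exact: u_eig.
  have iA : i \in [pred j | nu j == t] by rewrite inE nu_i.
  rewrite -(enum_rankK_in A0 iA).
  apply: (u_indep (fun k => c (enum_val k))) => e.
  apply: lebesgue_ae1 (c0 e) => x h /h h0; rewrite -[RHS]h0.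
  rewrite [RHS](big_enum_val (A := [pred j | nu j == t])
    (fun i => c i * u (enum_rank_in A0 i) e x)).
  by apply: eq_bigr => k _; rewrite enum_valK_in.
move=> /choice[U hU]; exists (fun i => U (nu i) i); split=> [i|c t c0].
  exact: (hU (nu i)).1.
apply: (hU t).2 => e; apply: lebesgue_ae1 (c0 e) => x h /h h0; rewrite -[RHS]h0.
by apply: eq_bigr => i /eqP ->.
Qed.

Lemma eigenfamily_multiplicity m0 m (kap : 'I_m -> R) (W g : 'I_m -> V) nu :
  eigenfamily q m0 kap W g -> multiplicity_ge q nu #|[pred k | kap k == nu]|.
Proof.
move=> [_ eig orth pos]; exists (fun i => complexify (g (enum_val i))); split=> [i|].
  have /eqP k_nu : kap (enum_val i) == nu by have := enum_valP i; rewrite inE.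
  by have := in_eigenspace_complexify (eig (enum_val i)); rewrite k_nu.
apply: (complexify_lin_indep (g := fun i => g (enum_val i))) => [i|i j ij|i].
- exact: krein_eig_L2 (eig _).
- by apply: orth; rewrite (inj_eq enum_val_inj).
- exact: pos.
Qed.

(** nu |g|^2 = <f, S f> is nonnegative for g the real or the imaginary part, and one
    of them is not zero. *)
Lemma eigenvalue_ge0 nu : multiplicity_ge q nu 1 -> 0 <= nu.
Proof.
move=> [u [u_eig u_indep]]; rewrite leNgt; apply/negP => nu_lt0.
have [w w_eig] := choice (fun b => krein_eig_part b (u_eig ord0)).
have u0 b : graph_ae_eq (gpart b (u ord0)) 0.
  have hg := krein_eig_L2 (w_eig b); apply: gip_eq0 => //.
  have [_ _ /(_ (w b) (w_eig b).1.1)] := aform_psd q_adm.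
  rewrite (aform_krein_eig q_adm (nu := fun=> nu) w_eig) nmulr_rge0// => g0.
  by apply/eqP; rewrite eq_le g0 gip_ge0.
suff /eqP : (1 : C) = 0 by rewrite oner_eq0.
apply: (u_indep (fun=> 1) _ ord0) => e.
apply: lebesgue_ae2 (u0 true e) (u0 false e) => x ut uf xl.
rewrite big_ord1 mul1r; apply: eq_parts => b; rewrite part0.
by case: b; [exact: ut | exact: uf].
Qed.

End EigenvaluesOfGraph.

Section Monotonicity.
Variables (R : realType) (G : metric_graph R) (q : edge G -> R -> R).
Hypothesis q_adm : admissible_potential q.
Variables (e0 : edge G) (a : R).
Hypothesis a_gt1 : 1 < a.
Local Notation q' := (lengthen_potential e0 a_gt1 q).

(** [lengthened_eigenfamily] for the positive ones among the first j + 1 eigenvalues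
    of the short graph. *)
Lemma positive_eigenvalues_lengthen (lam : nat -> R) j :
  {homo lam : i j / (i <= j)%N >-> i <= j} ->
  (forall nu n, 0 < nu -> occurs_ge lam nu n -> multiplicity_ge q nu n) ->
  exists kappa : seq R, [/\ size kappa = #|[pred i : 'I_j.+1 | 0 < lam i]|,
    forall nu, nu \in kappa -> 0 < nu <= lam j &
    forall nu, multiplicity_ge q' nu (count_mem nu kappa)].
Proof.
move=> lam_homo lam_mult; set A := [pred i : 'I_j.+1 | 0 < lam i].
pose f (k : 'I_#|A|) : nat := enum_val k.
have f_inj : injective f by move=> k l /val_inj; exact: enum_val_inj.
have nu_in k : 0 < lam (f k) <= lam j.
  have := enum_valP k; rewrite inE => -> /=.
  by apply: lam_homo; rewrite -ltnS; exact: ltn_ord.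
have [F [F_eig F_indep]] := eigenspace_families (q := q) (nu := fun k => lam (f k))
  (fun k => lam_mult _ _ (proj1 (andP (nu_in k))) (occurs_ge_inj lam _ f_inj)).
have [kap [W [g fam]]] := lengthened_eigenfamily q_adm e0 a_gt1 nu_in F_eig F_indep (leqnn _).
exists (map kap (enum 'I_#|A|)); split.
- by rewrite size_map size_enum_ord.
- by move=> _ /mapP[k _ ->]; have [kin _ _ _] := fam.
- by move=> nu; rewrite count_mem_map_enum; exact: eigenfamily_multiplicity fam.
Qed.

End Monotonicity.

Theorem theorem4p10 (R : realType) (G : metric_graph R)
    (G_connected : graph_connected G)
    (q : edge G -> R -> R) (q_adm : admissible_potential q)
    (e0 : edge G) (a : R) (a_gt1 : 1 < a) :
  (forall lam lam' : nat -> R,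
     positive_eigenvalue_listing q lam ->
     positive_eigenvalue_listing (G := lengthen e0 a_gt1)
       (lengthen_potential e0 a_gt1 q) lam' ->
     forall j, lam' j <= lam j) /\
  (forall lam lam' : nat -> R,
     eigenvalue_listing q lam ->
     eigenvalue_listing (G := lengthen e0 a_gt1)
       (lengthen_potential e0 a_gt1 q) lam' ->
     forall j, lam' j <= lam j).
Proof.
split=> lam lam'.
- move=> [lam_homo lam_gt0 lam_mult] [lam'_homo _ lam'_mult] j.
  have [kappa [sz kin kmult]] := positive_eigenvalues_lengthen q_adm e0 a_gt1 j lam_homo
    (fun nu n nu0 => (lam_mult nu n nu0).2).
  rewrite leNgt; apply/negP => lt_j.
  have : (size kappa <= j)%N.
    apply: (size_le_listing lam'_homo _ lt_j) => nu nuk.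
    by have /andP[nu0 nuj] := kin nu nuk; split=> //; apply/lam'_mult.
  rewrite sz (eq_card (B := 'I_j.+1)) ?card_ord ?ltnn// => i.
  by rewrite !inE lam_gt0.
- move=> [lam_homo lam_mult] [lam'_homo lam'_mult] j.
  have lam_ge0 i : 0 <= lam i.
    apply: (eigenvalue_ge0 q_adm); apply/lam_mult; exists [:: i].
    by split=> // k; rewrite inE => /eqP ->.
  have [kappa [sz kin kmult]] := positive_eigenvalues_lengthen q_adm e0 a_gt1 j lam_homo
    (fun nu n _ => (lam_mult nu n).2).
  pose n0 := #|[pred i : 'I_j.+1 | lam i == 0]|.
  (* By [kernel_dilate], 0 is an eigenvalue of the long graph at least this often. *)
  pose zeros : seq R := nseq n0 0.
  have mult0 : multiplicity_ge (G := lengthen e0 a_gt1) (lengthen_potential e0 a_gt1 q) 0 n0.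
    by apply: kernel_dilate; apply/lam_mult; apply: occurs_ge_inj; exact: val_inj.
  rewrite leNgt; apply/negP => lt_j.
  have : (size (zeros ++ kappa) <= j)%N.
    apply: (size_le_listing lam'_homo _ lt_j) => nu; rewrite mem_cat count_cat.
    have [->|nu0] := eqVneq nu 0.
      move=> _; split; first exact: lam_ge0.
      rewrite count_nseq /= eqxx mul1n (count_memPn _) ?addn0; first exact/lam'_mult.
      by apply/negP => /kin; rewrite ltxx.
    rewrite mem_nseq (negbTE nu0) andbF/= => nuk; have /andP[_ nuj] := kin nu nuk.
    split=> //; rewrite count_nseq/= eq_sym (negbTE nu0) mul0n add0n.
    by apply/lam'_mult.
  have -> : size (zeros ++ kappa) = j.+1; last by rewrite ltnn.
  rewrite size_cat size_nseq sz -[RHS]card_ord -(cardC [pred i : 'I_j.+1 | lam i == 0]).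
  by congr addn; apply: eq_card => i; rewrite !inE lt_neqAle eq_sym lam_ge0 andbT.
Qed.
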